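(* Let $n\ge1$, $\boldsymbol\beta_n=(\beta_0,\dots,\beta_n)$ with $\beta_k\ge0$, $f\in\mathcal{C}^{3,\boldsymbol\beta_n}_{loc}(V^2;V)$, and let $\mathbf{X}=(X,\mathbb{X})$ be a $V$-valued (linear) $\alpha$-Hölder rough path on $[0,T]$. Set $W(t,x)=f(X_t,x)$, $g(t,y)=D_2f(X_t,y)$, $g_{s,t}(y)=g(t,y)-g(s,y)$, and $$\mathbb{W}_{s,t}(x,y)=\int_s^tD_{21}f(X_r,y)f(X_r,x)\,d\mathbf{X}_r+\frac12\int_s^tD_{211}f(X_r,y)f(X_r,x)\,d\langle X\rangle_r-g_{s,t}(y)(f(X_s,x)).$$ Then $\mathbf{W}:=(W,\mathbb{W})$ is a nonlinear rough path: $\mathbf{W}\in\mathbf{C}^{\alpha,\boldsymbol\beta_n}([0,T]\times V;V)$.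
   Context: Fix $T>0$, $\alpha\in(\frac13,\frac12]$ and a separable Banach space $V$; $\Phi_{s,t}:=\Phi_t-\Phi_s$ for functions of time; tensor products carry the projective norm. Linear rough paths: $\mathbf{X}=(X,\mathbb{X})$ with $X:[0,T]\to V$ $\alpha$-Hölder, $\mathbb{X}:[0,T]^2\to V\otimes V$ with $\sup_{s\ne t}\|\mathbb{X}_{s,t}\|/|t-s|^{2\alpha}<\infty$, and $\mathbb{X}_{s,t}-\mathbb{X}_{s,u}-\mathbb{X}_{u,t}=X_{s,u}\otimes X_{u,t}$. Quadratic compensator: $\langle X\rangle_{s,t}=X_{s,t}\otimes X_{s,t}-2\mathbb{X}_{s,t}$. A path $H:[0,T]\to\mathcal{L}(V;V)$ is controlled by $X$ with Gubinelli derivative $H'$ if $H,H'$ are $\alpha$-Hölder ($H'_t\in\mathcal{L}(V;\mathcal{L}(V;V))$, identified with an element of $\mathcal{L}(V\otimes V;V)$ by $H'_t(v\otimes w)=(H'_tv)(w)$) and $\|H_{s,t}-H'_sX_{s,t}\|=O(|t-s|^{2\alpha})$; then $\int_s^tH_rd\mathbf{X}_r=\lim_{|\pi|\to0}\sum_k[H_{t_{k-1}}X_{t_{k-1},t_k}+H'_{t_{k-1}}\mathbb{X}_{t_{k-1},t_k}]$ over partitions $\pi$ of $[s,t]$. $\mathcal{C}^{m,\boldsymbol\beta_n}_{loc}(V^2;V)$: functions $f:V^2\to V$ with (continuous) mixed partial Fréchet derivatives such that for every compact $K\subset V$ $$\|f\|_{K,m,\boldsymbol\beta_n}=\sum_{j=0}^m\sum_{k=0}^n\sup_{x\in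 K,\,y\in V}\frac{\|D_2^kD_1^jf(x,y)\|}{(1+\|y\|_V)^{\beta_k}}<\infty,$$ where $D_1,D_2$ are the partial derivatives in the first and second argument. In the definition of $\mathbb{W}$: $D_{21}f(z,y)f(z,x)\in\mathcal{L}(V;V)$ is the operator $h^{x,y}(z)$ obtained from the mixed derivative of $f$ at $(z,y)$ by inserting $f(z,x)$ in the second-variable direction and leaving the first-variable direction free; the first integral is the linear rough integral of $r\mapsto h^{x,y}(X_r)$, which is controlled by $X$ with Gubinelli derivative $Dh^{x,y}(X_r)$ ($D$ = derivative in $z$). $D_{211}f(z,y)f(z,x)$ is the symmetric bilinear map $V\times V\to V$, extended to $V\otimes V$, given by the derivative of $f$ at $(z,y)$, once in the second variable in direction $f(z,x)$ and twice in the first variable. The second integral is the Young integral $\lim_{|\pi|\to0}\sum_kD_{211}f(X_{t_{k-1}},y)f(X_{t_{k-1}},x)\langle X\rangle_{t_{k-1},t_k}$. Nonlinear rough paths: $\mathcal{C}^{\alpha,\boldsymbol\beta_n}([0,T]\times V;V)$ is the space of $\Phi$, $n$ times continuously Fréchet differentiable in space, with $\sum_{k=0}^n\sup_{s\ne t,x}\|D^k\Phi_{s,t}(x)\|\,|t-s|^{-\alpha}(1+\|x\|_V)^{-\beta_k}<\infty$. For multi-indices $\boldsymbol\beta^1,\boldsymbol\beta^2$ of length $m+1$, $\mathcal{C}_2^{2\alpha,\boldsymbol\beta^1,\boldsymbol\beta^2}([0,T]^2\times V^2;V)$ is the space of $\Psi$, $m$ times continuously Fréchet differentiable in $(x_1,x_2)\in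 V^2$, with $\sum_{k=0}^m\sup_{s\ne t,x_1,x_2}\|D^k\Psi_{s,t}(x_1,x_2)\|\,|t-s|^{-2\alpha}(1+\|x_1\|_V)^{-\beta^1_k}(1+\|x_2\|_V)^{-\beta^2_k}<\infty$. Set $\boldsymbol\beta^*_{n-1}=(\beta^*_0,\dots,\beta^*_{n-1})$, $\boldsymbol\beta^{**}_{n-1}=(\beta^{**}_0,\dots,\beta^{**}_{n-1})$ with $\beta^*_k=\max\{\beta_0,\dots,\beta_k\}$, $\beta^{**}_k=\max\{\beta_1,\dots,\beta_{k+1}\}$. $\mathbf{C}^{\alpha,\boldsymbol\beta_n}([0,T]\times V;V)$ is the set of pairs $(W,\mathbb{W})$ with $W\in\mathcal{C}^{\alpha,\boldsymbol\beta_n}([0,T]\times V;V)$, $\mathbb{W}\in\mathcal{C}_2^{2\alpha,\boldsymbol\beta^*_{n-1},\boldsymbol\beta^{**}_{n-1}}([0,T]^2\times V^2;V)$ and $\mathbb{W}_{s,t}(x,y)-\mathbb{W}_{s,u}(x,y)-\mathbb{W}_{u,t}(x,y)=DW_{u,t}(y)(W_{s,u}(x))$ for all $x,y\in V$, $s,u,t\in[0,T]$. *)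

(* Defs.v *)
From HB Require Import structures.
From mathcomp Require Import all_boot all_order all_algebra.
From mathcomp Require Import all_classical all_reals all_analysis.
Set Implicit Arguments.
Unset Strict Implicit.
Unset Printing Implicit Defensive.
Import Order.TTheory GRing.Theory Num.Theory.
Import numFieldNormedType.Exports.
Local Open Scope classical_set_scope.
Local Open Scope ring_scope.

Definition bounded_op_pred (R : realType) (U W : normedModType R) : pred (U -> W) :=
  fun f => `[< linear f /\ continuous f >].
Arguments bounded_op_pred : clear implicits.

Section BoundedOpClosed.
Context (R : realType) (U W : normedModType R).

Fact bounded_op_submod_closed : submod_closed (bounded_op_pred R U W).
Proof.
split.
  apply/asboolP; split; last exact: cst_continuous.
  by move=> a u v; rewrite /= scaler0 addr0.
move=> a f g /asboolP[lf cf] /asboolP[lg cg]; apply/asboolP; split.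
  move=> b u v; rewrite !fctE lf lg.
  by rewrite !scalerDr !scalerA [b * a]mulrC addrACA.
move=> u; apply: cvgD; last exact: cg.
by apply: cvgZl_tmp; exact: cf.
Qed.

HB.instance Definition _ := GRing.isSubmodClosed.Build R (U -> W)
  (bounded_op_pred R U W) bounded_op_submod_closed.

End BoundedOpClosed.

Record bounded_op (R : realType) (U W : normedModType R) : Type :=
  BoundedOp { bop_fun :> U -> W ; _ : bop_fun \in bounded_op_pred R U W }.
Arguments bounded_op {R} U W.

Notation "''L' ( U ; W )" := (@bounded_op _ U W)
  (at level 8, format "''L' ( U ;  W )") : type_scope.

HB.instance Definition _ (R : realType) (U W : normedModType R) :=
  [isSub for @bop_fun R U W].
HB.instance Definition _ (R : realType) (U W : normedModType R) :=
  [Choice of 'L(U; W) by <:].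
HB.instance Definition _ (R : realType) (U W : normedModType R) :=
  [SubChoice_isSubLmodule of 'L(U; W) by <:].

Section BoundedOpNorm.
Context (R : realType) (U W : normedModType R).
Implicit Types A B : 'L(U; W).

Lemma bop_linear A : linear A.
Proof. by have /asboolP[] := valP A. Qed.

Lemma bop_continuous A : continuous A.
Proof. by have /asboolP[] := valP A. Qed.

HB.instance Definition _ A :=
  GRing.isLinear.Build R U W *:%R (A : U -> W) (bop_linear A).

Definition opnorm A : R := sup [set `|A u| | u in [set u : U | `|u| <= 1]].

Lemma opnorm_has_sup A : has_sup [set `|A u| | u in [set u : U | `|u| <= 1]].
Proof.
split; first by exists `|A 0|, 0 => //=; rewrite normr0.
have /linear_boundedP := continuous_linear_bounded 0 (@bop_continuous A 0).
move=> /pinfty_ex_gt0[M M0 AM]; exists M => _ [u /= u1 <-].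
by rewrite (le_trans (AM u))// ler_piMr// ltW.
Qed.

Lemma opnorm_ge0 A : 0 <= opnorm A.
Proof.
apply: (le_trans (normr_ge0 (A 0))); apply: sup_ubound.
  by have [] := opnorm_has_sup A.
by exists 0 => //=; rewrite normr0.
Qed.

Lemma opnormP A u : `|A u| <= opnorm A * `|u|.
Proof.
have [->|u0] := eqVneq u 0; first by rewrite linear0 !normr0 mulr0.
have nu0 : 0 < `|u| by rewrite normr_gt0.
rewrite -ler_pdivrMr// mulrC -[X in X * _]ger0_norm ?invr_ge0// -normrZ -linearZ.
apply: sup_ubound; first by have [] := opnorm_has_sup A.
by exists (`|u|^-1 *: u) => //=; rewrite normrZ ger0_norm ?invr_ge0// mulVf ?gt_eqF.
Qed.

Lemma opnorm_le A (M : R) : 0 <= M -> (forall u, `|A u| <= M * `|u|) -> opnorm A <= M.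
Proof.
move=> M0 AM; apply: ge_sup; first by have [] := opnorm_has_sup A.
by move=> _ [u /= u1 <-]; rewrite (le_trans (AM u))// ler_piMr.
Qed.

Let opnormD A B : opnorm (A + B) <= opnorm A + opnorm B.
Proof.
apply: opnorm_le; first by rewrite addr_ge0// opnorm_ge0.
by move=> u; rewrite mulrDl (le_trans (ler_normD _ _))// lerD// opnormP.
Qed.

Let opnormZ_le (a : R) A : opnorm (a *: A) <= `|a| * opnorm A.
Proof.
apply: opnorm_le; first by rewrite mulr_ge0// opnorm_ge0.
by move=> u; rewrite normrZ -mulrA ler_wpM2l// opnormP.
Qed.

Let opnormZ (a : R) A : opnorm (a *: A) = `|a| * opnorm A.
Proof.
apply/eqP; rewrite eq_le opnormZ_le /=.
have [->|a0] := eqVneq a 0; first by rewrite normr0 mul0r opnorm_ge0.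
rewrite -ler_pdivlMl ?normr_gt0// -normfV.
by rewrite -{1}[A]scale1r -(mulVf a0) -scalerA opnormZ_le.
Qed.

Let opnorm0_eq0 A : opnorm A = 0 -> A = 0.
Proof.
move=> A0; apply/val_inj/funext => u /=.
by apply/eqP; rewrite -normr_le0 (le_trans (opnormP A u))// A0 mul0r.
Qed.

HB.instance Definition _ :=
  Lmodule_isNormed.Build R 'L(U; W) opnormD opnormZ opnorm0_eq0.

Lemma bop_normE A : `|A| = opnorm A. Proof. by []. Qed.

End BoundedOpNorm.

Section Frechet.
Context (R : realType).

(* junk value 0 when ['d f x] is not continuous *)
Definition fderive (U W : normedModType R) (f : U -> W) (x : U) : 'L(U; W) :=
  insubd (0 : 'L(U; W)) ('d f x : U -> W).

Lemma fderiveE (U W : normedModType R) (f : U -> W) (x : U) :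
  differentiable f x -> fderive f x = 'd f x :> (U -> W).
Proof.
move=> dfx; rewrite /fderive insubdK//; apply/asboolP; split.
  by move=> a u v; rewrite linearP.
exact: diff_continuous.
Qed.

(* L(U; L(U; ... L(U; W))), i.e. the bounded k-linear maps U^k -> W *)
Fixpoint multi_op (k : nat) (U W : normedModType R) : normedModType R :=
  if k is k'.+1 then 'L(U; multi_op k' U W) else W.

Fixpoint fderiven (U W : normedModType R) (k : nat) (f : U -> W) :
    U -> multi_op k U W :=
  if k is k'.+1 then fderive (fderiven k' f) else f.

Definition Cdiff (U W : normedModType R) (n : nat) (f : U -> W) : Prop :=
  (forall k, (k < n)%N -> forall x, differentiable (fderiven k f) x) /\
  (forall k, (k <= n)%N -> continuous (fderiven k f)).

Definition D1 (U1 U2 W : normedModType R) (f : U1 -> U2 -> W)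
  (x : U1) (y : U2) : 'L(U1; W) := fderive (f^~ y) x.

Definition D2 (U1 U2 W : normedModType R) (f : U1 -> U2 -> W)
  (x : U1) (y : U2) : 'L(U2; W) := fderive (f x) y.

Definition D1n (U1 U2 W : normedModType R) (j : nat) (f : U1 -> U2 -> W)
  (x : U1) (y : U2) : multi_op j U1 W := fderiven j (f^~ y) x.

Definition D2n (U1 U2 W : normedModType R) (k : nat) (f : U1 -> U2 -> W)
  (x : U1) (y : U2) : multi_op k U2 W := fderiven k (f x) y.

End Frechet.

Definition separable (T : topologicalType) : Prop :=
  exists2 A : set T, countable A & dense A.

Section Cloc.
Context (R : realType) (V : normedModType R).
Implicit Types (f : V -> V -> V) (beta : nat -> R).

Definition mixed_continuously_differentiable (m n : nat) f : Prop :=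
  [/\ forall j, (j < m)%N -> forall x y, differentiable ((D1n j f)^~ y) x,
      forall j k, (j <= m)%N -> (k < n)%N ->
        forall x y, differentiable (D2n k (D1n j f) x) y &
      forall j k, (j <= m)%N -> (k <= n)%N ->
        continuous (fun p : V * V => D2n k (D1n j f) p.1 p.2)].

Definition Cloc_norm (K : set V) (m n : nat) beta f : \bar R :=
  (\sum_(j < m.+1) \sum_(k < n.+1)
    ereal_sup [set (`|D2n k (D1n j f) p.1 p.2| / (1 + `|p.2|) `^ beta k)%:E
              | p in K `*` [set: V]])%E.

Definition Cloc (m n : nat) beta f : Prop :=
  mixed_continuously_differentiable m n f /\
  (forall K : set V, compact K -> (Cloc_norm K m n beta f < +oo)%E).

End Cloc.

Section ProjectiveTensor.
Context (R : realType) (V : normedModType R) (E : completeNormedModType R).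
Variable ot : {bilinear V -> V -> E}.

Definition tensor_sum (s : seq (V * V)) : E := \sum_(p <- s) ot p.1 p.2.

(* [(E, ot)] is the completion of the algebraic tensor product of V with itself
   for the projective norm: the span of the elementary tensors is the algebraic
   tensor product (only the relations valid under every bilinear map hold in it),
   carries the projective norm, and is dense.  This determines [(E, ot)] up to
   isometric isomorphism. *)
Record projective_tensor : Prop := {
  pt_universal : forall (F : lmodType R) (B : {bilinear V -> V -> F}) s,
    tensor_sum s = 0 -> \sum_(p <- s) B p.1 p.2 = 0 ;
  pt_norm : forall s, `|tensor_sum s| =
    inf [set \sum_(p <- s') `|p.1| * `|p.2|
        | s' in [set s' | tensor_sum s' = tensor_sum s]] ;
  pt_dense : dense (range tensor_sum)
}.

(* identification of L(V; L(V; W)) with L(V (x) V; W), B |-> (v (x) w |-> B v w) *)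
Definition tensor_lift (W : normedModType R) (B : 'L(V; 'L(V; W))) : 'L(E; W) :=
  xget 0 [set L : 'L(E; W) | forall v w, L (ot v w) = B v w].

End ProjectiveTensor.

Section GermIntegral.
Context (R : realType).

(* [itv_partition a b p] means a = t_0 < t_1 < ... < t_N = b, p = [:: t_1; ...; t_N] *)
Definition mesh (a b : R) (p : seq R) : R :=
  \big[Num.max/0]_(0 <= k < size p) (nth b (a :: p) k.+1 - nth b (a :: p) k).

Definition mesh_filter (a b : R) : set_system (seq R) :=
  filter_from [set d : R | 0 < d] (fun d => [set p | itv_partition a b p /\ mesh a b p < d]).

Definition partition_sum (V : normedModType R) (Xi : R -> R -> V) (a b : R)
    (p : seq R) : V :=
  \sum_(0 <= k < size p) Xi (nth b (a :: p) k) (nth b (a :: p) k.+1).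

(* oriented integral; [lim] takes an arbitrary value when the limit does not exist *)
Definition germ_integral (V : normedModType R) (Xi : R -> R -> V) (s t : R) : V :=
  if s <= t then lim (partition_sum Xi s t @ mesh_filter s t)
  else - lim (partition_sum Xi t s @ mesh_filter t s).

End GermIntegral.

Section LinearRoughPath.
Context (R : realType) (V : normedModType R) (E : completeNormedModType R).
Variables (T alpha : R) (ot : {bilinear V -> V -> E}).
Implicit Types (X : R -> V) (XX : R -> R -> E).

(* paths on [0, T] are represented by functions on R whose values outside
   [0, T] are irrelevant *)
Record rough_path X XX : Prop := {
  rp_holder : exists C : R, forall s t, s \in `[0, T] -> t \in `[0, T] ->
    `|X t - X s| <= C * `|t - s| `^ alpha ;
  rp_holder2 : exists C : R, forall s t, s \in `[0, T] -> t \in `[0, T] -> s != t ->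
    `|XX s t| / `|t - s| `^ (2 * alpha) <= C ;
  rp_chen : forall s u t, s \in `[0, T] -> u \in `[0, T] -> t \in `[0, T] ->
    XX s t - XX s u - XX u t = ot (X u - X s) (X t - X u)
}.

Definition compensator X XX (s t : R) : E :=
  ot (X t - X s) (X t - X s) - 2 *: XX s t.

Definition rough_integral X XX (H : R -> 'L(V; V)) (H' : R -> 'L(V; 'L(V; V)))
    (s t : R) : V :=
  germ_integral (fun a b => H a (X b - X a) + tensor_lift ot (H' a) (XX a b)) s t.

Definition young_integral (A : R -> 'L(V; 'L(V; V))) (Q : R -> R -> E)
    (s t : R) : V :=
  germ_integral (fun a b => tensor_lift ot (A a) (Q a b)) s t.

End LinearRoughPath.

Section NonlinearRoughPath.
Context (R : realType) (V : normedModType R).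
Variables (T alpha : R).
(* only [beta 0, ..., beta n] are used from a multi-index [beta] of length n + 1 *)
Implicit Types (beta : nat -> R) (Phi : R -> V -> V) (Psi : R -> R -> V -> V -> V).

Definition time_pairs : set (R * R) :=
  [set st | [/\ st.1 \in `[0, T], st.2 \in `[0, T] & st.1 != st.2]].

Definition Calpha_norm (n : nat) beta Phi : \bar R :=
  (\sum_(k < n.+1)
    ereal_sup [set (`|fderiven k (fun x' => Phi q.1.2 x' - Phi q.1.1 x') q.2|
                    * `|q.1.2 - q.1.1| `^ (- alpha)
                    * (1 + `|q.2|) `^ (- beta k))%:E
              | q in time_pairs `*` [set: V]])%E.

Definition Calpha (n : nat) beta Phi : Prop :=
  (forall t, t \in `[0, T] -> Cdiff n (Phi t)) /\
  (Calpha_norm n beta Phi < +oo)%E.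

Definition uncurry2 Psi (s t : R) (p : V * V) : V := Psi s t p.1 p.2.

Definition C2alpha_norm (m : nat) beta1 beta2 Psi : \bar R :=
  (\sum_(k < m.+1)
    ereal_sup [set (`|fderiven k (uncurry2 Psi q.1.1 q.1.2) q.2|
                    * `|q.1.2 - q.1.1| `^ (- (2 * alpha))
                    * (1 + `|q.2.1|) `^ (- beta1 k)
                    * (1 + `|q.2.2|) `^ (- beta2 k))%:E
              | q in time_pairs `*` [set: V * V]])%E.

Definition C2alpha (m : nat) beta1 beta2 Psi : Prop :=
  (forall s t, s \in `[0, T] -> t \in `[0, T] -> Cdiff m (uncurry2 Psi s t)) /\
  (C2alpha_norm m beta1 beta2 Psi < +oo)%E.

Definition beta_star beta (k : nat) : R :=
  \big[Num.max/beta 0%N]_(0 <= i < k.+1) beta i.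

Definition beta_sstar beta (k : nat) : R :=
  \big[Num.max/beta 1%N]_(1 <= i < k.+2) beta i.

Record nonlinear_rough_path (n : nat) beta Phi Psi : Prop := {
  nrp_path : Calpha n beta Phi ;
  nrp_area : C2alpha n.-1 (beta_star beta) (beta_sstar beta) Psi ;
  nrp_chen : forall (x y : V) s u t, s \in `[0, T] -> u \in `[0, T] -> t \in `[0, T] ->
    Psi s t x y - Psi s u x y - Psi u t x y =
    fderive (fun y' => Phi t y' - Phi u y') y (Phi u x - Phi s x)
}.

End NonlinearRoughPath.

(* Main.v *)
From HB Require Import structures.
Require Import Defs.
From mathcomp Require Import all_boot all_order all_algebra.
From mathcomp Require Import all_classical all_reals all_analysis.
From mathcomp Require Import ring lra.
Import Order.TTheory GRing.Theory Num.Theory.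
Import numFieldNormedType.Exports.
Local Open Scope classical_set_scope.
Local Open Scope ring_scope.

(** Write h for |t - s|^alpha.  The first component moves by O(h) because f is
    C^1 in its first argument, the path moves by O(h), and the increment can be
    estimated after differentiating any number of times in the second argument:
    the two partial derivatives commute ([schwarz]), so the mean value theorem
    in the first variable holds in C^n ([Cfam_mvt]).

    For the second component the two integrals are constructed at once for all
    (x, y), as values in a space of C^(n-1) functions with polynomial weights.
    With H(z)(x, y) = D21 f(z, y) f(z, x), H' its derivative in z and
    A(z)(x, y) = D211 f(z, y) f(z, x), the germs are
      H(X_s) X_{s,t} + H'(X_s) XX_{s,t}   and   A(X_s) <X>_{s,t}.
    By the relation of Chen for XX, the defect of additivity of the first one
    between s, u and t is
      - (H(X_u) - H(X_s) - H'(X_s) X_{s,u}) X_{u,t} - (H'(X_u) - H'(X_s)) XX_{u,t},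
    which is O(h^3) since f has three derivatives in its first argument.  The
    bracket <X> fails to be additive by an antisymmetric tensor only, which the
    symmetric map A does not see, so the second defect is O(h^3) as well.  As
    3 alpha > 1, the sewing lemma ([sewing], [sewing_cball]) provides additive
    two-parameter functions at distance O(h^3) from the germs, in C^(n-1) with
    weights, and their values are the limits of the Riemann sums
    ([germ_integralE]).

    The relation of Chen for the pair is then immediate: the integrals are
    additive and the whole defect comes from g_{s,t}(y)(f(X_s, x)).  For the
    bound of order 2 alpha, integrals may be replaced by their germs, every
    term with XX or <X> is O(h^2), and what remains,
      H(X_s)(x, y) X_{s,t} - g_{s,t}(y)(f(X_s, x)),
    is the second order Taylor remainder of z |-> D2 f(z, y) at X_s, evaluated
    at f(X_s, x), because D1 D2 f is D2 D1 f with its arguments exchanged.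
    All of this is collected in [area_spec].

    No function space is constructed: [cball m w c f] says that f is C^m with
    k-th derivatives at most c * w k, and [Cfam] is the version for functions
    that depend continuously on a parameter.  Both peel off the innermost
    derivative, so that proofs by induction on m pass from f to its derivative
    and only change the target space. *)

Set Implicit Arguments.
Unset Strict Implicit.
Unset Printing Implicit Defensive.

(** * Identities in abelian groups *)

(** A decision procedure for identities between sums, opposites and zero in an
    abelian group, by comparison of the integer coefficients of the atoms;
    it serves in normed spaces and spaces of operators, which are not rings. *)
Section AbelianReflection.
Context {G : zmodType}.

Inductive zexpr := ZVar of nat | ZAdd of zexpr & zexpr | ZOpp of zexpr | ZZero.

Fixpoint zeval (env : seq G) e : G :=
  match e with
  | ZVar n => nth 0 env n
  | ZAdd a b => zeval env a + zeval env b
  | ZOpp a => - zeval env a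
  | ZZero => 0
  end.

Fixpoint zcoef e (n : nat) : int :=
  match e with
  | ZVar m => if m == n then 1 else 0
  | ZAdd a b => zcoef a n + zcoef b n
  | ZOpp a => - zcoef a n
  | ZZero => 0
  end.

Lemma zevalE env e :
  zeval env e = \sum_(i < size env) nth 0 env i *~ zcoef e i.
Proof.
elim: e => [n|a IHa b IHb|a IHa|] /=.
- have [ns|ns] := ltnP n (size env).
    rewrite (bigD1 (Ordinal ns))//= eqxx mulr1z big1 ?addr0// => i ni.
    by case: eqP => // e; case/eqP: ni; apply: val_inj.
  rewrite nth_default// big1// => i _; case: eqP => // e.
  by have := ltn_ord i; rewrite -e ltnNge ns.
- by rewrite IHa IHb -big_split; apply: eq_bigr => i _; rewrite mulrzDr.
- by rewrite IHa -sumrN; apply: eq_bigr => i _; rewrite mulrNz.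
- by rewrite big1.
Qed.

Lemma zevalP env a b :
  all (fun i => zcoef a i == zcoef b i) (iota 0 (size env)) ->
  zeval env a = zeval env b.
Proof.
move=> /allP ab; rewrite !zevalE; apply: eq_bigr => i _.
have /eqP-> // : zcoef a i == zcoef b i.
by apply: ab; rewrite mem_iota /= add0n ltn_ord.
Qed.

End AbelianReflection.

Ltac zsame strict x y :=
  lazymatch strict with
  | true => match constr:(Set) with _ => constr_eq x y end
  | false => match constr:(Set) with _ => unify x y end
  end.
Ltac zmem strict x l :=
  match l with
  | nil => constr:(false)
  | ?y :: _ => let _ := zsame strict x y in constr:(true)
  | _ :: ?l' => zmem strict x l'
  end.
Ltac zindex strict x l :=
  match l with
  | ?y :: _ => let _ := zsame strict x y in constr:(0%N)
  | _ :: ?l' => let n := zindex strict x l' in constr:(S n)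
  end.
Ltac zatoms strict l t :=
  lazymatch t with
  | ?a + ?b => let l := zatoms strict l a in zatoms strict l b
  | - ?a => zatoms strict l a
  | 0 => l
  | _ => match zmem strict t l with true => l | false => constr:(t :: l) end
  end.
Ltac zreify strict l t :=
  lazymatch t with
  | ?a + ?b => let a := zreify strict l a in let b := zreify strict l b in constr:(ZAdd a b)
  | - ?a => let a := zreify strict l a in constr:(ZOpp a)
  | 0 => constr:(ZZero)
  | _ => let n := zindex strict t l in constr:(ZVar n)
  end.
Ltac zsolve strict :=
  lazymatch goal with |- @eq ?T ?a ?b =>
    let l := zatoms strict (@nil T) a in
    let l := zatoms strict l b in
    let ea := zreify strict l a in
    let eb := zreify strict l b in
    apply: (@zevalP _ l ea eb); vm_compute; reflexivity
  end.
(* atoms are first compared up to syntax, then up to conversion *)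
Ltac abel := first [zsolve true | zsolve false].

(** * Bounded operators *)

Section Operators.
Context {R : realType}.
Implicit Types N U W Z : normedModType R.

Lemma bounded_op_bounded U W (f : U -> W) (M : R) :
  linear f -> (forall u, `|f u| <= M * `|u|) -> f \in bounded_op_pred R U W.
Proof.
move=> lf fM; apply/asboolP; split => //.
pose lm := GRing.isLinear.Build R U W *:%R f lf.
pose L : {linear U -> W} := HB.pack f lm.
apply: (@bounded_linear_continuous R U W L).
apply/linear_boundedP; near=> r => x.
apply: (le_trans (fM x)); rewrite ler_wpM2r//; near: r.
Unshelve. all: by end_near. Qed.

Definition mkop U W (f : U -> W) (M : R) (lf : linear f)
  (fM : forall u, `|f u| <= M * `|u|) : 'L(U; W) :=
  BoundedOp (bounded_op_bounded lf fM).

Lemma mkopE U W (f : U -> W) M lf fM u : @mkop U W f M lf fM u = f u.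
Proof. by []. Qed.

Lemma norm_mkop U W (f : U -> W) M lf fM : 0 <= M -> `|@mkop U W f M lf fM| <= M.
Proof. by move=> M0; apply: opnorm_le. Qed.

Lemma op_ext U W (L L' : 'L(U; W)) : (forall u, L u = L' u) -> L = L'.
Proof. by move=> H; apply/val_inj/funext. Qed.

Lemma opD U W (L L' : 'L(U; W)) u : (L + L') u = L u + L' u. Proof. by []. Qed.
Lemma opN U W (L : 'L(U; W)) u : (- L) u = - L u. Proof. by []. Qed.
Lemma opB U W (L L' : 'L(U; W)) u : (L - L') u = L u - L' u. Proof. by []. Qed.
Lemma opZ U W a (L : 'L(U; W)) u : (a *: L) u = a *: L u. Proof. by []. Qed.
Lemma op0 U W u : (0 : 'L(U; W)) u = 0. Proof. by []. Qed.

Lemma bopD U W (L : 'L(U; W)) u v : L (u + v) = L u + L v.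
Proof. exact: linearD. Qed.
Lemma bopB U W (L : 'L(U; W)) u v : L (u - v) = L u - L v.
Proof. exact: linearB. Qed.
Lemma bopN U W (L : 'L(U; W)) u : L (- u) = - L u.
Proof. exact: linearN. Qed.
Lemma bopZ U W (L : 'L(U; W)) a u : L (a *: u) = a *: L u.
Proof. exact: linearZ. Qed.
Lemma bop0 U W (L : 'L(U; W)) : L 0 = 0.
Proof. exact: linear0. Qed.

Lemma norm_op_le U W (L : 'L(U; W)) u : `|L u| <= `|L| * `|u|.
Proof. exact: opnormP. Qed.

Lemma op_norm_le U W (L : 'L(U; W)) M :
  0 <= M -> (forall u, `|L u| <= M * `|u|) -> `|L| <= M.
Proof. exact: opnorm_le. Qed.

Lemma norm_op2_le U W N (L : 'L(U; 'L(W; N))) u v : `|L u v| <= `|L| * `|u| * `|v|.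
Proof.
by apply: (le_trans (norm_op_le _ _)); rewrite ler_wpM2r// norm_op_le.
Qed.

Section op_comp.
Variables (U W N : normedModType R).
Implicit Types (A : 'L(W; N)) (B : 'L(U; W)).
Fact op_comp_linear (A : 'L(W; N)) (B : 'L(U; W)) : linear (fun u => A (B u)).
Proof. by move=> a u v; rewrite !linearP. Qed.
Fact op_comp_bounded (A : 'L(W; N)) (B : 'L(U; W)) u :
  `|A (B u)| <= `|A| * `|B| * `|u|.
Proof.
by apply: (le_trans (norm_op_le _ _)); rewrite -mulrA ler_wpM2l// norm_op_le.
Qed.
Definition op_comp A B : 'L(U; N) := mkop (op_comp_linear A B) (op_comp_bounded A B).
Lemma op_compE A B u : op_comp A B u = A (B u). Proof. by []. Qed.
Lemma norm_op_comp A B : `|op_comp A B| <= `|A| * `|B|.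
Proof. exact: norm_mkop. Qed.

Fact op_compl_linear A : linear (op_comp A).
Proof. by move=> a B C; apply: op_ext => u; rewrite /= linearP. Qed.
Definition op_compl A : 'L('L(U; W); 'L(U; N)) :=
  mkop (op_compl_linear A) (norm_op_comp A).
Fact op_compL_linear : linear op_compl.
Proof. by move=> a A B; apply: op_ext => C; apply: op_ext => u. Qed.
Fact op_compL_bounded A : `|op_compl A| <= 1 * `|A|.
Proof. by rewrite mul1r norm_mkop. Qed.
(** Composition, the exchange of arguments [flipL] and evaluation are themselves
    bounded operators.  With [op_compl], they write both terms of the Leibniz
    rule for a bounded bilinear map as bounded bilinear maps again. *)
Definition op_compL : 'L('L(W; N); 'L('L(U; W); 'L(U; N))) :=
  mkop op_compL_linear op_compL_bounded.
Lemma norm_op_compL : `|op_compL| <= 1. Proof. exact: norm_mkop. Qed.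
End op_comp.

Section flip.
Variables (U W N : normedModType R).
Implicit Types B : 'L(U; 'L(W; N)).
Fact flip1_linear B w : linear (fun u => B u w).
Proof. by move=> a u v; rewrite linearP. Qed.
Fact flip1_bounded B w u : `|B u w| <= `|B| * `|w| * `|u|.
Proof. by rewrite mulrAC norm_op2_le. Qed.
Definition flip1 B w : 'L(U; N) := mkop (flip1_linear B w) (flip1_bounded B w).
Fact flip_linear B : linear (flip1 B).
Proof. by move=> a u v; apply: op_ext => w; rewrite /= linearP. Qed.
Fact flip_bounded B w : `|flip1 B w| <= `|B| * `|w|.
Proof. exact: norm_mkop. Qed.
Definition flip B : 'L(W; 'L(U; N)) := mkop (flip_linear B) (flip_bounded B).
Lemma flipE B w u : flip B w u = B u w. Proof. by []. Qed.
Lemma norm_flip B : `|flip B| <= `|B|. Proof. exact: norm_mkop. Qed.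
Fact flipL_linear : linear flip.
Proof. by move=> a A B; apply: op_ext => w; apply: op_ext => u. Qed.
Fact flipL_bounded B : `|flip B| <= 1 * `|B|.
Proof. by rewrite mul1r norm_flip. Qed.
Definition flipL : 'L('L(U; 'L(W; N)); 'L(W; 'L(U; N))) :=
  mkop flipL_linear flipL_bounded.
Lemma norm_flipL : `|flipL| <= 1. Proof. exact: norm_mkop. Qed.
End flip.

Section ev.
Variables (U N : normedModType R).
Fact idop_bounded (u : U) : `|u| <= 1 * `|u|. Proof. by rewrite mul1r. Qed.
Fact idop_linear : linear (fun u : U => u). Proof. by []. Qed.
Definition idop : 'L(U; U) := mkop idop_linear idop_bounded.
Lemma norm_idop : `|idop| <= 1. Proof. exact: norm_mkop. Qed.
End ev.

Definition evL U N (u : U) : 'L('L(U; N); N) := flip (idop 'L(U; N)) u.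

Lemma evLE U N (u : U) (L : 'L(U; N)) : evL N u L = L u. Proof. by []. Qed.
Lemma norm_evL U N (u : U) : `|evL N u| <= `|u|.
Proof.
apply: op_norm_le => // L; rewrite evLE mulrC; exact: norm_op_le.
Qed.

Section proj.
Variables (U W : normedModType R).
Fact fst_linear : linear (fun p : U * W => p.1). Proof. by []. Qed.
Fact snd_linear : linear (fun p : U * W => p.2). Proof. by []. Qed.
Fact fst_bounded (p : U * W) : `|p.1| <= 1 * `|p|.
Proof. by rewrite mul1r prod_normE le_max lexx. Qed.
Fact snd_bounded (p : U * W) : `|p.2| <= 1 * `|p|.
Proof. by rewrite mul1r prod_normE le_max lexx orbT. Qed.
Definition fstL : 'L((U * W)%type; U) := mkop fst_linear fst_bounded.
Definition sndL : 'L((U * W)%type; W) := mkop snd_linear snd_bounded.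
Lemma norm_fstL : `|fstL| <= 1. Proof. exact: norm_mkop. Qed.
Lemma norm_sndL : `|sndL| <= 1. Proof. exact: norm_mkop. Qed.
End proj.

End Operators.

(** * Completeness of spaces of bounded operators *)

Section Complete.
Context {R : realType} (U : normedModType R) (W : completeNormedModType R).

(** On a Cauchy filter the operators converge pointwise; the pointwise limit is
    within e |u| of every operator whose e-ball belongs to the filter, and this
    gives linearity, boundedness and convergence in norm. *)
Lemma bounded_op_complete (F : set_system 'L(U; W)) :
  ProperFilter F -> cauchy F -> cvg F.
Proof.
move=> FF Fc.
have Fex e : 0 < e -> exists L0, F (ball L0 e).
  by move: e; apply/cauchyP.
have lim_ex u : exists a : W, forall e L0, 0 < e -> F (ball L0 e) ->
    `|a - L0 u| <= e * `|u|.
  have : cvg ((fun L : 'L(U; W) => L u) @ F).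
    apply: cauchy_cvg; apply: cauchy_exP => e e0.
    have [L0 FL0] := Fex (e / (1 + `|u|)) (divr_gt0 e0 (ltr_pwDl ltr01 (normr_ge0 u))).
    exists (L0 u); rewrite /=; near=> L; rewrite /= -ball_normE /= -opB.
    apply: le_lt_trans (norm_op_le _ _) _.
    have : ball L0 (e / (1 + `|u|)) L by near: L.
    rewrite -ball_normE /= ltr_pdivlMr ?ltr_pwDl// mulrDr mulr1.
    by apply: le_lt_trans; rewrite lerDr.
  move=> /cvg_ex[a La]; exists a => e L0 e0 FL0.
  apply/ler_addgt0Pr => d d0.
  have /cvgrPdist_le/(_ d d0) Ld := La.
  have [L [L0L aL]] := filter_ex (filterI FL0 Ld).
  have -> : a - L0 u = (L - L0) u + (a - L u) by rewrite opB; abel.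
  apply: le_trans (ler_normD _ _) _; rewrite lerD//.
  apply: le_trans (norm_op_le _ _) _.
  by rewrite ler_wpM2r// distrC ltW//; move: L0L; rewrite -ball_normE.
have [A AP] := choice lim_ex.
have Alin : linear A.
  move=> a u v; apply/eqP; rewrite -subr_eq0 -normr_le0.
  apply/ler_addgt0Pr => e e0; rewrite add0r.
  pose C := `|a *: u + v| + `|a| * `|u| + `|v|.
  have C0 : 0 <= C by rewrite !addr_ge0// mulr_ge0.
  have d0 : 0 < e / (1 + C) by rewrite divr_gt0// ltr_pwDl.
  have [L0 FL0] := Fex _ d0.
  have -> : A (a *: u + v) - (a *: A u + A v) =
     (A (a *: u + v) - L0 (a *: u + v)) - (a *: (A u - L0 u) + (A v - L0 v)).
    by rewrite bopD bopZ scalerBr; abel.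
  apply: (@le_trans _ _ (e / (1 + C) * C)); last first.
    by rewrite mulrAC ler_pdivrMr ?ltr_pwDl// ler_pM2l// lerDr.
  move: (e / (1 + C)) d0 FL0 => c d0 FL0.
  apply: le_trans (ler_normB _ _) _; rewrite /C -addrA mulrDr; apply: lerD; first exact: AP _ _ _ d0 FL0.
  apply: le_trans (ler_normD _ _) _; rewrite mulrDr; apply: lerD; last exact: AP _ _ _ d0 FL0.
  by rewrite normrZ mulrCA ler_wpM2l//; exact: AP _ _ _ d0 FL0.
have [L1 FL1] := Fex 1 ltr01.
have Abd u : `|A u| <= (1 + `|L1|) * `|u|.
  rewrite -(subrK (L1 u) (A u)) (le_trans (ler_normD _ _))// mulrDl lerD//.
    exact: AP.
  exact: norm_op_le.
apply/cvg_ex; exists (mkop Alin Abd); apply/cvgrPdist_le => e e0.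
have e20 : 0 < e / 2 by rewrite divr_gt0.
have [L0 FL0] := Fex (e / 2) e20; near=> L.
have : ball L0 (e / 2) L by near: L.
rewrite -ball_normE /= => L0L.
rewrite -(subrK L0 (mkop _ _)) -addrA (splitr e) (le_trans (ler_normD _ _))// lerD// ?(ltW L0L)//.
by apply: op_norm_le => [|u]; [exact: ltW|rewrite opB mkopE; exact: AP].
Unshelve. all: by end_near. Qed.

End Complete.

HB.instance Definition _ (R : realType) (U : normedModType R)
  (W : completeNormedModType R) :=
  Uniform_isComplete.Build 'L(U; W) (@bounded_op_complete R U W).

(** * Fréchet derivatives *)

Section FrechetDerivative.
Context {R : realType}.
Implicit Types N U W Z : normedModType R.

Definition is_fderive U N (f : U -> N) (x : U) (L : 'L(U; N)) : Prop :=
  forall e : R, 0 < e -> \forall h \near (0 : U), `|f (x + h) - f x - L h| <= e * `|h|.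

Lemma near_and (T : topologicalType) (x : T) (P Q : T -> Prop) :
  (\forall h \near x, P h) -> (\forall h \near x, Q h) ->
  \forall h \near x, P h /\ Q h.
Proof. exact: filterI. Qed.

Lemma near_imp (T : topologicalType) (x : T) (P Q : T -> Prop) :
  (forall h, P h -> Q h) -> (\forall h \near x, P h) -> \forall h \near x, Q h.
Proof. exact: filterS. Qed.

(** The bridge between the epsilon formulation, in which all the calculus below
    is done, and differentiability in the sense of little-o. *)
Lemma is_fderiveP U N (f : U -> N) x (L : 'L(U; N)) :
  is_fderive f x L <-> differentiable f x /\ fderive f x = L.
Proof.
have E (D : U -> N) : (f \o shift x = cst (f x) + D +o_ 0 id) <->
    forall e : R, 0 < e -> \forall h \near (0 : U), `|f (x + h) - f x - D h| <= e * `|h|.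
  split=> [/eqaddoP H e e0|H].
    have := H e e0; apply: near_imp => h.
    by rewrite -[(f \o shift x - (cst (f x) + D)) h]/(f (h + x) - (f x + D h)) opprD [h + x]addrC addrA.
  apply/eqaddoP => e e0; have := H e e0; apply: near_imp => h /=.
  by rewrite -[(f \o shift x - (cst (f x) + D)) h]/(f (h + x) - (f x + D h)) opprD [h + x]addrC addrA.
split=> [/E fL|[df <-]]; last first.
  have /diff_locallyP[_ /E H] := df.
  by move=> e /H; apply: near_imp => h; rewrite fderiveE.
have dE : 'd f x = L :> (U -> N).
  by rewrite (diff_unique (@bop_continuous _ _ _ L) fL).
have df : differentiable f x.
  by apply/diff_locallyP; rewrite dE; split => //; exact: bop_continuous.
split=> //; apply: op_ext => u; by rewrite fderiveE// dE.
Qed.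

Lemma is_fderive_diff U N (f : U -> N) x : differentiable f x -> is_fderive f x (fderive f x).
Proof. by move=> df; apply/is_fderiveP. Qed.

Lemma is_fderive_unique U N (f : U -> N) x (L L' : 'L(U; N)) :
  is_fderive f x L -> is_fderive f x L' -> L = L'.
Proof. by move=> /is_fderiveP[_ <-] /is_fderiveP[_ <-]. Qed.

Lemma near0_norm_le U (d : R) : 0 < d -> \forall h \near (0 : U), `|h| <= d.
Proof. by move=> d0; apply/nbhs_norm0P; exists d => //= h /= /ltW. Qed.

Lemma is_fderive_lip U N (f : U -> N) x (L : 'L(U; N)) e : 0 < e -> is_fderive f x L ->
  \forall h \near (0 : U), `|f (x + h) - f x| <= (`|L| + e) * `|h|.
Proof.
move=> e0 fL; have := fL e e0; apply: near_imp => h hd.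
rewrite -(subrK (L h) (f (x + h) - f x)) (le_trans (ler_normD _ _))//.
by rewrite mulrDl addrC lerD// norm_op_le.
Qed.

Lemma is_fderive_near0 U N (f : U -> N) x (L : 'L(U; N)) e : 0 < e -> is_fderive f x L ->
  \forall h \near (0 : U), `|f (x + h) - f x| <= e.
Proof.
move=> e0 fL; have p : 0 < `|L| + 1 by rewrite ltr_wpDl.
have := near_and (is_fderive_lip ltr01 fL) (near0_norm_le U (divr_gt0 e0 p)).
apply: near_imp => h [h1 h2]; apply: le_trans h1 _.
by rewrite -ler_pdivlMl// mulrC.
Qed.

Lemma is_fderive_continuous U N (f : U -> N) x (L : 'L(U; N)) :
  is_fderive f x L -> {for x, continuous f}.
Proof. by move=> /is_fderiveP[/differentiable_continuous]. Qed.

Lemma is_fderive_op U N (L : 'L(U; N)) x : is_fderive L x L.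
Proof.
move=> e e0; apply: nearW => h.
have E : L x + L h - L x - L h = 0 by abel.
by rewrite bopD E normr0 mulr_ge0// ltW.
Qed.

Lemma is_fderive_cst U N (a : N) (x : U) : is_fderive (fun=> a) x 0.
Proof.
move=> e e0; apply: nearW => h.
by rewrite op0 subrr subr0 normr0 mulr_ge0// ltW.
Qed.

Lemma is_fderive_add U N (f g : U -> N) x (L M : 'L(U; N)) :
  is_fderive f x L -> is_fderive g x M -> is_fderive (f + g) x (L + M).
Proof.
move=> fL gM e e0; have e20 : 0 < e / 2 by rewrite divr_gt0.
have := near_and (fL _ e20) (gM _ e20); apply: near_imp => h [h1 h2].
rewrite -[(f + g) (x + h)]/(f (x + h) + g (x + h)) -[(f + g) x]/(f x + g x) opD.
have -> : f (x + h) + g (x + h) - (f x + g x) - (L h + M h) =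
  (f (x + h) - f x - L h) + (g (x + h) - g x - M h) by abel.
by rewrite (le_trans (ler_normD _ _))// (splitr e) mulrDl lerD.
Qed.

Lemma is_fderive_opl U N W (A : 'L(N; W)) (f : U -> N) x (L : 'L(U; N)) :
  is_fderive f x L -> is_fderive (fun u => A (f u)) x (op_comp A L).
Proof.
move=> fL e e0; have p : 0 < `|A| + 1 by rewrite ltr_wpDl.
have := fL _ (divr_gt0 e0 p); apply: near_imp => h hd.
rewrite op_compE -!bopB; apply: le_trans (norm_op_le _ _) _.
apply: le_trans (ler_wpM2l _ hd) _ => //.
rewrite mulrA ler_wpM2r// mulrA ler_pdivrMr// mulrC ler_pM2l// lerDl//.
Qed.

Lemma is_fderive_sub U N (f g : U -> N) x (L M : 'L(U; N)) :
  is_fderive f x L -> is_fderive g x M -> is_fderive (fun u => f u - g u) x (L - M).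
Proof.
move=> fL gM; have := is_fderive_add fL (is_fderive_opl (- idop N) gM).
rewrite (_ : op_comp _ M = - M)//.
by apply: op_ext => u; rewrite op_compE !opN.
Qed.

Lemma is_fderive_opr U N W (B : 'L(W; U)) (f : U -> N) w (L : 'L(U; N)) :
  is_fderive f (B w) L -> is_fderive (fun w => f (B w)) w (op_comp L B).
Proof.
move=> fL e e0; have p : 0 < `|B| + 1 by rewrite ltr_wpDl.
have := fL _ (divr_gt0 e0 p) => /nbhs_norm0P[d /= d0 H].
apply/nbhs_norm0P; exists (d / (`|B| + 1)) => /=; first exact: divr_gt0.
move=> h /= hd; rewrite bopD; apply: (le_trans (H _ _)) => /=.
  apply: le_lt_trans (norm_op_le _ _) _; move: hd; rewrite ltr_pdivlMr// mulrDr mulr1.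
  by rewrite mulrC; apply: le_lt_trans; rewrite lerDl.
rewrite mulrAC ler_pdivrMr// -mulrA ler_pM2l//; apply: (le_trans (norm_op_le _ _)).
by rewrite mulrC ler_wpM2l// lerDl.
Qed.

Lemma is_fderive_bil U (N1 N2 N : normedModType R) (B : 'L(N1; 'L(N2; N)))
    (f : U -> N1) (g : U -> N2) x L M :
  is_fderive f x L -> is_fderive g x M ->
  is_fderive (fun u => B (f u) (g u)) x
    (op_comp (flip B (g x)) L + op_comp (B (f x)) M).
Proof.
move=> fL gM e e0.
pose C := `|B| * (`|g x| + 1 + `|L| + `|f x|).
have C0 : 0 <= C by rewrite mulr_ge0// !addr_ge0.
have p : 0 < C + 1 by rewrite ltr_wpDl.
pose d := e / (C + 1).
have d0 : 0 < d by rewrite divr_gt0.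
have := near_and (near_and (fL _ d0) (gM _ d0))
  (near_and (is_fderive_near0 ltr01 gM) (is_fderive_near0 d0 gM)).
apply: near_imp => h [[h1 h2] [h3 h4]].
have -> : B (f (x + h)) (g (x + h)) - B (f x) (g x) -
    (op_comp (flip B (g x)) L + op_comp (B (f x)) M) h =
  B (f (x + h) - f x - L h) (g (x + h)) + B (L h) (g (x + h) - g x) +
  B (f x) (g (x + h) - g x - M h).
  by rewrite opD !op_compE flipE !bopB !opB; abel.
have gb : `|g (x + h)| <= `|g x| + 1.
  by rewrite -(subrK (g x) (g (x + h))) (le_trans (ler_normD _ _))// addrC lerD.
apply: (@le_trans _ _ (C * d * `|h|)); last first.
  by rewrite ler_wpM2r// /d mulrA ler_pdivrMr// mulrC ler_pM2l// lerDl.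
have t1 : `|B (f (x + h) - f x - L h) (g (x + h))| <=
    `|B| * (d * `|h|) * (`|g x| + 1).
  apply: le_trans (norm_op2_le _ _ _) _.
  by rewrite ler_pM// ?mulr_ge0// ler_wpM2l.
have t2 : `|B (L h) (g (x + h) - g x)| <= `|B| * (`|L| * `|h|) * d.
  apply: le_trans (norm_op2_le _ _ _) _.
  by rewrite ler_pM// ?mulr_ge0// ler_wpM2l// norm_op_le.
have t3 : `|B (f x) (g (x + h) - g x - M h)| <= `|B| * `|f x| * (d * `|h|).
  by apply: le_trans (norm_op2_le _ _ _) _; rewrite ler_wpM2l// mulr_ge0.
apply: le_trans (ler_normD _ _) _; apply: le_trans (lerD (ler_normD _ _) t3) _.
apply: le_trans (lerD (lerD t1 t2) (lexx _)) _.
by rewrite le_eqVlt; apply/orP; left; apply/eqP; rewrite /C; ring.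
Qed.

(** A linear map is determined by its values near 0: a local Lipschitz constant
    of f at x bounds the operator norm of its derivative. *)
Lemma is_fderive_norm_le U N (f : U -> N) x (L : 'L(U; N)) M : 0 <= M ->
  is_fderive f x L -> (\forall h \near (0 : U), `|f (x + h) - f x| <= M * `|h|) ->
  `|L| <= M.
Proof.
move=> M0 fL fM; apply/ler_addgt0Pr => e e0.
have /nbhs_norm0P[d /= d0 H] := near_and (fL _ e0) fM.
apply: op_norm_le => [|u]; first by rewrite addr_ge0// ltW.
have [->|u0] := eqVneq u 0; first by rewrite bop0 !normr0 mulr0.
have nu : 0 < `|u| by rewrite normr_gt0.
pose t := d / 2 / `|u|.
have t0 : 0 < t by rewrite !divr_gt0.
have [|h1 h2] := H (t *: u).
  by rewrite /= normrZ gtr0_norm// /t divfK ?gt_eqF// ltr_pdivrMr// ltr_pMr// ltr1n.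
rewrite -(ler_pM2l t0) mulrCA -{1 2}(gtr0_norm t0) -!normrZ -bopZ.
rewrite -(subrK (f (x + t *: u) - f x) (L _)) (le_trans (ler_normD _ _))//.
by rewrite mulrDl addrC lerD// distrC.
Qed.

End FrechetDerivative.

(** * Mean value theorem and exchange of derivatives *)

Section MeanValue.
Context {R : realType}.
Implicit Types N U W Z : normedModType R.

(** The supremum of the times up to which |phi s - phi 0| <= (M + e) s holds is 1,
    since it is attained and can be increased as long as it is less than 1.
    This is the form of the mean value theorem that survives for functions with
    values in a normed space. *)
Lemma local_lipschitz_le N (phi : R -> N) (M : R) :
  (forall t e : R, 0 <= t <= 1 -> 0 < e -> exists2 d : R, 0 < d &
     forall s, 0 <= s <= 1 -> `|s - t| < d -> `|phi s - phi t| <= (M + e) * `|s - t|) ->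
  `|phi 1 - phi 0| <= M.
Proof.
move=> H; apply/ler_addgt0Pr => e e0.
pose A := [set t : R | 0 <= t <= 1 /\
  forall s, 0 <= s <= t -> `|phi s - phi 0| <= (M + e) * s].
have A0 : A 0.
  split; first by rewrite lexx ler01.
  by move=> s s0; have -> : s = 0 by [lra]; rewrite subrr normr0 mulr0.
have Aub : ubound A 1 by move=> t [/andP[]].
have hA : has_sup A by split; [exists 0|exists 1].
pose c := sup A.
have c0 : 0 <= c by apply: (sup_ubound hA.2).
have c1 : c <= 1 by apply: (ge_sup hA.1).
have [|d d0 Hd] := H c e _ e0; first by rewrite c0.
have [t [/andP[t0 t1] At] ct] := sup_adherent d0 hA.
rewrite -/c in ct.
have tc : t <= c by apply: (sup_ubound hA.2); split=> //; rewrite t0.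
have Ac : A c.
  split; first by rewrite c0.
  move=> s /andP[s0]; rewrite le_eqVlt => /predU1P[->|sc].
    rewrite -(subrK (phi t) (phi c)) -addrA (le_trans (ler_normD _ _))//.
    have -> : (M + e) * c = (M + e) * (c - t) + (M + e) * t by ring.
    apply: lerD; last by apply: At; rewrite t0 lexx.
    have ctd : `|t - c| < d by rewrite ltr_norml; apply/andP; split; lra.
    have := Hd t _ ctd; rewrite t0 t1 => /(_ isT).
    by rewrite distrC [`|t - c|]distrC [`|c - t|]ger0_norm ?subr_ge0.
  have [|t' [/andP[t'0 t'1] At'] ct'] := @sup_adherent _ A (c - s) _ hA.
    by rewrite subr_gt0.
  by apply: At'; rewrite s0 /=; move: ct'; rewrite -/c opprB addrC subrK => /ltW.
have [c1'|c1'] := ltP c 1; last first.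
  have -> : M + e = (M + e) * 1 by rewrite mulr1.
  by apply: Ac.2; rewrite ler01.
pose c' := Num.min (c + d / 2) 1.
have cc' : c < c' by rewrite /c' lt_min; apply/andP; split; lra.
have c'1 : c' <= 1 by rewrite /c' ge_min lexx orbT.
have c'd : c' <= c + d / 2 by rewrite /c' ge_min lexx.
suff /(sup_ubound hA.2) : A c' by rewrite -/c leNgt cc'.
split; first by apply/andP; split; lra.
move=> s /andP[s0 sc']; have [sc|sc] := leP s c; first by apply: Ac.2; rewrite s0.
rewrite -(subrK (phi c) (phi s)) -addrA (le_trans (ler_normD _ _))//.
have -> : (M + e) * s = (M + e) * (s - c) + (M + e) * c by ring.
apply: lerD; last by apply: Ac.2; rewrite c0 /=.
have scd : `|s - c| < d by rewrite ltr_norml; apply/andP; split; lra.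
have := Hd s _ scd; rewrite s0 /= => /(_ ltac:(lra)).
by rewrite [`|s - c|]ger0_norm// subr_ge0 ltW.
Qed.

Lemma mvt_segment U N (f : U -> N) (D : U -> 'L(U; N)) (a v : U) (M : R) :
  (forall t : R, 0 <= t <= 1 -> is_fderive f (a + t *: v) (D (a + t *: v))) ->
  (forall t : R, 0 <= t <= 1 -> `|D (a + t *: v) v| <= M) ->
  `|f (a + v) - f a| <= M.
Proof.
move=> fD DM.
have := @local_lipschitz_le N (fun t => f (a + t *: v)) M.
rewrite scale1r scale0r addr0; apply=> t e t01 e0.
have p : 0 < `|v| + 1 by rewrite ltr_wpDl.
have /nbhs_norm0P[d /= d0 H] := fD t t01 _ (divr_gt0 e0 p).
exists (d / (`|v| + 1)); first exact: divr_gt0.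
move=> s s01 sd.
have -> : a + s *: v = a + t *: v + (s - t) *: v.
  by rewrite -addrA -scalerDl [t + _]addrC subrK.
have vd : `|(s - t) *: v| < d.
  rewrite normrZ; move: sd; rewrite ltr_pdivlMr//; apply: le_lt_trans.
  by rewrite ler_wpM2l// lerDl.
have {vd} := H _ vd.
set x := a + t *: v.
have : `|D x ((s - t) *: v)| <= M * `|s - t|.
  by rewrite bopZ normrZ mulrC ler_wpM2r// DM.
set w := (s - t) *: v => h1 h2; rewrite /= in h2.
rewrite -(subrK (D x w) (f (x + w) - f x)) (le_trans (ler_normD _ _))//.
rewrite mulrDl addrC lerD//; apply: (le_trans h2).
rewrite /w normrZ mulrCA mulrA [X in _ <= X]mulrC -mulrA ler_wpM2l//.
by rewrite mulrC mulrA ler_pdivrMr// mulrC ler_pM2l// lerDl.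
Qed.

(** The exchange of the partial derivatives: apply the mean value theorem in z
    and then in y to the second difference
      P(z0 + v, y0 + u) - P(z0, y0 + u) - P(z0 + v, y0) + P(z0, y0),
    from which D2 D1 P(z0, y0) u v has been subtracted; it is at most e |u| |v|.
    Letting u tend to 0 in a fixed direction gives the derivative of D2 P. *)
Lemma schwarz Z U N (P : Z -> U -> N) (Q : Z -> U -> 'L(Z; N))
    (P2 : Z -> U -> 'L(U; N)) (Q2 : Z -> U -> 'L(U; 'L(Z; N))) z0 y0 :
  (forall z y, is_fderive (P^~ y) z (Q z y)) ->
  (forall z y, is_fderive (P z) y (P2 z y)) ->
  (forall z y, is_fderive (Q z) y (Q2 z y)) ->
  {for (z0, y0), continuous (fun p : Z * U => Q2 p.1 p.2)} ->
  is_fderive (P2^~ y0) z0 (flip (Q2 z0 y0)).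
Proof.
move=> PQ PP2 QQ2 Q2c e e0.
have /cvgrPdist_le/(_ e e0)/nbhs_normP[d /= d0 Hd] := Q2c.
have {}Hd z y : `|z - z0| < d -> `|y - y0| < d -> `|Q2 z y - Q2 z0 y0| <= e.
  move=> zd yd; rewrite distrC; apply: (Hd (z, y)); rewrite /=.
  rewrite prod_normE /= gt_max.
  by rewrite distrC zd distrC yd.
have conv (W : normedModType R) (x0 x : W) (t : R) : `|x| < d -> 0 <= t <= 1 ->
    `|x0 + t *: x - x0| < d.
  move=> xd /andP[t0 t1]; rewrite addrAC subrr add0r normrZ ger0_norm//.
  by apply: le_lt_trans xd; rewrite ler_piMl.
apply/nbhs_norm0P; exists d => //= v vd.
apply: (@is_fderive_norm_le _ U N (fun y => P (z0 + v) y - P z0 y - Q2 z0 y0 y v) y0).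
- by rewrite mulr_ge0// ltW.
- exact: is_fderive_sub (is_fderive_sub (PP2 (z0 + v) y0) (PP2 z0 y0))
    (is_fderive_op (flip (Q2 z0 y0) v) y0).
apply/nbhs_norm0P; exists d => //= u ud.
have -> : P (z0 + v) (y0 + u) - P z0 (y0 + u) - Q2 z0 y0 (y0 + u) v -
    (P (z0 + v) y0 - P z0 y0 - Q2 z0 y0 y0 v) =
  (P (z0 + v) (y0 + u) - P (z0 + v) y0 - flip (flip (Q2 z0 y0)) u (z0 + v)) -
  (P z0 (y0 + u) - P z0 y0 - flip (flip (Q2 z0 y0)) u z0).
  by rewrite !flipE !bopD !opD; abel.
apply: (@mvt_segment Z N
  (fun z => P z (y0 + u) - P z y0 - flip (flip (Q2 z0 y0)) u z)
  (fun z => Q z (y0 + u) - Q z y0 - Q2 z0 y0 u)) => t t01.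
  exact: is_fderive_sub (is_fderive_sub (PQ _ (y0 + u)) (PQ _ y0))
    (is_fderive_op (flip (flip (Q2 z0 y0)) u) _).
set z := z0 + t *: v.
apply: le_trans (norm_op_le _ _) _; rewrite mulrAC ler_wpM2r//.
have -> : Q z (y0 + u) - Q z y0 - Q2 z0 y0 u =
  (Q z (y0 + u) - Q2 z0 y0 (y0 + u)) - (Q z y0 - Q2 z0 y0 y0).
  by rewrite bopD; abel.
apply: (@mvt_segment U _ (fun y => Q z y - Q2 z0 y0 y) (fun y => Q2 z y - Q2 z0 y0)) => s s01.
  exact: is_fderive_sub (QQ2 z _) (is_fderive_op (Q2 z0 y0) _).
apply: le_trans (norm_op_le _ _) _; rewrite ler_wpM2r// Hd//; exact: conv.
Qed.

End MeanValue.

(** * Parametrized families of functions of class C^m *)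

Section Families.
Context {R : realType}.
Implicit Types N U W V : normedModType R.

Lemma continuous_fst (Z U : topologicalType) (T : topologicalType) (g : Z -> T) :
  continuous g -> continuous (fun p : Z * U => g p.1).
Proof.
by move=> gc p; apply: (@continuous_comp _ _ _ fst g); [exact: cvg_fst|exact: gc].
Qed.

Lemma continuous_snd (Z U : topologicalType) (T : topologicalType) (g : U -> T) :
  continuous g -> continuous (fun p : Z * U => g p.2).
Proof.
by move=> gc p; apply: (@continuous_comp _ _ _ snd g); [exact: cvg_snd|exact: gc].
Qed.

Lemma continuous_pair (X Z U T : topologicalType) (P : Z -> U -> T) (g : X -> Z) (h : X -> U) :
  continuous g -> continuous h -> continuous (fun p : Z * U => P p.1 p.2) ->
  continuous (fun x => P (g x) (h x)).
Proof.
move=> gc hc Pc x; apply: (@continuous_comp _ _ _ (fun x => (g x, h x)) (fun p => P p.1 p.2)).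
  by apply: (@cvg_pair _ _ _ (nbhs x)); [exact: gc|exact: hc].
exact: Pc.
Qed.

Lemma op_continuous N W (T : topologicalType) (L : 'L(N; W)) (f : T -> N) :
  continuous f -> continuous (fun x => L (f x)).
Proof. by move=> fc x; apply: continuous_comp; [exact: fc|exact: bop_continuous]. Qed.

Lemma bil_continuous (N1 N2 N : normedModType R) (B : 'L(N1; 'L(N2; N)))
    (T : topologicalType) (f : T -> N1) (g : T -> N2) :
  continuous f -> continuous g -> continuous (fun x => B (f x) (g x)).
Proof.
move=> fc gc; apply: (continuous_pair (P := fun a b => B a b) fc gc) => q.
apply: is_fderive_continuous.
exact: (is_fderive_bil B (is_fderive_op (@fstL _ N1 N2) q) (is_fderive_op (@sndL _ N1 N2) q)).
Qed.

(** A family of C^m functions of u indexed by z, whose derivatives in u are jointly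
    continuous in (z, u) and bounded by c * w k for z in S.  The empty S states
    the regularity alone.  The constant c is separate from the weights because
    it will carry powers of |t - s|. *)
Fixpoint Cfam (Z : topologicalType) U (m : nat) (S : set Z) (c : R) (w : nat -> U -> R)
    N (P : Z -> U -> N) : Prop :=
  [/\ continuous (fun p : Z * U => P p.1 p.2),
      forall z u, S z -> `|P z u| <= c * w 0%N u &
      match m with
      | 0%N => True
      | m'.+1 => (forall z u, differentiable (P z) u) /\
                 Cfam m' S c (fun k => w k.+1) (fun z => fderive (P z))
      end].

Section FamilyTheory.
Variables (Z : topologicalType) (U : normedModType R).
Implicit Types (S : set Z) (c : R) (w : nat -> U -> R).

Lemma Cfam_continuous m S c w N (P : Z -> U -> N) :
  Cfam m S c w P -> continuous (fun p : Z * U => P p.1 p.2).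
Proof. by case: m => [|m] []. Qed.

Lemma Cfam_bound m S c w N (P : Z -> U -> N) :
  Cfam m S c w P -> forall z u, S z -> `|P z u| <= c * w 0%N u.
Proof. by case: m => [|m] []. Qed.

Lemma Cfam_is_fderive m S c w N (P : Z -> U -> N) :
  Cfam m.+1 S c w P -> forall z u, is_fderive (P z) u (fderive (P z) u).
Proof. by case=> _ _ [dP _] z u; apply: is_fderive_diff. Qed.

Lemma Cfam_deriv m S c w N (P : Z -> U -> N) :
  Cfam m.+1 S c w P -> Cfam m S c (fun k => w k.+1) (fun z => fderive (P z)).
Proof. by case=> _ _ []. Qed.

Lemma Cfam_intro m S c w N (P : Z -> U -> N) (P' : Z -> U -> 'L(U; N)) :
  continuous (fun p : Z * U => P p.1 p.2) ->
  (forall z u, S z -> `|P z u| <= c * w 0%N u) ->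
  (forall z u, is_fderive (P z) u (P' z u)) ->
  Cfam m S c (fun k => w k.+1) P' -> Cfam m.+1 S c w P.
Proof.
move=> cP bP dP fP'; split => //; split.
  by move=> z u; have /is_fderiveP[] := dP z u.
suff -> : (fun z => fderive (P z)) = P' by [].
by apply/funext => z; apply/funext => u; have /is_fderiveP[_ <-] := dP z u.
Qed.

Lemma Cfam_le m' m S' S c' c w' w N (P : Z -> U -> N) :
  (m' <= m)%N -> S' `<=` S ->
  (forall k z u, (k <= m')%N -> S' z -> c * w k u <= c' * w' k u) ->
  Cfam m S c w P -> Cfam m' S' c' w' P.
Proof.
move=> + SS; elim: m' m w w' N P => [|m' IH] [|m]// w w' N P mm cw.
- by move=> [cP bP _]; split=> // z u Sz; apply: le_trans (cw _ _ _ _ Sz) => //; apply/bP/SS.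
- by move=> [cP bP _]; split=> // z u Sz; apply: le_trans (cw _ _ _ _ Sz) => //; apply/bP/SS.
move=> FP; apply: Cfam_intro (Cfam_continuous FP) _ (Cfam_is_fderive FP) _.
  by move=> z u Sz; apply: le_trans (cw _ _ _ _ Sz) => //; apply: (Cfam_bound FP); apply: SS.
by apply: IH (Cfam_deriv FP) => // k z u km; apply: cw.
Qed.

Lemma Cfam_nobound m S c c' w w' N (P : Z -> U -> N) :
  Cfam m S c w P -> Cfam m set0 c' w' P.
Proof. by apply: Cfam_le => // k z u _ []. Qed.

Lemma Cfam_op m S c w N W (L : 'L(N; W)) a (P : Z -> U -> N) : `|L| <= a ->
  Cfam m S c w P -> Cfam m S (a * c) w (fun z u => L (P z u)).
Proof.
elim: m w N W L P => [|m IH] w N W L P La FP.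
  case: FP => [cP bP _]; split => //; first exact: op_continuous.
  by move=> z u Sz; apply: le_trans (norm_op_le _ _) _; rewrite -mulrA ler_pM// bP.
apply: (Cfam_intro (P' := fun z u => op_comp L (fderive (P z) u))).
- exact: op_continuous (Cfam_continuous FP).
- move=> z u Sz; apply: le_trans (norm_op_le _ _) _; rewrite -mulrA ler_pM//.
  exact: (Cfam_bound FP).
- by move=> z u; apply/is_fderive_opl/(Cfam_is_fderive FP).
apply: (IH _ _ _ (op_compl U L)) (Cfam_deriv FP).
exact: le_trans (norm_mkop _ _ (normr_ge0 _)) La.
Qed.

Lemma Cfam_add m S c1 c2 w N (P1 P2 : Z -> U -> N) :
  Cfam m S c1 w P1 -> Cfam m S c2 w P2 ->
  Cfam m S (c1 + c2) w (fun z u => P1 z u + P2 z u).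
Proof.
elim: m w N P1 P2 => [|m IH] w N P1 P2 F1 F2.
  split => //.
    by move=> p; apply: cvgD; [exact: (Cfam_continuous F1)|exact: (Cfam_continuous F2)].
  move=> z u Sz; rewrite mulrDl; apply: le_trans (ler_normD _ _) _.
  by apply: lerD; [exact: (Cfam_bound F1)|exact: (Cfam_bound F2)].
apply: (Cfam_intro (P' := fun z u => fderive (P1 z) u + fderive (P2 z) u)).
- by move=> p; apply: cvgD; [exact: (Cfam_continuous F1)|exact: (Cfam_continuous F2)].
- move=> z u Sz; rewrite mulrDl; apply: le_trans (ler_normD _ _) _.
  by apply: lerD; [exact: (Cfam_bound F1)|exact: (Cfam_bound F2)].
- by move=> z u; apply: is_fderive_add; [exact: (Cfam_is_fderive F1)|exact: (Cfam_is_fderive F2)].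
by apply: IH; exact: Cfam_deriv.
Qed.

Lemma Cfam_scale m S c w N (a : R) (P : Z -> U -> N) :
  Cfam m S c w P -> Cfam m S (`|a| * c) w (fun z u => a *: P z u).
Proof.
move=> FP; have ha : `|a *: idop N| <= `|a|.
  by rewrite normrZ -[leRHS]mulr1 ler_wpM2l// norm_idop.
exact: (Cfam_op ha FP).
Qed.

Lemma Cfam_opp m S c w N (P : Z -> U -> N) :
  Cfam m S c w P -> Cfam m S c w (fun z u => - P z u).
Proof.
move=> /(Cfam_scale (-1)); rewrite normrN1 mul1r.
by under [X in Cfam _ _ _ _ X -> _]eq_fun do under eq_fun do rewrite scaleN1r.
Qed.

Lemma Cfam_sub m S c1 c2 w N (P1 P2 : Z -> U -> N) :
  Cfam m S c1 w P1 -> Cfam m S c2 w P2 ->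
  Cfam m S (c1 + c2) w (fun z u => P1 z u - P2 z u).
Proof. by move=> F1 F2; apply: Cfam_add => //; apply: Cfam_opp. Qed.

(** The Leibniz rule.  The weights are nondecreasing in k, so that every term of
    the expansion of the k-th derivative is bounded by the product of the
    weights of order k; 2 ^ m is the sum of the binomial coefficients. *)
Lemma Cfam_bil m S (c1 c2 a : R) w1 w2 (N1 N2 N : normedModType R)
    (B : 'L(N1; 'L(N2; N))) (P1 : Z -> U -> N1) (P2 : Z -> U -> N2) :
  0 <= c1 -> 0 <= c2 ->
  (forall k u, w1 k u <= w1 k.+1 u) -> (forall k u, w2 k u <= w2 k.+1 u) ->
  `|B| <= a ->
  Cfam m S c1 w1 P1 -> Cfam m S c2 w2 P2 ->
  Cfam m S (2 ^+ m * (a * c1 * c2)) (fun k u => w1 k u * w2 k u)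
    (fun z u => B (P1 z u) (P2 z u)).
Proof.
move=> c10 c20.
elim: m w1 w2 N1 N2 N B P1 P2 => [|m IH] w1 w2 N1 N2 N B P1 P2 w1m w2m Ba F1 F2.
  split=> //; first by apply: bil_continuous; [exact: (Cfam_continuous F1)|exact: (Cfam_continuous F2)].
  move=> z u Sz; apply: le_trans (norm_op2_le _ _ _) _.
  rewrite expr0 mul1r [leRHS](_ : _ = a * (c1 * w1 0%N u) * (c2 * w2 0%N u)); last by ring.
  by rewrite !ler_pM ?mulr_ge0//; [exact: (Cfam_bound F1)|exact: (Cfam_bound F2)].
apply: (Cfam_intro (P' := fun z u =>
  op_comp (flip B (P2 z u)) (fderive (P1 z) u) + op_comp (B (P1 z u)) (fderive (P2 z) u))).
- by apply: bil_continuous; [exact: (Cfam_continuous F1)|exact: (Cfam_continuous F2)].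
- move=> z u Sz; apply: le_trans (norm_op2_le _ _ _) _.
  have b1 := Cfam_bound F1 u Sz; have b2 := Cfam_bound F2 u Sz.
  have b10 := le_trans (normr_ge0 _) b1; have b20 := le_trans (normr_ge0 _) b2.
  have a0 := le_trans (normr_ge0 _) Ba.
  rewrite [leRHS](_ : _ = 2 ^+ m.+1 * (a * (c1 * w1 0%N u) * (c2 * w2 0%N u))); last by ring.
  apply: le_trans (_ : _ <= a * (c1 * w1 0%N u) * (c2 * w2 0%N u)) _.
    by rewrite !ler_pM ?mulr_ge0.
  apply: ler_peMl; first exact: mulr_ge0 (mulr_ge0 a0 b10) b20.
  by rewrite exprn_ege1// ler1n.
- by move=> z u; apply: is_fderive_bil; [exact: (Cfam_is_fderive F1)|exact: (Cfam_is_fderive F2)].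
rewrite exprS (_ : 2 * _ * _ = 2 ^+ m * (a * c1 * c2) + 2 ^+ m * (a * c1 * c2)); last by ring.
have low (c : R) w N0 (P : Z -> U -> N0) : 0 <= c -> (forall k u, w k u <= w k.+1 u) ->
    Cfam m.+1 S c w P -> Cfam m S c (fun k => w k.+1) P.
  by move=> c0 wm; apply: Cfam_le => // k z u _ _; rewrite ler_wpM2l.
have nB (W0 W1 W2 : normedModType R) (D : 'L(W0; 'L(W1; W2))) : `|D| <= a ->
    `|op_comp (op_compL U W1 W2) D| <= a.
  move=> Da; apply: le_trans (norm_op_comp _ _) _; rewrite -[leRHS]mul1r.
  by rewrite ler_pM// norm_op_compL.
(* both terms of the Leibniz rule are values of bounded bilinear maps, to which
   the induction hypothesis applies *)
apply: Cfam_add.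
- apply: (IH (fun k => w1 k.+1) (fun k => w2 k.+1) _ _ _
    (flip (op_comp (op_compL U N1 N) (flip B))) (fun z => fderive (P1 z)) P2) => //.
  + by apply: le_trans (norm_flip _) _; apply/nB/(le_trans (norm_flip _) Ba).
  + exact: Cfam_deriv F1.
  + exact: low F2.
apply: (IH (fun k => w1 k.+1) (fun k => w2 k.+1) _ _ _
    (op_comp (op_compL U N2 N) B) P1 (fun z => fderive (P2 z))) => //.
- exact: nB.
- exact: low F1.
- exact: Cfam_deriv F2.
Qed.

End FamilyTheory.

Lemma Cfam_reparam (Z Z' : topologicalType) U m (S : set Z) (S' : set Z') c w N
    (g : Z' -> Z) (P : Z -> U -> N) :
  continuous g -> (forall z, S' z -> S (g z)) ->
  Cfam m S c w P -> Cfam m S' c w (fun z => P (g z)).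
Proof.
move=> gc gS; elim: m w N P => [|m IH] w N P FP.
  split=> //; last by move=> z u /gS; exact: (Cfam_bound FP).
  apply: (continuous_pair (g := fun p => g p.1) (h := snd)) (Cfam_continuous FP).
    exact: continuous_fst.
  by move=> p; exact: cvg_snd.
apply: (Cfam_intro (P' := fun z => fderive (P (g z)))).
- apply: (continuous_pair (g := fun p => g p.1) (h := snd)) (Cfam_continuous FP).
    exact: continuous_fst.
  by move=> p; exact: cvg_snd.
- by move=> z u /gS; exact: (Cfam_bound FP).
- by move=> z u; exact: (Cfam_is_fderive FP).
exact: IH (Cfam_deriv FP).
Qed.

Lemma Cfam_pre (Z : topologicalType) U V m (S : set Z) c w N
    (L : 'L(V; U)) (P : Z -> U -> N) : `|L| <= 1 ->
  Cfam m S c w P -> Cfam m S c (fun k v => w k (L v)) (fun z v => P z (L v)).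
Proof.
move=> L1; elim: m w N P => [|m IH] w N P FP.
  split=> //; last by move=> z u; exact: (Cfam_bound FP).
  apply: (continuous_pair (g := fst) (h := fun p => L p.2)) (Cfam_continuous FP).
    by move=> p; exact: cvg_fst.
  exact/continuous_snd/bop_continuous.
apply: (Cfam_intro (P' := fun z v => op_comp (fderive (P z) (L v)) L)).
- apply: (continuous_pair (g := fst) (h := fun p => L p.2)) (Cfam_continuous FP).
    by move=> p; exact: cvg_fst.
  exact/continuous_snd/bop_continuous.
- by move=> z u; exact: (Cfam_bound FP).
- by move=> z u; apply/is_fderive_opr/(Cfam_is_fderive FP).
rewrite -[c]mul1r.
apply: (@Cfam_op Z V m S c (fun k v => w k.+1 (L v)) _ _ (flip (op_compL V U N) L) 1).
  apply: le_trans (norm_op_le _ _) _; rewrite -[leRHS]mul1r ler_pM//.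
  exact: le_trans (norm_flip _) (norm_op_compL _ _ _).
exact: IH (Cfam_deriv FP).
Qed.

(** The mean value theorem in the parameter, for all derivatives in u at once.
    The induction replaces P by D2 P and Q = D1 P by the flip of D2 Q, which is
    D1 D2 P by [schwarz]. *)
Lemma Cfam_mvt (Z U : normedModType R) m c w c0 w0 c1 w1 N (P : Z -> U -> N) (Q : Z -> U -> 'L(Z; N)) (a b : Z) :
  Cfam m set0 c0 w0 P -> Cfam m set0 c1 w1 Q ->
  (forall z u, is_fderive (P^~ u) z (Q z u)) ->
  (forall t : R, 0 <= t <= 1 -> Cfam m [set: R] c w (fun=> Q (a + t *: (b - a)))) ->
  Cfam m [set: R] (c * `|b - a|) w (fun=> (fun u => P b u - P a u)).
Proof.
have bd m' w' N' (P' : Z -> U -> N') Q' :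
    (forall z u, is_fderive (P'^~ u) z (Q' z u)) ->
    (forall t : R, 0 <= t <= 1 -> Cfam m' [set: R] c w' (fun=> Q' (a + t *: (b - a)))) ->
    forall u, `|P' b u - P' a u| <= c * `|b - a| * w' 0%N u.
  move=> PQ' Qb' u.
  have := @mvt_segment R Z N' (P'^~ u) (Q'^~ u) a (b - a) (c * `|b - a| * w' 0%N u).
  rewrite [a + _]addrC subrK; apply=> [t _|t t01]; first exact: PQ'.
  rewrite mulrAC; apply: le_trans (norm_op_le _ _) _; rewrite ler_wpM2r//.
  exact: (Cfam_bound (Qb' t t01) (z := 0)).
elim: m w w0 w1 N P Q => [|m IH] w w0 w1 N P Q FP FQ PQ Qb.
  split=> //; last by move=> _ u _; exact: bd PQ Qb u.
  have Pc z : continuous (P z).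
    apply: (continuous_pair (g := fun=> z) (h := id)) (Cfam_continuous FP).
      exact: cst_continuous.
    by move=> u; exact: cvg_id.
  by apply: (continuous_snd (g := fun u => P b u - P a u)) => u; apply: cvgB; exact: Pc.
have dP u := is_fderive_sub (Cfam_is_fderive FP b u) (Cfam_is_fderive FP a u).
apply: (Cfam_intro (P' := fun _ : R => fun u => fderive (P b) u - fderive (P a) u)).
- apply: (continuous_snd (g := fun u => P b u - P a u)) => u.
  exact: is_fderive_continuous (dP u).
- by move=> _ u _; exact: bd PQ Qb u.
- by move=> _ u; exact: dP.
apply: (IH _ (fun k => w0 k.+1) (fun k => w1 k.+1) _ (fun z => fderive (P z)) (fun z u => flipL U Z N (fderive (Q z) u))).
- exact: Cfam_deriv FP.
- exact: Cfam_nobound (Cfam_op (norm_flipL _ _ _) (Cfam_deriv FQ)).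
- move=> z u.
  apply: (@schwarz R Z U N P Q (fun z => fderive (P z)) (fun z => fderive (Q z)) z u) => //.
  + exact: (Cfam_is_fderive FP).
  + exact: (Cfam_is_fderive FQ).
  + exact: (Cfam_continuous (Cfam_deriv FQ)).
move=> t t01.
rewrite -[c]mul1r.
apply: (Cfam_op (norm_flipL _ _ _)).
exact: Cfam_deriv (Qb t t01).
Qed.

End Families.

(** * Iterated derivatives and completeness *)

Section IteratedDerivatives.
Context {R : realType}.
Variables (Z : topologicalType) (U : normedModType R).

Let family := {N : normedModType R & Z -> U -> N}.

(** [fderiven] differentiates last on the outside and [Cfam] first on the inside.
    The two iterated derivatives agree, but their targets L(U; L(U; ... W)) are
    equal only by induction on k; the equality of dependent pairs transports
    continuity, differentiability and norms without any cast. *)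
Lemma fderivenSr (N : normedModType R) (P : Z -> U -> N) (k : nat) :
  existT (fun N : normedModType R => Z -> U -> N) (multi_op k.+1 U N)
    (fun z => fderiven k.+1 (P z)) =
  existT _ (multi_op k U 'L(U; N)) (fun z => fderiven k (fderive (P z))).
Proof.
elim: k => [//|k IH].
pose D (F : family) : family :=
  existT _ ('L(U; projT1 F) : normedModType R) (fun z => fderive (projT2 F z)).
have := congr1 D IH; rewrite /D /=; exact.
Qed.

Lemma CfamP m (S : set Z) c w (N : normedModType R) (P : Z -> U -> N) :
  Cfam m S c w P <->
  [/\ forall k, (k <= m)%N -> continuous (fun p : Z * U => fderiven k (P p.1) p.2),
      forall k, (k < m)%N -> forall z u, differentiable (fderiven k (P z)) u &
      forall k, (k <= m)%N -> forall z u, S z -> `|fderiven k (P z) u| <= c * w k u].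
Proof.
have tC k (N0 : normedModType R) (P0 : Z -> U -> N0) :
    continuous (fun p : Z * U => fderiven k.+1 (P0 p.1) p.2) <->
    continuous (fun p : Z * U => fderiven k (fderive (P0 p.1)) p.2).
  pose Q (F : family) := continuous (fun p : Z * U => projT2 F p.1 p.2).
  by have := congr1 Q (fderivenSr P0 k); rewrite /Q /= => ->.
have tD k (N0 : normedModType R) (P0 : Z -> U -> N0) z u :
    differentiable (fderiven k.+1 (P0 z)) u <->
    differentiable (fderiven k (fderive (P0 z))) u.
  pose Q (F : family) := differentiable (projT2 F z) u.
  by have := congr1 Q (fderivenSr P0 k); rewrite /Q /= => ->.
have tB k (N0 : normedModType R) (P0 : Z -> U -> N0) z u :
    `|fderiven k.+1 (P0 z) u| = `|fderiven k (fderive (P0 z)) u|.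
  pose Q (F : family) := `|projT2 F z u|.
  by have := congr1 Q (fderivenSr P0 k); rewrite /Q.
elim: m w N P => [|m IH] w N P.
  split=> [[cP bP _]|[cP _ bP]].
    by split=> [[|]//|//|[|]//].
  by split=> //; [exact: (cP 0%N)|exact: (bP 0%N)].
split=> [[cP bP [dP /IH[cP' dP' bP']]]|[cP dP bP]].
  split=> [[|k]|[|k]|[|k]] //.
  - by move=> km; apply/tC/cP'.
  - by move=> km z u; apply/tD/dP'.
  - by move=> km z u Sz; rewrite tB; exact: bP'.
split; [exact: (cP 0%N)|exact: (bP 0%N)|split]; first exact: (dP 0%N).
apply/IH; split=> k km.
- by apply/tC/cP.
- by move=> z u; apply/tD/dP.
- by move=> z u Sz; rewrite -tB; exact: bP.
Qed.

End IteratedDerivatives.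

Section Balls.
Context {R : realType}.
Variables (U : normedModType R).

(** The ball of radius c in the space of C^m functions with weights w; the
    parameter is a dummy. *)
Definition cball (N : normedModType R) (m : nat) (w : nat -> U -> R) (c : R) (f : U -> N) :=
  Cfam m [set: R] c w (fun=> f).

Lemma cballP m w c (N : normedModType R) (f : U -> N) :
  cball m w c f -> Cdiff m f /\ (forall k, (k <= m)%N -> forall u, `|fderiven k f u| <= c * w k u).
Proof.
move=> /CfamP[cf df bf]; split; last by move=> k km u; apply: (bf k km 0).
split=> [k km|k km]; first exact: (df k km 0).
apply: (continuous_pair (P := fun _ : R => fderiven k f) (g := fun=> 0) (h := id)) (cf k km).
  exact: cst_continuous.
by move=> u; exact: cvg_id.
Qed.

Lemma cball_continuous m w c (N : normedModType R) (f : U -> N) :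
  cball m w c f -> continuous f.
Proof. by move=> /cballP[[_ cf] _]; exact: (cf 0%N). Qed.

Lemma Cfam_cball (Z : topologicalType) m (S : set Z) w c (N : normedModType R)
    (P : Z -> U -> N) z : S z -> Cfam m S c w P -> cball m w c (P z).
Proof.
move=> Sz; apply: (@Cfam_reparam R Z R U m S setT c w N (fun=> z) P) => //.
exact: cst_continuous.
Qed.

End Balls.

Section Completeness.
Context {R : realType}.
Variables (U : normedModType R).

Lemma cvg_dist_ex (N : normedModType R) (v : nat -> N) a i (eps : R) :
  v @ \oo --> a -> 0 < eps -> exists2 j, (i <= j)%N & `|a - v j| <= eps.
Proof.
move=> va eps0; have /cvgrPdist_le/(_ eps eps0) := va.
move=> [j _ Hj]; exists (maxn i j); first exact: leq_maxl.
by apply: Hj; exact: leq_maxr.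
Qed.

Lemma small_ex (e : nat -> R) i (M eps : R) : (forall i, 0 <= e i) -> e @ \oo --> 0 ->
  0 < eps -> exists2 j, (i <= j)%N & e j * M <= eps.
Proof.
move=> e0 elim eps0.
have p : 0 < `|M| + 1 by rewrite ltr_wpDl.
have [j ij] := cvg_dist_ex i elim (divr_gt0 eps0 p).
rewrite sub0r normrN ger0_norm// => ej; exists j => //.
apply: (@le_trans _ _ (e j * (`|M| + 1))).
  by rewrite ler_wpM2l// (le_trans (ler_norm M))// lerDl.
by rewrite -ler_pdivlMr.
Qed.

Lemma near_le_value (w : U -> R) u : continuous w -> \forall v \near u, w v <= `|w u| + 1.
Proof.
move=> wc; have /cvgrPdist_le/(_ 1 ltr01) := wc u; apply: near_imp => v.
rewrite distrC => /(le_trans (ler_norm _)); rewrite lerBlDr => h.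
by apply: (le_trans h); rewrite addrC lerD2r ler_norm.
Qed.

Lemma pointwise_limit (N : completeNormedModType R) (w : U -> R) (e : nat -> R)
    (f : nat -> U -> N) : (forall i, 0 <= e i) -> e @ \oo --> 0 ->
  (forall i j, (i <= j)%N -> forall u, `|f j u - f i u| <= e i * w u) ->
  exists2 g : U -> N, forall u, f ^~ u @ \oo --> g u &
    forall i u, `|g u - f i u| <= e i * w u.
Proof.
move=> e0 elim fc; have lim_ex u : exists a : N, f ^~ u @ \oo --> a.
  apply/cvg_ex; apply: cauchy_cvg; apply: cauchy_exP => eps eps0.
  have [i _ ei] := small_ex 0%N (w u) e0 elim (divr_gt0 eps0 (@ltr0n R 2)).
  exists (f i u); exists i => // j /= ij; rewrite -ball_normE /= distrC.
  apply: le_lt_trans (fc i j ij u) _.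
  by apply: le_lt_trans ei _; rewrite ltr_pdivrMr// ltr_pMr// ltr1n.
have [g fg] := choice lim_ex; exists g => // i u.
apply/ler_addgt0Pr => eps eps0.
have [j ij gj] := cvg_dist_ex i (fg u) eps0.
have -> : g u - f i u = (f j u - f i u) + (g u - f j u) by abel.
by apply: le_trans (ler_normD _ _) _; apply: lerD => //; exact: fc.
Qed.

(** Completeness of the space of C^m functions with weights.  The derivatives
    converge by induction, to a function with values in the complete space
    L(U; N), and a locally uniform limit of derivatives is the derivative of the
    pointwise limit. *)
Lemma cball_complete (N : completeNormedModType R) m (w : nat -> U -> R) (e : nat -> R)
    (f : nat -> U -> N) c0 w0 :
  (forall k, continuous (w k)) -> (forall i, 0 <= e i) -> e @ \oo --> 0 ->
  (forall i, Cfam m (@set0 R) c0 w0 (fun=> f i)) ->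
  (forall i j, (i <= j)%N -> cball m w (e i) (fun u => f j u - f i u)) ->
  exists g : U -> N, forall i, cball m w (e i) (fun u => g u - f i u).
Proof.
move=> + e0 elim.
elim: m w w0 N f => [|m IH] w w0 N f wc fsm fc.
all: have [g fg gb] := pointwise_limit e0 elim
  (fun i j ij u => Cfam_bound (fc i j ij) (z := 0) u I).
- exists g => i; split=> //; apply: (continuous_snd (g := fun u => g u - f i u)) => u.
  apply/cvgrPdist_le => eps eps0.
  have eps3 : 0 < eps / 3 by rewrite divr_gt0.
  have [j ij ej] := small_ex i (`|w 0%N u| + 1) e0 elim eps3.
  have wu := near_le_value u (wc 0%N).
  have fu : \forall v \near u, `|(f j u - f i u) - (f j v - f i v)| <= eps / 3.
    have fcont : continuous (fun u => f j u - f i u) by exact: cball_continuous (fc i j ij).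
    by have /cvgrPdist_le/(_ _ eps3) := fcont u.
  near=> v.
  have -> : g u - f i u - (g v - f i v) =
    (g u - f j u) - (g v - f j v) + ((f j u - f i u) - (f j v - f i v)) by abel.
  have -> : eps = eps / 3 + eps / 3 + eps / 3 by field.
  apply: le_trans (ler_normD _ _) _; apply: lerD; last by near: v.
  apply: le_trans (ler_normB _ _) _; apply: lerD; apply: le_trans (gb _ _) _;
    apply: le_trans ej; rewrite ler_wpM2l//.
    by rewrite (le_trans (ler_norm _))// lerDl.
  by near: v.
have fD i u : is_fderive (f i) u (fderive (f i) u) by exact: (Cfam_is_fderive (fsm i) 0).
have DfB i j : (i <= j)%N ->
    cball m (fun k => w k.+1) (e i) (fun u => fderive (f j) u - fderive (f i) u).
  move=> ij; have := Cfam_deriv (fc i j ij).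
  rewrite /cball (_ : fderive _ = (fun u => fderive (f j) u - fderive (f i) u))//.
  by apply/funext => u; have /is_fderiveP[] := is_fderive_sub (fD j u) (fD i u).
have [psi psiP] := IH (fun k => w k.+1) (fun k => w0 k.+1) _ (fun i => fderive (f i))
  (fun k => wc k.+1) (fun i => Cfam_deriv (fsm i)) DfB.
have gD u : is_fderive g u (psi u).
  move=> eps eps0; have eps3 : 0 < eps / 3 by rewrite divr_gt0.
  have [i _ ei] := small_ex 0%N (`|w 1%N u| + 1) e0 elim eps3.
  have /nbhs_normP[d /= d0 wu] := near_le_value u (wc 1%N).
  have /nbhs_norm0P[d' /= d'0 Df] := fD i u _ eps3.
  apply/nbhs_norm0P; exists (Num.min d d'); first by rewrite /= lt_min d0.
  move=> h /=; rewrite lt_min => /andP[hd hd'].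
  (* the increments of g - f i are limits of those of f j - f i, which the mean
     value theorem controls uniformly in j *)
  have gf : `|g (u + h) - g u - (f i (u + h) - f i u)| <= eps / 3 * `|h|.
    apply/ler_addgt0Pr => eta eta0; have eta2 : 0 < eta / 2 by rewrite divr_gt0.
    have /cvgrPdist_le/(_ _ eta2) A1 := fg (u + h).
    have /cvgrPdist_le/(_ _ eta2) A2 := fg u.
    have [j0 _ Hj0] := filterI A1 A2.
    have [j1 j2] := Hj0 (maxn i j0) (leq_maxr _ _).
    move: (maxn i j0) (leq_maxl i j0) j1 j2 => j ij j1 j2 {Hj0}.
    have -> : g (u + h) - g u - (f i (u + h) - f i u) =
      ((f j (u + h) - f i (u + h)) - (f j u - f i u)) +
      ((g (u + h) - f j (u + h)) - (g u - f j u)) by abel.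
    apply: le_trans (ler_normD _ _) _; apply: lerD; last first.
      by rewrite [leRHS]splitr (le_trans (ler_normB _ _))// lerD.
    apply: (@mvt_segment R U N (fun u => f j u - f i u)
      (fun u => fderive (f j) u - fderive (f i) u)) => t t01; first exact: is_fderive_sub.
    apply: le_trans (norm_op_le _ _) _; rewrite ler_wpM2r//.
    apply: le_trans (Cfam_bound (DfB i j ij) (z := 0) _ I) _.
    apply: le_trans ei; rewrite ler_wpM2l// wu//= opprD addNKr normrN normrZ.
    move: t01 => /andP[t0 t1]; rewrite ger0_norm//.
    by apply: le_lt_trans hd; rewrite ler_piMl.
  have -> : g (u + h) - g u - psi u h =
    (g (u + h) - g u - (f i (u + h) - f i u)) +
    (f i (u + h) - f i u - fderive (f i) u h) - (psi u h - fderive (f i) u h) by abel.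
  have -> : eps = eps / 3 + eps / 3 + eps / 3 by field.
  rewrite !mulrDl; apply: le_trans (ler_normB _ _) _; apply: lerD.
    by apply: le_trans (ler_normD _ _) _; apply: lerD => //; apply: Df.
  rewrite -opB; apply: le_trans (norm_op_le _ _) _; rewrite ler_wpM2r//.
  apply: le_trans (Cfam_bound (psiP i) (z := 0) u I) _.
  apply: le_trans ei; rewrite ler_wpM2l// .
  by rewrite (le_trans (ler_norm _))// lerDl.
exists g => i; apply: Cfam_intro (psiP i).
- apply: (continuous_snd (g := fun u => g u - f i u)) => u.
  exact: is_fderive_continuous (is_fderive_sub (gD u) (fD i u)).
- by move=> z u _; exact: gb.
by move=> _ u; exact: is_fderive_sub.
Unshelve. all: by end_near. Qed.

End Completeness.

(** * Sewing lemma *)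

Section Clip.
Context {R : realType}.

Definition clip (s t x : R) : R := Num.max s (Num.min x t).

Lemma clip_homo s t x y : x <= y -> clip s t x <= clip s t y.
Proof.
move=> xy; rewrite /clip.
by case: (leP y t) (leP x t) (leP s x) (leP s y) (leP s t) => ? [?|?] [?|?] [?|?] [?|?]; lra. Qed.

Lemma clip_ge s t x : s <= clip s t x.
Proof. by rewrite /clip le_max lexx. Qed.

Lemma clip_le s t x : s <= t -> clip s t x <= t.
Proof. by move=> st; rewrite /clip ge_max st ge_min lexx orbT. Qed.

Lemma clip_lip s t x y : x <= y -> clip s t y - clip s t x <= y - x.
Proof.
move=> xy; rewrite /clip.
by case: (leP y t) (leP x t) (leP s x) (leP s y) (leP s t) => ? [?|?] [?|?] [?|?] [?|?]; lra. Qed.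

End Clip.

(** The sewing lemma in an abelian group G, where [B c x] stands for: x has norm
    at most c.  Balls of functions fit this description although the functions
    themselves have no finite norm. *)
Section Sewing.
Context {R : realType} (G : zmodType) (B : R -> G -> Prop).
Hypothesis B0 : B 0 0.
Hypothesis B_le : forall c d x, c <= d -> B c x -> B d x.
Hypothesis BD : forall c d x y, B c x -> B d y -> B (c + d) (x + y).
Hypothesis BN : forall c x, B c x -> B c (- x).
Hypothesis B_closed : forall c x, (forall e, 0 < e -> B (c + e) x) -> B c x.
Hypothesis B_sep : forall x, B 0 x -> x = 0.
Hypothesis B_complete : forall (e : nat -> R) (f : nat -> G),
  (forall i, 0 <= e i) -> e @ \oo --> 0 ->
  (forall i j, (i <= j)%N -> B (e i) (f j - f i)) ->
  exists g, forall i, B (e i) (g - f i).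

Lemma B_sum (c : nat -> R) (x : nat -> G) m n :
  (forall k, (m <= k < n)%N -> B (c k) (x k)) ->
  B (\sum_(m <= k < n) c k) (\sum_(m <= k < n) x k).
Proof.
have [mn|nm] := leqP m n; last by move=> _; rewrite !big_geq// ltnW.
rewrite -(subnKC mn); elim: (n - m)%N => [|d IH] H.
  by rewrite addn0 !big_geq.
rewrite addnS !big_nat_recr ?leq_addr//=; apply: BD; last by apply: H; rewrite leq_addr addnS leqnn.
by apply: IH => k /andP[mk kd]; apply: H; rewrite mk addnS ltnS ltnW.
Qed.

Variables (T g C : R) (Xi : R -> R -> G).
Hypothesis g1 : 1 < g.
Hypothesis C0 : 0 <= C.
Hypothesis XiE : forall t, 0 <= t <= T -> Xi t t = 0.
Hypothesis Xi_delta : forall s u t, 0 <= s -> s <= u -> u <= t -> t <= T ->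
  B (C * (t - s) `^ g) (Xi s t - Xi s u - Xi u t).

Let g0 : 0 <= g. Proof. by rewrite ltW// (lt_trans ltr01). Qed.

Lemma split_index (P : pred nat) d : P 0%N -> (0 < d)%N ->
  exists i, [/\ (i < d)%N, P i & (i.+1 = d \/ ~~ P i.+1)].
Proof.
elim: d => // d IH P0 _; case: d IH => [|d] IH; first by exists 0%N; split => //; left.
have [i [id Pi [iE|Pi']]] := IH P0 isT; last by exists i; split; [exact: ltnW|by []|right].
case: (boolP (P d.+1)) => [Pd|Pd]; first by exists d.+1; split => //; left.
by exists i; split; [exact: ltnW|by []|right; rewrite iE].
Qed.

(** The fixed point of K |-> 2 K 2^(-g) + 2 C, which is the recursion in
    [maximal_inequality]. *)
Definition sew_cst : R := 2 * C / (1 - 2 `^ (1 - g)).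

Lemma pow21g : 0 < (2 : R) `^ (1 - g) < 1.
Proof.
rewrite powR_gt0//= -opprB powRN invf_lt1 ?powR_gt0//.
have := @gt0_ltr_powR R (g - 1); rewrite subr_gt0 => /(_ g1 1 2).
by rewrite !nnegrE !ler0n powR1 ltr1n; apply.
Qed.

Lemma sew_cst_ge0 : 0 <= sew_cst.
Proof.
have /andP[_ h] := pow21g.
by rewrite /sew_cst divr_ge0 ?mulr_ge0// subr_ge0 ltW.
Qed.

Lemma sew_cstE : sew_cst * 2 `^ (1 - g) + 2 * C = sew_cst.
Proof.
have /andP[_ h] := pow21g; rewrite /sew_cst; field.
by rewrite subr_eq0 eq_sym lt_eqF.
Qed.

(** Two intervals of half the length contribute 2 (1/2)^g = 2^(1 - g) times the
    bound of the whole interval, and this factor is less than 1 as g > 1. *)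
Lemma half_powR (L x : R) : 0 <= x -> x <= L / 2 ->
  2 * (sew_cst * x `^ g) <= sew_cst * 2 `^ (1 - g) * L `^ g.
Proof.
move=> x0 xL; have L0 : 0 <= L by lra.
have -> : sew_cst * 2 `^ (1 - g) * L `^ g = 2 * (sew_cst * (L / 2) `^ g).
  have e1 : (2 : R) `^ (1 - g) = 2 * 2 `^ (- g).
    by rewrite powRD ?pnatr_eq0 ?implybT// powRr1.
  have e2 : (L / 2) `^ g = L `^ g * 2 `^ (- g).
    by rewrite powRM// -powR_inv1// -powRrM mulN1r.
  by rewrite e1 e2; ring.
by rewrite ler_pM2l// ler_wpM2l ?sew_cst_ge0// ge0_ler_powR// nnegrE divr_ge0.
Qed.

(** Remove the one subinterval that contains the midpoint in value: the points
    before it and the points after it lie in intervals of at most half the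
    length, where induction applies, and gluing the three pieces costs two
    defects of additivity. *)
Lemma maximal_inequality (tau : nat -> R) :
  (forall i, 0 <= tau i <= T) -> (forall i j, (i <= j)%N -> tau i <= tau j) ->
  forall d m, B (sew_cst * (tau (m + d)%N - tau m) `^ g)
    (\sum_(m <= k < m + d) Xi (tau k) (tau k.+1) - Xi (tau m) (tau (m + d)%N)).
Proof.
move=> tT tm d; elim/ltn_ind: d => d IH m.
have [->|d0] := posnP d.
  rewrite addn0 big_geq// XiE// !subrr.
  by apply: (B_le _ B0); rewrite mulr_ge0 ?sew_cst_ge0// powR_ge0.
pose L := tau (m + d)%N - tau m.
have L0 : 0 <= L by rewrite subr_ge0 tm// leq_addr.
have [i [id Pi Pi']] := @split_index (fun i => tau (m + i)%N <= tau m + L / 2) d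
  ltac:(by rewrite /= addn0 lerDl divr_ge0) d0.
pose a := tau (m + i)%N; pose b := tau (m + i).+1; pose z := tau (m + d)%N.
have ma : tau m <= a by rewrite tm// leq_addr.
have ab : a <= b by rewrite tm.
have bz : b <= z by rewrite tm// -addnS leq_add2l.
have left : a - tau m <= L / 2 by rewrite lerBlDl.
have right : z - b <= L / 2.
  case: Pi' => [iE|]; first by rewrite /z /b -addnS iE subrr divr_ge0.
  by rewrite -ltNge addnS -/b /L -/z; lra.
have m0 : 0 <= tau m by case/andP: (tT m).
have zT : z <= T by case/andP: (tT (m + d)%N).
have h1 := IH i id m; rewrite -/a in h1.
have h2 := IH (d - i.+1)%N ltac:(by rewrite ltn_subrL d0) (m + i).+1.
rewrite -addnS -addnA subnKC// addnS -/b -/z in h2.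
have d1 := Xi_delta m0 ma ab (le_trans bz zT).
have d2 := Xi_delta m0 (le_trans ma ab) bz zT.
have -> : \sum_(m <= k < m + d) Xi (tau k) (tau k.+1) - Xi (tau m) (tau (m + d)%N) =
  (\sum_(m <= k < m + i) Xi (tau k) (tau k.+1) - Xi (tau m) a) +
  (\sum_((m + i).+1 <= k < m + d) Xi (tau k) (tau k.+1) - Xi b z) +
  (- (Xi (tau m) b - Xi (tau m) a - Xi a b) +
   - (Xi (tau m) z - Xi (tau m) b - Xi b z)).
  rewrite (@big_cat_nat _ _ _ (m + i)%N m (m + d)%N)/=; [|exact: leq_addr|by rewrite leq_add2l ltnW].
  rewrite (@big_cat_nat _ _ _ (m + i).+1 (m + i)%N (m + d)%N)/=; [|exact: leqnSn|by rewrite -addnS leq_add2l].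
  rewrite big_nat1 -/a -/b -/z; abel.
apply: (B_le _ (BD (BD h1 h2) (BD (BN d1) (BN d2)))).
have k1 := @half_powR L (a - tau m) ltac:(by rewrite subr_ge0) left.
have k2 := @half_powR L (z - b) ltac:(by rewrite subr_ge0) right.
have k3 : C * (b - tau m) `^ g <= C * L `^ g.
  rewrite ler_wpM2l// ge0_ler_powR// ?nnegrE ?subr_ge0 ?(le_trans ma ab)//.
  by rewrite /L lerD2r.
have k4 : C * (z - tau m) `^ g <= C * L `^ g by [].
have E : sew_cst * L `^ g = sew_cst * 2 `^ (1 - g) * L `^ g + 2 * (C * L `^ g).
  by rewrite mulrA -mulrDl sew_cstE.
by rewrite -/L -/z E; lra.
Qed.


Hypothesis T0 : 0 <= T.

Definition dyadic (N k : nat) : R := T * k%:R / 2 ^+ N.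
(** The grid is the dyadic grid of [0, T] for all s and t, with its points clipped
    to [s, t].  Hence the grid of level N + 1 refines that of level N, and the
    sums over [s, u], [u, t] and [s, t] are compared interval by interval. *)
Definition dyadic_sum (N : nat) (s t : R) : G :=
  \sum_(0 <= k < 2 ^ N) Xi (clip s t (dyadic N k)) (clip s t (dyadic N k.+1)).

Lemma dyadic_homo N i j : (i <= j)%N -> dyadic N i <= dyadic N j.
Proof.
move=> ij; rewrite /dyadic ler_wpM2r// ?invr_ge0 ?exprn_ge0//.
by rewrite ler_wpM2l// ler_nat.
Qed.

Lemma dyadicS N k : dyadic N k.+1 - dyadic N k = T / 2 ^+ N.
Proof. by rewrite /dyadic -mulrBl -mulrBr -natr1 [_ + 1]addrC addrK mulr1. Qed.

Lemma dyadic_double N k : dyadic N.+1 k.*2 = dyadic N k.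
Proof.
rewrite /dyadic -muln2 natrM exprS; field.
by rewrite expf_neq0 ?pnatr_eq0.
Qed.

Let q : R := 2 `^ (1 - g).
Let q01 : 0 < q < 1. Proof. exact: pow21g. Qed.
Let E (N : nat) : R := C * T `^ g * q ^+ N.

Lemma dyadic_error N : \sum_(0 <= k < 2 ^ N) C * (T / 2 ^+ N) `^ g = E N.
Proof.
rewrite sumr_const_nat subn0 -(mulr_natr (C * _)) natrX /E -!mulrA; congr (C * _).
have -> : (T / 2 ^+ N) `^ g = T `^ g * (2 ^+ N) `^ (- g).
  by rewrite powRM ?invr_ge0 ?exprn_ge0// -powR_inv1 ?exprn_ge0// -powRrM mulN1r.
rewrite -mulrA; congr (_ * _).
rewrite /q -[RHS]powR_mulrn ?powR_ge0// -[RHS]powRrM -(@powR_mulrn _ 2 N)//.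
rewrite -powRrM -powRD; last by rewrite pnatr_eq0 implybT.
by congr (_ `^ _); ring.
Qed.

Lemma sum_double n (F : nat -> G) :
  \sum_(0 <= k < n.*2) F k = \sum_(0 <= k < n) (F k.*2 + F k.*2.+1).
Proof.
elim: n => [|n IH]; first by rewrite !big_geq.
by rewrite doubleS !big_nat_recr//= IH addrA.
Qed.

Section fixed.
Variables s t : R.
Hypotheses (s0 : 0 <= s) (st : s <= t) (tT : t <= T).

Lemma dyadic_sum_germ N :
  B (sew_cst * (t - s) `^ g) (dyadic_sum N s t - Xi s t).
Proof.
have := @maximal_inequality (fun k => clip s t (dyadic N k)) _ _ (2 ^ N)%N 0%N.
rewrite add0n; have -> : clip s t (dyadic N 0) = s.
  rewrite /dyadic mulr0 mul0r /clip; apply/max_idPl.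
  by rewrite ge_min s0.
have -> : clip s t (dyadic N (2 ^ N)) = t.
  rewrite /dyadic natrX mulfK ?expf_neq0 ?pnatr_eq0// /clip.
  by rewrite (min_idPr tT); apply/max_idPr.
apply=> [i|i j ij]; last exact/clip_homo/dyadic_homo.
by rewrite (le_trans s0 (clip_ge _ _ _))//= (le_trans (clip_le _ st)).
Qed.

Lemma dyadic_sum_step N : B (E N) (dyadic_sum N.+1 s t - dyadic_sum N s t).
Proof.
rewrite -dyadic_error /dyadic_sum expnS mul2n sum_double -sumrB.
apply: B_sum => k _; rewrite dyadic_double -doubleS dyadic_double.
set a := clip _ _ (dyadic N k); set b := clip _ _ (dyadic N k.+1); set u := clip _ _ _.
have au : a <= u by rewrite /a -dyadic_double clip_homo// dyadic_homo.
have ub : u <= b by rewrite /b -dyadic_double clip_homo// dyadic_homo.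
have -> : Xi a u + Xi u b - Xi a b = - (Xi a b - Xi a u - Xi u b) by abel.
apply: BN; apply: B_le (Xi_delta _ au ub _).
- rewrite ler_wpM2l// ge0_ler_powR// ?nnegrE ?subr_ge0 ?(le_trans au)//.
    by rewrite divr_ge0// exprn_ge0.
  by rewrite -(dyadicS N k) clip_lip// dyadic_homo.
- exact: le_trans s0 (clip_ge _ _ _).
- exact: le_trans (clip_le _ st) tT.
Qed.

Lemma dyadic_sum_cauchy i j : (i <= j)%N ->
  B (E i / (1 - q)) (dyadic_sum j s t - dyadic_sum i s t).
Proof.
move=> /subnKC <-; move: (j - i)%N => d {j}.
have q1 : 0 < 1 - q by case/andP: q01 => _; rewrite subr_gt0.
have A0 : 0 <= C * T `^ g by rewrite mulr_ge0 ?powR_ge0.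
apply: (@B_le ((E i - E (i + d)%N) / (1 - q))).
  rewrite ler_pM2r ?invr_gt0// gerBl /E mulr_ge0// exprn_ge0//.
  by case/andP: q01 => /ltW.
elim: d => [|d IH]; first by rewrite addn0 !subrr mul0r.
have := BD IH (dyadic_sum_step (i + d)).
rewrite addnS; congr B; last by abel.
rewrite /E exprS; field; exact: lt0r_neq0.
Qed.

End fixed.

(** Only the interval of the grid that contains u has a nonzero defect; the bound
    that allows one defect per interval tends to 0 anyway. *)
Lemma dyadic_sum_additive N s u t : 0 <= s -> s <= u -> u <= t -> t <= T ->
  B (E N) (dyadic_sum N s t - dyadic_sum N s u - dyadic_sum N u t).
Proof.
move=> s0 su ut tT; rewrite -dyadic_error /dyadic_sum -!sumrB.
have cl x : clip s u x = Num.min (clip s t x) u.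
  by rewrite /clip min_maxl (min_idPl su) -minA (min_idPr ut).
have cr x : clip u t x = Num.max (clip s t x) u.
  by rewrite /clip maxAC (max_idPr su).
apply: B_sum => k _; rewrite !cl !cr.
have ab : clip s t (dyadic N k) <= clip s t (dyadic N k.+1).
  exact/clip_homo/dyadic_homo.
have abh : clip s t (dyadic N k.+1) - clip s t (dyadic N k) <= T / 2 ^+ N.
  by rewrite -(dyadicS N k) clip_lip// dyadic_homo.
have a0 := le_trans s0 (clip_ge s t (dyadic N k)).
have bT := le_trans (clip_le (dyadic N k.+1) (le_trans su ut)) tT.
move: (clip s t (dyadic N k)) (clip s t (dyadic N k.+1)) ab abh a0 bT => a b ab abh a0 bT.
have h0 : 0 <= T / 2 ^+ N by rewrite divr_ge0// exprn_ge0.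
have e0 : B (C * (T / 2 ^+ N) `^ g) 0.
  by apply: (B_le _ B0); rewrite mulr_ge0 ?powR_ge0.
have uT : 0 <= u <= T by rewrite (le_trans s0 su) (le_trans ut tT).
have [bu|ub] := leP b u.
  rewrite (min_idPl (le_trans ab bu)) (max_idPr (le_trans ab bu)) XiE//.
  by have -> : Xi a b - Xi a b - 0 = 0 by abel.
have [au|ua] := leP a u; last first.
  by rewrite XiE//; have -> : Xi a b - 0 - Xi a b = 0 by abel.
apply: B_le (Xi_delta a0 au (ltW ub) bT).
by rewrite ler_wpM2l// ge0_ler_powR// nnegrE subr_ge0.
Qed.

(** The dyadic sums form a Cauchy sequence, at level N within a constant times
    2^(N (1 - g)) of the limit; additivity and the distance to the germ pass to
    the limit from [dyadic_sum_additive] and [dyadic_sum_germ]. *)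
Theorem sewing : exists I : R -> R -> G,
  (forall s u t, 0 <= s -> s <= u -> u <= t -> t <= T -> I s t = I s u + I u t) /\
  (forall s t, 0 <= s -> s <= t -> t <= T ->
    B (sew_cst * (t - s) `^ g) (I s t - Xi s t)).
Proof.
have /andP[q0 q1] := q01.
have q1' : 0 < 1 - q by rewrite subr_gt0.
have A0 : 0 <= C * T `^ g by rewrite mulr_ge0 ?powR_ge0.
pose e N := E N / (1 - q).
have E0 N : 0 <= E N by rewrite /E mulr_ge0// exprn_ge0// ltW.
have e0 N : 0 <= e N by apply: divr_ge0 => //; exact: ltW.
have ecvg : e @ \oo --> 0.
  have -> : e = (fun N => C * T `^ g / (1 - q) * q ^+ N).
    by apply/funext => N; rewrite /e /E; ring.
  rewrite -[X in _ --> X](mulr0 (C * T `^ g / (1 - q))).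
  by apply: cvgMr; apply: cvg_expr; rewrite gtr0_norm.
have Ee N : E N <= e N.
  by rewrite /e ler_pdivlMr// ler_piMr// gerBl ltW.
have small x c : 0 <= c -> (forall N, B (c + 4 * e N) x) -> B c x.
  move=> c0 H; apply: B_closed => d d0.
  have d4 : 0 < d / 4 by rewrite divr_gt0.
  have /cvgrPdist_le/(_ _ d4)[N _ HN] := ecvg.
  apply: B_le (H N); rewrite lerD2l.
  have := HN N (leqnn N); rewrite sub0r normrN ger0_norm// => h; lra.
have pw (p : R * R) : exists i : G, 0 <= p.1 -> p.1 <= p.2 -> p.2 <= T ->
    forall N, B (e N) (i - dyadic_sum N p.1 p.2).
  case: p => s t /=.
  case: (boolP [&& 0 <= s, s <= t & t <= T]) => [/and3P[s0 st tT]|H].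
    have [i Hi] := @B_complete e (fun N => dyadic_sum N s t) e0 ecvg
      (fun i j ij => dyadic_sum_cauchy s0 st tT ij).
    by exists i.
  by exists 0 => s0 st tT; move: H; rewrite s0 st tT.
have [I IP] := choice pw.
exists (fun s t => I (s, t)); split=> [s u t s0 su ut tT|s t s0 st tT].
  apply/eqP; rewrite -subr_eq0; apply/eqP/B_sep/small => // N; rewrite add0r.
  have st := le_trans su ut; have u0 := le_trans s0 su; have uT := le_trans ut tT.
  have H := BD (BD (IP (s, t) s0 st tT N) (dyadic_sum_additive N s0 su ut tT))
    (BD (BN (IP (s, u) s0 su uT N)) (BN (IP (u, t) u0 ut tT N))).
  have -> : I (s, t) - (I (s, u) + I (u, t)) =
    (I (s, t) - dyadic_sum N s t) + (dyadic_sum N s t - dyadic_sum N s u - dyadic_sum N u t)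
    + (- (I (s, u) - dyadic_sum N s u) + - (I (u, t) - dyadic_sum N u t)) by abel.
  by apply: (B_le _ H); have := Ee N; lra.
apply: small => [|N]; first by rewrite mulr_ge0 ?powR_ge0 ?sew_cst_ge0.
have H := BD (dyadic_sum_germ s0 st tT N) (IP (s, t) s0 st tT N).
have -> : I (s, t) - Xi s t = (dyadic_sum N s t - Xi s t) + (I (s, t) - dyadic_sum N s t) by abel.
by apply: (B_le _ H); rewrite lerD2l; have := e0 N; lra.
Qed.

End Sewing.

(** * Riemann sums along partitions *)

Section GermIntegral.
Context {R : realType}.

Lemma bigmax_lt (d : R) (F : nat -> R) m n : 0 < d ->
  (forall k, (m <= k < n)%N -> F k < d) -> \big[Num.max/0]_(m <= k < n) F k < d.
Proof.
move=> d0 H; rewrite big_seq; elim/big_ind: _ => //.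
  by move=> x y xd yd; rewrite gt_max xd.
by move=> k; rewrite mem_index_iota => /H.
Qed.

Lemma bigmax_ge (F : nat -> R) n k : (k < n)%N -> F k <= \big[Num.max/0]_(0 <= k < n) F k.
Proof.
by move=> kn; rewrite big_mkord (le_bigmax _ (fun i : 'I_n => F i) (Ordinal kn)).
Qed.

(** Fine partitions exist, so that the filter in the definition of the integral is
    proper and limits along it are unique. *)
Lemma fine_partition (a b d : R) : a <= b -> 0 < d ->
  exists p, itv_partition a b p /\ mesh a b p < d.
Proof.
rewrite le_eqVlt => /predU1P[<-|ab] d0.
  by exists [::]; split; [split=> //=|rewrite /mesh big_geq].
pose N := (Num.bound ((b - a) / d)).+1.
have Nd : (b - a) / N%:R < d.
  rewrite ltr_pdivrMr// mulrC -ltr_pdivrMr//.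
  apply: lt_le_trans (archi_boundP _) _; first by rewrite divr_ge0// ?subr_ge0 ltW.
  by rewrite ler_nat.
pose t k : R := a + (b - a) * k%:R / N%:R.
pose p := mkseq (fun k => t k.+1) N.
have nthp x0 k : (k <= N)%N -> nth x0 (a :: p) k = t k.
  case: k => [|k] kN /=; first by rewrite /t mulr0 mul0r addr0.
  by rewrite nth_mkseq.
have tS k : t k.+1 - t k = (b - a) / N%:R.
  by rewrite /t -natr1; ring.
have h0 : 0 < (b - a) / N%:R by rewrite divr_gt0// subr_gt0.
have sp : size p = N by rewrite size_mkseq.
exists p; split.
  split.
    apply/(pathP a) => i; rewrite sp => iN.
    rewrite -[nth a p i]/(nth a (a :: p) i.+1) !nthp// 1?ltnW//.
    by rewrite -subr_gt0 tS.
  by rewrite -(nth_last a) sp /p nth_mkseq// -[_.-1.+1]/N /t mulfK ?pnatr_eq0// addrC subrK.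
rewrite /mesh; apply: bigmax_lt => // k; rewrite sp => /andP[_ kN].
by rewrite !nthp// 1?ltnW// tS.
Qed.

Lemma mesh_filter_proper (a b : R) : a <= b -> ProperFilter (mesh_filter a b).
Proof.
move=> ab; apply: filter_from_proper; last first.
  by move=> d /= d0; have [p] := fine_partition ab d0; exists p.
apply: filter_from_filter; first by exists 1 => /=.
move=> d e /= d0 e0; exists (Num.min d e); first by rewrite /= lt_min d0.
by move=> p [pab]; rewrite lt_min => /andP[pd pe].
Qed.

(** By additivity the error of a Riemann sum is a sum of errors on its intervals,
    at most K (mesh)^(g - 1) (b - a). *)
Lemma partition_sum_cvg (V : normedModType R) (Xi I : R -> R -> V) (T g K : R) (a b : R) :
  1 < g -> 0 <= K -> 0 <= a -> a <= b -> b <= T ->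
  (forall s u t, 0 <= s -> s <= u -> u <= t -> t <= T -> I s t = I s u + I u t) ->
  (forall s t, 0 <= s -> s <= t -> t <= T -> `|I s t - Xi s t| <= K * (t - s) `^ g) ->
  partition_sum Xi a b @ mesh_filter a b --> I a b.
Proof.
move=> g1 K0 a0 ab bT Iadd IXi.
have g10 : 0 < g - 1 by rewrite subr_gt0.
have FF : Filter (mesh_filter a b) by apply: mesh_filter_proper.
have P0 : 0 < K * (b - a) + 1 by rewrite ltr_wpDl// mulr_ge0// subr_ge0.
apply/cvgrPdist_le => eps eps0.
(* chosen so that K d ^ (g - 1) (b - a) <= eps *)
pose d := (eps / (K * (b - a) + 1)) `^ (g - 1)^-1.
have d0 : 0 < d by rewrite powR_gt0// divr_gt0.
have dg : d `^ (g - 1) = eps / (K * (b - a) + 1).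
  by rewrite /d -powRrM mulVf ?gt_eqF// powRr1// divr_ge0// ltW.
exists d => //= p [pab pd].
pose tau k := nth b (a :: p) k.
have tau0 : tau 0%N = a by [].
have tauN : tau (size p) = b by exact: itv_partition_nth_size pab.
have tau_lt k : (k < size p)%N -> tau k < tau k.+1.
  case: pab => /(pathP b) H _ /H; exact.
have tau_ge k : (k <= size p)%N -> a <= tau k by move=> kp; apply: itv_partition_nth_ge pab.
have tau_le k : (k <= size p)%N -> tau k <= b by move=> kp; apply: itv_partition_nth_le pab.
have Itau k : (k <= size p)%N -> I a (tau k) = \sum_(0 <= i < k) I (tau i) (tau i.+1).
  elim: k => [_|k IH kp].
    rewrite big_geq// tau0; have := Iadd a a a a0 (lexx _) (lexx _) (le_trans ab bT).
    by move=> /eqP; rewrite -subr_eq0 opprD addrA subrr sub0r oppr_eq0 => /eqP.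
  rewrite (big_nat_recr k 0%N)// -(IH (ltnW kp)).
  exact: (Iadd _ _ _ a0 (tau_ge k (ltnW kp)) (ltW (tau_lt k kp))
    (le_trans (tau_le k.+1 kp) bT)).
have -> : I a b = \sum_(0 <= i < size p) I (tau i) (tau i.+1).
  by rewrite -Itau// tauN.
rewrite /partition_sum -sumrB.
apply: (@le_trans _ _ (\sum_(0 <= k < size p) K * (d `^ (g - 1) * (tau k.+1 - tau k)))).
  apply: le_trans (ler_norm_sum _ _ _) _; rewrite big_seq [leRHS]big_seq.
  apply: ler_sum => k; rewrite mem_index_iota => /andP[_ kp].
  have tk := tau_lt k kp; have tk0 : 0 < tau k.+1 - tau k by rewrite subr_gt0.
  apply: le_trans (IXi _ _ _ (ltW tk) _) _.
  - by rewrite (le_trans a0)// tau_ge// ltnW.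
  - by rewrite (le_trans (tau_le _ _)).
  rewrite ler_wpM2l// -(mulr_powRB1 (ltW tk0) (lt_trans ltr01 g1)) mulrC.
  apply: ler_wpM2r; first exact: ltW.
  apply: ge0_ler_powR; rewrite ?nnegrE; [exact: ltW|exact: ltW|exact: ltW|].
  apply: (le_trans _ (ltW pd)).
  by apply: (@bigmax_ge (fun k => tau k.+1 - tau k)).
have -> : \sum_(0 <= k < size p) K * (d `^ (g - 1) * (tau k.+1 - tau k)) =
    K * (d `^ (g - 1) * (b - a)).
  by rewrite -mulr_sumr -[X in K * X]mulr_sumr telescope_sumr// tauN.
rewrite dg.
set P := K * (b - a) + 1 in P0 *.
have -> : K * (eps / P * (b - a)) = eps * (K * (b - a) / P) by ring.
by rewrite ler_piMr ?(ltW eps0)// ler_pdivrMr// mul1r /P lerDl.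
Qed.

Lemma germ_integralE (V : normedModType R) (Xi I : R -> R -> V) (T g K : R) :
  1 < g -> 0 <= K ->
  (forall s u t, 0 <= s -> s <= u -> u <= t -> t <= T -> I s t = I s u + I u t) ->
  (forall s t, 0 <= s -> s <= t -> t <= T -> `|I s t - Xi s t| <= K * (t - s) `^ g) ->
  forall s t, s \in `[0, T] -> t \in `[0, T] ->
  germ_integral Xi s t = if s <= t then I s t else - I t s.
Proof.
move=> g1 K0 Iadd IXi s t; rewrite !in_itv/= => /andP[s0 sT] /andP[t0 tT].
have L a b : 0 <= a -> a <= b -> b <= T -> lim (partition_sum Xi a b @ mesh_filter a b) = I a b.
  move=> a0 ab bT; have FF := mesh_filter_proper ab.
  by apply/cvg_lim => //; apply: partition_sum_cvg IXi.
by rewrite /germ_integral; case: leP => [st|/ltW ts]; rewrite L.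
Qed.

End GermIntegral.

(** * Operators on the projective tensor product *)

Section TensorLift.
Context {R : realType} {V E : completeNormedModType R} (ot : {bilinear V -> V -> E}).
Hypothesis hpt : projective_tensor ot.

Local Notation ts := (tensor_sum ot).

Lemma ts_cat s s' : ts (s ++ s') = ts s + ts s'.
Proof. by rewrite /tensor_sum big_cat. Qed.

Definition scale_seq (a : R) (s : seq (V * V)) := [seq (a *: p.1, p.2) | p <- s].

Lemma ts_scale a s : ts (scale_seq a s) = a *: ts s.
Proof.
rewrite /tensor_sum big_map scaler_sumr; apply: eq_bigr => p _ /=.
by rewrite linearZl_LR.
Qed.

Lemma ts1 v w : ts [:: (v, w)] = ot v w.
Proof. by rewrite /tensor_sum big_seq1. Qed.

Lemma norm_ot v w : `|ot v w| <= `|v| * `|w|.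
Proof.
rewrite -ts1 (pt_norm hpt); apply: ge_inf.
  by exists 0 => _ [s _ <-]; apply: sumr_ge0 => p _; rewrite mulr_ge0.
by exists [:: (v, w)] => //; rewrite big_seq1.
Qed.

Lemma ts_approx e (d : R) : 0 < d -> exists s, `|e - ts s| < d.
Proof.
move=> d0; have ne : ball e d !=set0 by exists e; exact: ballxx.
have [x [ed [s _ sx]]] := pt_dense hpt ne (ball_open _ _).
by exists s; rewrite sx; move: ed; rewrite -ball_normE.
Qed.

(** The span of the elementary tensors is dense. *)
Lemma tensor_op_unique (W : normedModType R) (L L' : 'L(E; W)) :
  (forall v w, L (ot v w) = L' (ot v w)) -> L = L'.
Proof.
move=> H; have Hs s : (L - L') (ts s) = 0.
  elim: s => [|[v w] s IH]; first by rewrite /tensor_sum big_nil bop0.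
  rewrite -cat1s ts_cat bopD IH ts1 opB H subrr addr0//.
suff /subr0_eq : L - L' = 0 by [].
apply: op_ext => e; rewrite op0; apply/eqP; rewrite -normr_le0.
apply/ler_addgt0Pr => d d0; rewrite add0r.
have p : 0 < `|L - L'| + 1 by rewrite ltr_wpDl.
have [s es] := ts_approx e (divr_gt0 d0 p).
rewrite -(subr0 ((L - L') e)) -(Hs s) -bopB; apply: le_trans (norm_op_le _ _) _.
apply: (@le_trans _ _ ((`|L - L'| + 1) * `|e - ts s|)); first by rewrite ler_wpM2r// lerDl.
by rewrite mulrC -ler_pdivlMr// ltW.
Qed.

Section lift.
Variables (W : completeNormedModType R) (B : 'L(V; 'L(V; W))).

Let Bs (s : seq (V * V)) : W := \sum_(p <- s) B p.1 p.2.

Let Bs_cat s s' : Bs (s ++ s') = Bs s + Bs s'.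
Proof. by rewrite /Bs big_cat. Qed.

Let Bs_scale a s : Bs (scale_seq a s) = a *: Bs s.
Proof.
rewrite /Bs big_map scaler_sumr; apply: eq_bigr => p _ /=.
by rewrite bopZ opZ.
Qed.

Fact op_isBilinear : bilinear_for *:%R *:%R (fun u v => B u v).
Proof. by split=> [u'|u] a v w /=; rewrite !(bopD, bopZ, opD, opZ). Qed.

Let Bs_wd s s' : ts s = ts s' -> Bs s = Bs s'.
Proof.
move=> ss'; pose b := bilinear_isBilinear.Build R V V W _ _ (fun u v => B u v) op_isBilinear.
pose Bil : {bilinear V -> V -> W} := HB.pack (fun u v => B u v) b.
have := pt_universal hpt Bil (s := s ++ scale_seq (-1) s').
rewrite ts_cat ts_scale ss' scaleN1r subrr => /(_ erefl) => H.
have : Bs (s ++ scale_seq (-1) s') = 0 by exact: H.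
by rewrite Bs_cat Bs_scale scaleN1r => /subr0_eq.
Qed.

Let Bs_bound s : `|Bs s| <= `|B| * `|ts s|.
Proof.
have b s' : `|Bs s'| <= `|B| * \sum_(p <- s') `|p.1| * `|p.2|.
  apply: le_trans (ler_norm_sum _ _ _) _; rewrite mulr_sumr; apply: ler_sum => p _.
  by rewrite mulrA norm_op2_le.
have [B0|B0] := eqVneq `|B| 0.
  by have := b s; rewrite B0 !mul0r.
have Bp : 0 < `|B| by rewrite lt_def B0 normr_ge0.
rewrite -ler_pdivrMl// (pt_norm hpt); apply: lb_le_inf.
  by exists (\sum_(p <- s) `|p.1| * `|p.2|), s.
by move=> _ [s' /= ss' <-]; rewrite ler_pdivrMl// -(Bs_wd ss').
Qed.

Let Bs_sub s s' : `|Bs s - Bs s'| <= `|B| * `|ts s - ts s'|.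
Proof.
have := Bs_bound (s ++ scale_seq (-1) s').
by rewrite Bs_cat ts_cat Bs_scale ts_scale !scaleN1r.
Qed.

(** On finite sums of elementary tensors the lift is forced; it is well defined by
    the universal property and bounded by |B| since the projective norm is an
    infimum over representations.  It extends to E by density and completeness
    of W: L e is the point within |B| |e - tensor_sum s| of the image of every
    s. *)
Lemma tensor_lift_exists : exists2 L : 'L(E; W),
  (forall v w, L (ot v w) = B v w) & `|L| <= `|B|.
Proof.
have pB : 0 < `|B| + 1 by rewrite ltr_wpDl.
have lim_ex e : exists v : W, forall s, `|v - Bs s| <= `|B| * `|e - ts s|.
  have [s sP] := choice (fun n : nat => @ts_approx e n.+1%:R^-1 ltac:(by rewrite invr_gt0)).
  have small d : 0 < d -> exists N, forall n, (N <= n)%N -> `|B| * `|e - ts (s n)| <= d.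
    move=> d0; exists (Num.bound ((`|B| + 1) / d)) => n Nn.
    apply: (@le_trans _ _ ((`|B| + 1) * `|e - ts (s n)|)); first by rewrite ler_wpM2r// lerDl.
    rewrite mulrC -ler_pdivlMr//; apply: le_trans (ltW (sP n)) _.
    rewrite -[leRHS]invrK lef_pV2 ?posrE ?invr_gt0 ?divr_gt0// invf_div.
    apply: le_trans (ltW (archi_boundP _)) _; first by rewrite divr_ge0// ltW.
    by rewrite ler_nat (leq_trans Nn).
  have : cvg (Bs \o s @ \oo).
    apply: cauchy_cvg; apply: cauchy_exP => d d0.
    have d3 : 0 < d / 3 by rewrite divr_gt0.
    have [N HN] := small _ d3; exists (Bs (s N)); exists N => // n /= Nn.
    rewrite -ball_normE /=; apply: le_lt_trans (Bs_sub _ _) _.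
    have -> : ts (s N) - ts (s n) = (e - ts (s n)) - (e - ts (s N)) by abel.
    apply: le_lt_trans (ler_wpM2l (normr_ge0 _) (ler_normB _ _)) _.
    by rewrite mulrDr; have := HN n Nn; have := HN N (leqnn N); lra.
  move=> /cvg_ex[v sv]; exists v => s'; apply/ler_addgt0Pr => d d0.
  have d2 : 0 < d / 2 by rewrite divr_gt0.
  have [N HN] := small _ d2.
  have /cvgrPdist_le/(_ _ d2)[M _ HM] := sv.
  have := HM (maxn N M) (leq_maxr _ _); have := HN (maxn N M) (leq_maxl _ _).
  rewrite /=; move: (maxn N M) => n h1 h2.
  have -> : v - Bs s' = (Bs (s n) - Bs s') + (v - Bs (s n)) by abel.
  apply: le_trans (ler_normD _ _) _.
  have h3 := Bs_sub (s n) s'.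
  have h4 : `|B| * `|ts (s n) - ts s'| <= `|B| * `|e - ts s'| + `|B| * `|e - ts (s n)|.
    rewrite -mulrDr ler_wpM2l//.
    have -> : ts (s n) - ts s' = (e - ts s') - (e - ts (s n)) by abel.
    exact: ler_normB.
  lra.
have [L LP] := choice lim_ex.
have small (x : W) (C : R) : 0 <= C -> (forall d : R, 0 < d -> `|x| <= C * d) -> x = 0.
  move=> C0 H; apply/eqP; rewrite -normr_le0; apply/ler_addgt0Pr => d d0.
  rewrite add0r; have p : 0 < C + 1 by rewrite ltr_wpDl.
  apply: le_trans (H _ (divr_gt0 d0 p)) _.
  by rewrite mulrA ler_pdivrMr// mulrC ler_pM2l// lerDl.
have Llin : linear L.
  move=> a e e'; apply/eqP; rewrite -subr_eq0; apply/eqP.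
  apply: (small _ (2 * `|B| * (`|a| + 1))); first by rewrite !mulr_ge0// addr_ge0.
  move=> d d0; have [s es] := ts_approx e d0; have [s' es'] := ts_approx e' d0.
  have h1 := LP e s; have h2 := LP e' s'.
  have h3 := LP (a *: e + e') (scale_seq a s ++ s').
  rewrite Bs_cat ts_cat Bs_scale ts_scale in h3.
  have -> : L (a *: e + e') - (a *: L e + L e') =
    (L (a *: e + e') - (a *: Bs s + Bs s')) - (a *: (L e - Bs s) + (L e' - Bs s')).
    by rewrite scalerBr; abel.
  have E3 : a *: e + e' - (a *: ts s + ts s') = a *: (e - ts s) + (e' - ts s').
    by rewrite scalerBr; abel.
  have k : `|a| * `|e - ts s| + `|e' - ts s'| <= (`|a| + 1) * d.
    by rewrite mulrDl mul1r lerD// ?ler_wpM2l// ltW.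
  have k3 : `|a *: e + e' - (a *: ts s + ts s')| <= (`|a| + 1) * d.
    by rewrite E3 (le_trans (ler_normD _ _))// normrZ.
  have -> : 2 * `|B| * (`|a| + 1) * d = `|B| * ((`|a| + 1) * d) + `|B| * ((`|a| + 1) * d).
    by ring.
  apply: le_trans (ler_normB _ _) _; apply: lerD.
    by apply: le_trans h3 _; rewrite ler_wpM2l.
  apply: le_trans (ler_normD _ _) _; rewrite normrZ.
  apply: le_trans (_ : `|B| * (`|a| * `|e - ts s| + `|e' - ts s'|) <= _); last first.
    by rewrite ler_wpM2l.
  by rewrite mulrDr mulrCA lerD// ler_wpM2l.
have Lbd e : `|L e| <= `|B| * `|e|.
  have := LP e [::]; rewrite /Bs big_nil /tensor_sum big_nil !subr0; exact.
exists (mkop Llin Lbd); last exact: norm_mkop.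
move=> v w; rewrite mkopE; apply/eqP; rewrite -subr_eq0 -normr_le0.
have := LP (ot v w) [:: (v, w)]; rewrite ts1 subrr normr0 mulr0.
by rewrite /Bs big_seq1.
Qed.

Lemma tensor_liftE v w : tensor_lift ot B (ot v w) = B v w.
Proof.
have [L LB _] := tensor_lift_exists.
exact: (@xgetPex _ 0 [set L : 'L(E; W) | forall v w, L (ot v w) = B v w] (ex_intro _ L LB)).
Qed.

Lemma norm_tensor_lift : `|tensor_lift ot B| <= `|B|.
Proof.
have [L LB Ln] := tensor_lift_exists.
rewrite (_ : tensor_lift ot B = L)//.
by apply: tensor_op_unique => v w; rewrite LB tensor_liftE.
Qed.

End lift.

(** For a fixed tensor e the lift depends on B through a bounded operator of norm
    at most |e|, so that [Cfam_op] applies to the germs. *)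
Section liftL.
Variables (W : completeNormedModType R) (e : E).
Fact liftL_linear : linear (fun B : 'L(V; 'L(V; W)) => tensor_lift ot B e).
Proof.
move=> a B B'; suff -> : tensor_lift ot (a *: B + B') = a *: tensor_lift ot B + tensor_lift ot B' by [].
by apply: tensor_op_unique => v w; rewrite opD opZ !tensor_liftE.
Qed.
Fact liftL_bounded (B : 'L(V; 'L(V; W))) : `|tensor_lift ot B e| <= `|e| * `|B|.
Proof.
apply: le_trans (norm_op_le _ _) _; rewrite mulrC ler_wpM2l//; exact: norm_tensor_lift.
Qed.
Definition liftL : 'L('L(V; 'L(V; W)); W) := mkop liftL_linear liftL_bounded.
Lemma norm_liftL : `|liftL| <= `|e|. Proof. exact: norm_mkop. Qed.
Lemma liftLE B : liftL B = tensor_lift ot B e. Proof. by []. Qed.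
End liftL.

End TensorLift.

(** * Sewing and second order expansions in C^m *)

Section FunctionBalls.
Context {R : realType}.
Implicit Types N U : normedModType R.

Lemma Cfam_cst (Z : topologicalType) U m (S : set Z) c w N (g : Z -> N) :
  continuous g -> (forall z, S z -> forall u, `|g z| <= c * w 0%N u) ->
  (forall k z u, (k <= m)%N -> S z -> 0 <= c * w k u) ->
  Cfam m S c w (fun z (_ : U) => g z).
Proof.
move=> + + cw0; have c1 N' (g' : Z -> N') : continuous g' ->
    continuous (fun p : Z * U => g' p.1).
  by move=> gc p; apply: (@continuous_comp _ _ _ fst g'); [exact: cvg_fst|exact: gc].
elim: m w N g cw0 => [|m IH] w N g cw0 gc gb; first by split=> //; [exact: c1|move=> z u /gb].
apply: (Cfam_intro (P' := fun _ _ => 0)).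
- exact: c1.
- by move=> z u /gb.
- by move=> z u; exact: is_fderive_cst.
apply: (IH (fun k => w k.+1) _ (fun _ => 0)) => [k z u km Sz| |z Sz u].
- exact: (cw0 k.+1 z u km Sz).
- exact: cst_continuous.
- by rewrite normr0; exact: (cw0 1%N z u isT Sz).
Qed.

Lemma cball_cst0 U m w N : (forall k u, 0 <= w k u) -> cball m w 0 (fun _ : U => 0 : N).
Proof.
move=> w0; apply: (@Cfam_cst R U m setT 0 w N (fun _ => 0)) => [|z _ u|k z u _ _].
- exact: cst_continuous.
- by rewrite normr0 mul0r.
- by rewrite mul0r.
Qed.

Lemma cball_eq U m w c c' N (f g : U -> N) : c = c' -> (forall u, f u = g u) ->
  cball m w c f -> cball m w c' g.
Proof. by move=> -> /funext ->. Qed.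

Lemma cball_le U m w c c' N (f : U -> N) : (forall k u, 0 <= w k u) -> c <= c' ->
  cball m w c f -> cball m w c' f.
Proof. by move=> w0 cc; apply: Cfam_le => // k z u _ _; rewrite ler_wpM2r. Qed.

Lemma cball_add U m w c c' N (f g : U -> N) :
  cball m w c f -> cball m w c' g -> cball m w (c + c') (fun u => f u + g u).
Proof. exact: Cfam_add. Qed.

Lemma cball_opp U m w c N (f : U -> N) : cball m w c f -> cball m w c (fun u => - f u).
Proof. exact: Cfam_opp. Qed.

Lemma cball_op U m w c N N' (L : 'L(N; N')) (f : U -> N) : `|L| <= 1 ->
  cball m w c f -> cball m w c (fun u => L (f u)).
Proof. by move=> L1 /(Cfam_op L1); rewrite mul1r. Qed.

Lemma cball_opa U m w c N N' (L : 'L(N; N')) a (f : U -> N) : `|L| <= a ->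
  cball m w c f -> cball m w (a * c) (fun u => L (f u)).
Proof. exact: Cfam_op. Qed.

Lemma cball_scale U m w c N (a : R) (f : U -> N) :
  cball m w c f -> cball m w (`|a| * c) (fun u => a *: f u).
Proof. exact: Cfam_scale. Qed.

Lemma cball_closed U m w c N (f : U -> N) : (forall k u, 0 <= w k u) ->
  (forall e, 0 < e -> cball m w (c + e) f) -> cball m w c f.
Proof.
move=> w0 H; have /CfamP[fc fd _] := H 1 ltr01.
apply/CfamP; split=> // k km z u _; apply/ler_addgt0Pr => e e0.
have p : 0 < w k u + 1 by rewrite ltr_wpDl.
have /CfamP[_ _ /(_ k km z u I)] := H _ (divr_gt0 e0 p).
rewrite mulrDl => /le_trans; apply; rewrite lerD2l mulrAC ler_pdivrMr//.
by rewrite ler_pM2l// lerDl.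
Qed.

(** Apply [Cfam_mvt] to z |-> P z - Q a z, whose derivative Q z - Q a is small. *)
Lemma Cfam_mvt2 (Z U : normedModType R) m c w c0 w0 c1 w1 N
    (P : Z -> U -> N) (Q : Z -> U -> 'L(Z; N)) (a b : Z) :
  Cfam m set0 c0 w0 P -> Cfam m set0 c1 w1 Q ->
  (forall z u, is_fderive (P^~ u) z (Q z u)) ->
  (forall t : R, 0 <= t <= 1 ->
    cball m w c (fun u => Q (a + t *: (b - a)) u - Q a u)) ->
  cball m w (c * `|b - a|) (fun u => P b u - P a u - Q a u (b - a)).
Proof.
move=> FP FQ PQ Qb.
pose w1' : nat -> U -> R := fun _ _ => 0.
have FQa : Cfam m set0 0 w1' (fun _ : Z => Q a).
  by apply: (Cfam_reparam (g := fun _ : Z => a) (S := set0)) (Cfam_nobound _ _ FQ) => //; exact: cst_continuous.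
have Fid : Cfam m (@set0 Z) 0 w1' (fun (z : Z) (_ : U) => z).
  by apply: Cfam_cst => //; move=> z; exact: cvg_id.
have Fev : Cfam m set0 c0 w0 (fun z u => Q a u z).
  apply: (Cfam_nobound _ _ (Cfam_bil (B := idop 'L(Z; N)) (lexx 0) (lexx 0) _ _ (lexx _) FQa Fid)).
  - by [].
  - by [].
have Fsub : Cfam m set0 (c0 + c0) w0 (fun z u => P z u - Q a u z) by exact: Cfam_sub.
have FQsub : Cfam m set0 (c1 + c1) w1 (fun z u => Q z u - Q a u).
  by apply: Cfam_sub => //; exact: Cfam_nobound FQa.
have := Cfam_mvt (a := a) (b := b) (c := c) (w := w) Fsub FQsub _ Qb.
rewrite /cball (_ : (fun u => P b u - Q a u b - (P a u - Q a u a)) =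
  (fun u => P b u - P a u - Q a u (b - a))); last first.
  by apply/funext => u; rewrite bopB; abel.
apply=> z u.
exact: is_fderive_sub (PQ z u) (is_fderive_op (Q a u) z).
Qed.

Theorem sewing_cball U (N : completeNormedModType R) m (w : nat -> U -> R)
    (T g C : R) (Xi : R -> R -> U -> N) :
  (forall k u, 0 <= w k u) -> (forall k, continuous (w k)) ->
  1 < g -> 0 <= C -> 0 <= T ->
  (forall t, 0 <= t <= T -> Xi t t = (fun=> 0)) ->
  (forall s u t, 0 <= s -> s <= u -> u <= t -> t <= T ->
    cball m w (C * (t - s) `^ g) (fun p => Xi s t p - Xi s u p - Xi u t p)) ->
  exists I : R -> R -> U -> N,
  (forall s u t, 0 <= s -> s <= u -> u <= t -> t <= T ->
     forall p, I s t p = I s u p + I u t p) /\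
  (forall s t, 0 <= s -> s <= t -> t <= T ->
    cball m w (sew_cst g C * (t - s) `^ g) (fun p => I s t p - Xi s t p)).
Proof.
move=> w0 wc g1 C0 T0 Xi0 Xid.
have [||||||||||I [Iadd IXi]] := @sewing R (U -> N : zmodType) (@cball R U N m w) _ _ _ _ _ _ _ T g C Xi g1 C0.
- exact: cball_cst0.
- by move=> c d x cd; exact: cball_le.
- by move=> c d x y; exact: cball_add.
- by move=> c x; exact: cball_opp.
- by move=> c x; exact: cball_closed.
- move=> x xb; apply/funext => u; apply/eqP; rewrite -normr_le0.
  by have := Cfam_bound xb (z := 0) u Logic.I; rewrite mul0r.
- move=> e f e0 ecvg fc.
  have fs i : Cfam m (@set0 R) 0 w (fun=> (fun u => f i u - f 0%N u)).
    exact: Cfam_nobound (fc 0%N i (leq0n i)).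
  have fc' i j : (i <= j)%N ->
      cball m w (e i) (fun u => (f j u - f 0%N u) - (f i u - f 0%N u)).
    move=> ij; have := fc i j ij; congr cball; apply/funext => u.
    by rewrite -[(f j - f i) u]/(f j u - f i u); abel.
  have [h hP] := cball_complete wc e0 ecvg fs fc'.
  exists (fun u => h u + f 0%N u) => i; have := hP i; congr cball.
  apply/funext => u; rewrite -[(_ - f i) u]/(h u + f 0%N u - f i u); abel.
- exact: Xi0.
- exact: Xid.
- exact: T0.
exists I; split=> // s u t s0 su ut tT p.
by rewrite (Iadd s u t).
Qed.

Lemma powR_weight_continuous U (b : R) : continuous (fun u : U => (1 + `|u|) `^ b).
Proof.
move=> u; apply: (@continuous_comp _ _ _ (fun u : U => 1 + `|u|) (fun x : R => x `^ b)).
  by apply: cvgD; [exact: cvg_cst|exact: norm_continuous].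
apply: differentiable_continuous; apply/derivable1_diffP; apply: derivable_powR.
by rewrite in_itv/= andbT ltr_wpDr.
Qed.

End FunctionBalls.

(** * Increments of the coefficients *)

Section Weights.
Context {R : realType} (V : normedModType R) (beta : nat -> R).

Definition weight (b : nat -> R) (k : nat) (y : V) : R := (1 + `|y|) `^ b k.
Definition weight2 (k : nat) (p : V * V) : R :=
  weight (beta_star beta) k p.1 * weight (beta_sstar beta) k p.2.

Lemma weight_ge0 b k y : 0 <= weight b k y. Proof. exact: powR_ge0. Qed.

Lemma weight_le (b b' : nat -> R) k k' y : b k <= b' k' -> weight b k y <= weight b' k' y.
Proof. by move=> bb; apply: ler_powR => //; rewrite lerDl. Qed.

Lemma weight2_ge0 k p : 0 <= weight2 k p. Proof. by rewrite mulr_ge0// weight_ge0. Qed.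

Lemma weight2_continuous k : continuous (weight2 k).
Proof.
move=> p; apply: cvgM.
  apply: (@continuous_comp _ _ _ fst (weight (beta_star beta) k)); first exact: cvg_fst.
  exact: powR_weight_continuous.
apply: (@continuous_comp _ _ _ snd (weight (beta_sstar beta) k)); first exact: cvg_snd.
exact: powR_weight_continuous.
Qed.

Lemma beta_starS k : beta_star beta k <= beta_star beta k.+1.
Proof. exact: le_bigmax_nat. Qed.

Lemma beta_star_ge k : beta k <= beta_star beta k.
Proof. by apply: le_bigmax_seq; rewrite // mem_index_iota ltnS leqnn. Qed.

Lemma beta_sstarS k : beta_sstar beta k <= beta_sstar beta k.+1.
Proof. exact: le_bigmax_nat. Qed.

Lemma beta_sstar_ge k : beta k.+1 <= beta_sstar beta k.
Proof. by apply: le_bigmax_seq; rewrite // mem_index_iota ltnS leqnn. Qed.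

End Weights.

Section Products.
Context {R : realType} (V : normedModType R) (beta : nat -> R) (m : nat).
Local Notation wx := (weight (beta_star beta)).
Local Notation wy := (weight (beta_sstar beta)).
Local Notation w := (@weight2 R V beta).

(** All coefficients have this form, a function of y multiplied by a function of
    x: differentiating the first one uses beta_sstar, the second one beta_star. *)
Lemma Cfam_prod (Z : topologicalType) (S : set Z) (c1 c2 : R) (N1 N2 N : normedModType R)
    (B : 'L(N1; 'L(N2; N))) (P1 : Z -> V -> N1) (P2 : Z -> V -> N2) :
  0 <= c1 -> 0 <= c2 -> `|B| <= 1 ->
  Cfam m S c1 wy P1 -> Cfam m S c2 wx P2 ->
  Cfam m S (2 ^+ m * (c1 * c2)) w (fun z (p : V * V) => B (P1 z p.2) (P2 z p.1)).
Proof.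
move=> c10 c20 B1 F1 F2.
have G1 := Cfam_pre (@norm_sndL R V V) F1; have G2 := Cfam_pre (@norm_fstL R V V) F2.
have := Cfam_bil c10 c20 _ _ B1 G1 G2; rewrite mul1r => H.
apply: Cfam_le (H _ _) => // [k z p _ _|k p|k p].
- by rewrite /weight2 [X in _ <= _ * X]mulrC.
- exact/weight_le/beta_sstarS.
- exact/weight_le/beta_starS.
Qed.

Lemma cball_ev (c1 c2 : R) (N : normedModType R) (P1 : V -> 'L(V; N)) (P2 : V -> V) :
  0 <= c1 -> 0 <= c2 -> cball m wy c1 P1 -> cball m wx c2 P2 ->
  cball m w (2 ^+ m * (c1 * c2)) (fun p : V * V => P1 p.2 (P2 p.1)).
Proof. by move=> c10 c20 F1 F2; apply: (Cfam_prod (B := idop 'L(V; N))) F1 F2; rewrite ?norm_idop. Qed.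

Lemma cball_comp (c1 c2 : R) (N : normedModType R) (P1 : V -> 'L(V; N)) (P2 : V -> 'L(V; V)) :
  0 <= c1 -> 0 <= c2 -> cball m wy c1 P1 -> cball m wx c2 P2 ->
  cball m w (2 ^+ m * (c1 * c2)) (fun p : V * V => op_comp (P1 p.2) (P2 p.1)).
Proof. by move=> c10 c20 F1 F2; apply: (Cfam_prod (B := op_compL V V N)) F1 F2; rewrite ?norm_op_compL. Qed.

End Products.

Section Increments.
Context {R : realType} (U W N : normedModType R).

Lemma op_increment (L' L : 'L(U; N)) u' u : (L' - L) u' + L (u' - u) = L' u' - L u.
Proof. by rewrite bopB opB; abel. Qed.

Lemma op_comp_increment (A' A : 'L(W; N)) (B' B : 'L(U; W)) :
  op_comp (A' - A) B' + op_comp A (B' - B) = op_comp A' B' - op_comp A B.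
Proof. by apply: op_ext => u; rewrite !(opD, opN, op_compE, bopD, bopN); abel. Qed.

Lemma flip_remainder (L' L : 'L(U; N)) (B : 'L(U; 'L(W; N))) u v :
  - ((L' - L - flip B v) u) = B u v - (L' - L) u.
Proof. by rewrite !(opD, opN, flipE); abel. Qed.

End Increments.

(** The coefficients of the two integrals and their increments between two points
    a and b of K that are joined by a segment in K.  The bounds are explicit
    multiples of powers of |b - a|, with a common bound C of f and its first
    three derivatives in the first argument, so that they are uniform in a and b. *)
Section Regularity.
Context {R : realType} (V : normedModType R).
Variables (beta : nat -> R) (m : nat) (f : V -> V -> V) (K : set V) (C : R).
Local Notation wb := (@weight R V beta).
Local Notation wx := (@weight R V (beta_star beta)).
Local Notation wy := (@weight R V (beta_sstar beta)).
Local Notation w := (@weight2 R V beta).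
Local Notation F1 := (D1 f).
Local Notation F2 := (D1 (D1 f)).
Local Notation F3 := (D1 (D1 (D1 f))).
Hypothesis C0 : 0 <= C.
Hypothesis K0 : Cfam m.+1 K C wb f.
Hypothesis K1 : Cfam m.+1 K C wb F1.
Hypothesis K2 : Cfam m.+1 K C wb F2.
Hypothesis K3 : Cfam m.+1 K C wb F3.
Hypothesis df : forall z y, differentiable (f^~ y) z.
Hypothesis dF1 : forall z y, differentiable (F1^~ y) z.
Hypothesis dF2 : forall z y, differentiable (F2^~ y) z.

Lemma D1f z y : is_fderive (f^~ y) z (F1 z y). Proof. exact: is_fderive_diff. Qed.
Lemma D1F1 z y : is_fderive (F1^~ y) z (F2 z y). Proof. exact: is_fderive_diff. Qed.
Lemma D1F2 z y : is_fderive (F2^~ y) z (F3 z y). Proof. exact: is_fderive_diff. Qed.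

Lemma D1D2f z y : is_fderive ((D2 f)^~ y) z (flip (D2 F1 z y)).
Proof.
apply: (@schwarz R V V V f F1 (D2 f) (D2 F1)) => //.
- exact: D1f.
- exact: (Cfam_is_fderive K0).
- exact: (Cfam_is_fderive K1).
- exact: (Cfam_continuous (Cfam_deriv K1)).
Qed.

Lemma D1D2F1 z y : is_fderive ((D2 F1)^~ y) z (flip (D2 F2 z y)).
Proof.
apply: (@schwarz R V V _ F1 F2 (D2 F1) (D2 F2)) => //.
- exact: D1F1.
- exact: (Cfam_is_fderive K1).
- exact: (Cfam_is_fderive K2).
- exact: (Cfam_continuous (Cfam_deriv K2)).
Qed.

(** [schwarz] for (z, u) |-> f (z + u) y, both partial derivatives of which are
    D1 f (z + u) y. *)
Lemma F2_sym z y : flip (F2 z y) = F2 z y.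
Proof.
have sh z' u : is_fderive (fun u => f (z' + u) y) u (F1 (z' + u) y).
  move=> e e0; have := @D1f (z' + u) y e e0; apply: near_imp => h.
  by rewrite addrA.
have sh1 z' u : is_fderive (fun u => F1 (z' + u) y) u (F2 (z' + u) y).
  move=> e e0; have := @D1F1 (z' + u) y e e0; apply: near_imp => h.
  by rewrite addrA.
have shl z' u : is_fderive (fun z => f (z + u) y) z' (F1 (z' + u) y).
  move=> e e0; have := @D1f (z' + u) y e e0; apply: near_imp => h.
  by rewrite [z' + u + h]addrAC.
have := @schwarz R V V V (fun z u => f (z + u) y) (fun z u => F1 (z + u) y)
  (fun z u => F1 (z + u) y) (fun z u => F2 (z + u) y) z 0 shl sh sh1.
rewrite addr0 => H; apply: is_fderive_unique (H _) _.
  apply: (@continuous_comp _ _ _ (fun p : V * V => (p.1 + p.2, y)) (fun p : V * V => F2 p.1 p.2)).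
    apply: (@cvg_pair _ _ _ (nbhs _)); last exact: cvg_cst.
    by apply: cvgD; [exact: cvg_fst|exact: cvg_snd].
  exact: (Cfam_continuous K2).
have e : (fun x => F1 (x + 0) y) = F1^~ y by apply/funext => x; rewrite addr0.
by have := @D1F1 z y; rewrite -e.
Qed.

(** Differentiate [F2_sym] in y. *)
Lemma D2F2_sym z y u v v' : D2 F2 z y u v v' = D2 F2 z y u v' v.
Proof.
have h1 := Cfam_is_fderive K2 z y.
have h2 := is_fderive_opl (flipL V V V) h1.
have e : (fun y => flipL V V V (F2 z y)) = F2 z.
  by apply/funext => y'; exact: F2_sym.
rewrite e in h2.
by rewrite {1}/D2 (is_fderive_unique h1 h2).
Qed.

(** H, A and H' = dH/dz, with values in functions of p = (x, y). *)
Definition rough_coef (z : V) (p : V * V) : 'L(V; V) := D2 F1 z p.2 (f z p.1).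
Definition young_coef (z : V) (p : V * V) : 'L(V; 'L(V; V)) := D2 F2 z p.2 (f z p.1).
Definition rough_coef_deriv (z : V) (p : V * V) : 'L(V; 'L(V; V)) :=
  young_coef z p + op_comp (D2 F1 z p.2) (F1 z p.1).

Lemma is_fderive_rough_coef z p : is_fderive (rough_coef^~ p) z (rough_coef_deriv z p).
Proof.
have := is_fderive_bil (idop 'L(V; 'L(V; V))) (D1D2F1 z p.2) (D1f z p.1).
by congr (is_fderive _ _ _); apply: op_ext => v; apply: op_ext => w'.
Qed.

Lemma fderive_rough_coef z p : fderive (rough_coef^~ p) z = rough_coef_deriv z p.
Proof. by have /is_fderiveP[_ <-] := is_fderive_rough_coef z p. Qed.

Definition segment_in (a b : V) := forall t : R, 0 <= t <= 1 -> K (a + t *: (b - a)).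

Lemma segment_in_l a b : segment_in a b -> K a.
Proof. by move=> /(_ 0); rewrite scale0r addr0 lexx ler01; apply. Qed.

Lemma segment_in_r a b : segment_in a b -> K b.
Proof. by move=> /(_ 1); rewrite scale1r addrCA subrr addr0 lexx ler01; apply. Qed.

Lemma segment_in_sub a b t : segment_in a b -> 0 <= t <= 1 -> segment_in a (a + t *: (b - a)).
Proof.
move=> ab /andP[t0 t1] t' /andP[t'0 t'1]; rewrite addrAC subrr add0r scalerA.
by apply: ab; rewrite mulr_ge0//= mulr_ile1.
Qed.

Lemma wb_wy (N : normedModType R) c (P : V -> N) : cball m (fun k => wb k.+1) c P ->
  0 <= c -> cball m wy c P.
Proof. by move=> + c0; apply: Cfam_le => // k z u _ _; rewrite ler_wpM2l// weight_le// beta_sstar_ge. Qed.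

Lemma wb_wx (N : normedModType R) c (P : V -> N) : cball m.+1 wb c P ->
  0 <= c -> cball m wx c P.
Proof. by move=> + c0; apply: Cfam_le => // k z u _ _; rewrite ler_wpM2l// weight_le// beta_star_ge. Qed.

Lemma cball_deriv_sub (N : normedModType R) (P : V -> V -> N) c a b :
  (forall z y, differentiable (P z) y) ->
  cball m.+1 wb c (fun y => P b y - P a y) ->
  cball m (fun k => wb k.+1) c (fun y => D2 P b y - D2 P a y).
Proof.
move=> dP /Cfam_deriv; congr (Cfam _ _ _ _ _); apply/funext => _; apply/funext => y.
by have /is_fderiveP[] := is_fderive_sub (is_fderive_diff (dP b y)) (is_fderive_diff (dP a y)).
Qed.

Section increments.
Variables a b : V.
Hypothesis ab : segment_in a b.
Let d : R := `|b - a|.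
Let cd0 : 0 <= C * d. Proof. exact: mulr_ge0 C0 (normr_ge0 _). Qed.

Lemma df_bound : cball m.+1 wb (C * d) (fun y => f b y - f a y).
Proof. by apply: (Cfam_mvt (Cfam_nobound 0 wb K0) (Cfam_nobound 0 wb K1) D1f) => t t01; exact: Cfam_cball (ab t01) K1. Qed.

Lemma dF1_bound : cball m.+1 wb (C * d) (fun y => F1 b y - F1 a y).
Proof. by apply: (Cfam_mvt (Cfam_nobound 0 wb K1) (Cfam_nobound 0 wb K2) D1F1) => t t01; exact: Cfam_cball (ab t01) K2. Qed.

Lemma dF2_bound : cball m.+1 wb (C * d) (fun y => F2 b y - F2 a y).
Proof. by apply: (Cfam_mvt (Cfam_nobound 0 wb K2) (Cfam_nobound 0 wb K3) D1F2) => t t01; exact: Cfam_cball (ab t01) K3. Qed.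

Lemma dD2f_bound : cball m (fun k => wb k.+1) (C * d) (fun y => D2 f b y - D2 f a y).
Proof. by apply: cball_deriv_sub df_bound; case: K0 => _ _ []. Qed.

Lemma dD2F1_bound : cball m (fun k => wb k.+1) (C * d) (fun y => D2 F1 b y - D2 F1 a y).
Proof. by apply: cball_deriv_sub dF1_bound; case: K1 => _ _ []. Qed.

Lemma dD2F2_bound : cball m (fun k => wb k.+1) (C * d) (fun y => D2 F2 b y - D2 F2 a y).
Proof. by apply: cball_deriv_sub dF2_bound; case: K2 => _ _ []. Qed.

Lemma dyoung_coef_bound : cball m w (2 * (2 ^+ m * C ^+ 2) * d) (fun p => young_coef b p - young_coef a p).
Proof.
have h1 := cball_ev cd0 C0 (wb_wy dD2F2_bound cd0) (wb_wx (Cfam_cball (segment_in_r ab) K0) C0).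
have h2 := cball_ev C0 cd0 (wb_wy (Cfam_cball (segment_in_l ab) (Cfam_deriv K2)) C0) (wb_wx df_bound cd0).
apply: cball_eq (cball_add h1 h2); first by ring.
by move=> p; exact: op_increment.
Qed.

Lemma drough_coef_deriv_bound : cball m w (4 * (2 ^+ m * C ^+ 2) * d) (fun p => rough_coef_deriv b p - rough_coef_deriv a p).
Proof.
have h1 := cball_comp cd0 C0 (wb_wy dD2F1_bound cd0) (wb_wx (Cfam_cball (segment_in_r ab) K1) C0).
have h2 := cball_comp C0 cd0 (wb_wy (Cfam_cball (segment_in_l ab) (Cfam_deriv K1)) C0) (wb_wx dF1_bound cd0).
apply: cball_eq (cball_add dyoung_coef_bound (cball_add h1 h2)); first by ring.
move=> p; rewrite (op_comp_increment (D2 F1 b p.2) (D2 F1 a p.2)) /rough_coef_deriv; abel.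
Qed.

Lemma dfdf_bound : cball m w (2 ^+ m * C ^+ 2 * d ^+ 2)
  (fun p => (D2 f b p.2 - D2 f a p.2) (f b p.1 - f a p.1)).
Proof.
apply: cball_eq (cball_ev cd0 cd0 (wb_wy dD2f_bound cd0) (wb_wx df_bound cd0)) => //.
by ring.
Qed.

End increments.

Lemma young_coef_bound a : K a -> cball m w (2 ^+ m * C ^+ 2) (young_coef a).
Proof.
move=> Ka; rewrite expr2.
exact: cball_ev C0 C0 (wb_wy (Cfam_cball Ka (Cfam_deriv K2)) C0) (wb_wx (Cfam_cball Ka K0) C0).
Qed.

Lemma rough_coef_deriv_bound a : K a -> cball m w (2 * (2 ^+ m * C ^+ 2)) (rough_coef_deriv a).
Proof.
move=> Ka; rewrite mulr_natl mulr2n; apply: cball_add (young_coef_bound Ka) _; rewrite expr2.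
exact: cball_comp C0 C0 (wb_wy (Cfam_cball Ka (Cfam_deriv K1)) C0) (wb_wx (Cfam_cball Ka K1) C0).
Qed.

Let K0x := Cfam_le (leqnSn m) (@subset_refl _ K) (fun _ _ _ _ _ => lexx _) K0.
Let K1x := Cfam_le (leqnSn m) (@subset_refl _ K) (fun _ _ _ _ _ => lexx _) K1.

Lemma Cfam_smooth_prod (N1 N2 N : normedModType R) (B : 'L(N1; 'L(N2; N)))
    (P1 : V -> V -> N1) (P2 : V -> V -> N2) c1 w1 c2 w2 :
  Cfam m K c1 w1 P1 -> Cfam m K c2 w2 P2 ->
  Cfam m set0 0 w (fun z (p : V * V) => B (P1 z p.2) (P2 z p.1)).
Proof.
move=> G1 G2.
have H1 := Cfam_pre (@norm_sndL R V V) (Cfam_nobound 0 (fun _ _ => 0) G1).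
have H2 := Cfam_pre (@norm_fstL R V V) (Cfam_nobound 0 (fun _ _ => 0) G2).
by apply: Cfam_nobound (Cfam_bil (lexx 0) (lexx 0) _ _ (lexx `|B|) H1 H2).
Qed.

Lemma rough_coef_smooth : Cfam m set0 0 w rough_coef.
Proof. exact: Cfam_smooth_prod (idop _) _ _ _ _ _ _ (Cfam_deriv K1) K0x. Qed.

Lemma rough_coef_deriv_smooth : Cfam m set0 0 w rough_coef_deriv.
Proof.
have h1 := Cfam_smooth_prod (idop _) (Cfam_deriv K2) K0x.
have h2 := Cfam_smooth_prod (op_compL _ _ _) (Cfam_deriv K1) K1x.
exact: Cfam_nobound (Cfam_add h1 h2).
Qed.

Section remainders.
Variables a b : V.
Hypothesis ab : segment_in a b.
Let d : R := `|b - a|.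
Let cd0 : 0 <= C * d. Proof. exact: mulr_ge0 C0 (normr_ge0 _). Qed.

Let dist_le t : 0 <= t <= 1 -> `|a + t *: (b - a) - a| <= d.
Proof.
move=> /andP[t0 t1]; rewrite addrAC subrr add0r normrZ ger0_norm//.
by rewrite ler_piMl.
Qed.

(** By [Cfam_mvt2], as H' is Lipschitz along the segment. *)
Lemma RH_bound : cball m w (4 * (2 ^+ m * C ^+ 2) * d ^+ 2)
  (fun p => rough_coef b p - rough_coef a p - rough_coef_deriv a p (b - a)).
Proof.
have H := @Cfam_mvt2 R V (V * V)%type m (4 * (2 ^+ m * C ^+ 2) * d) w 0 w 0 w _ rough_coef rough_coef_deriv a b
  rough_coef_smooth rough_coef_deriv_smooth is_fderive_rough_coef.
apply: (cball_eq _ _ (H _)) => [|//|t t01]; first by rewrite -/d; ring.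
apply: cball_le (drough_coef_deriv_bound (segment_in_sub ab t01)); first exact: weight2_ge0.
by rewrite ler_wpM2l ?dist_le// !mulr_ge0// exprn_ge0.
Qed.

Lemma RD2f_bound : cball m wy (C * d ^+ 2)
  (fun y => D2 f b y - D2 f a y - flip (D2 F1 a y) (b - a)).
Proof.
have F1fl : Cfam m set0 0 wy (fun z y => flipL V V V (D2 F1 z y)).
  exact: Cfam_nobound (Cfam_op (norm_flipL _ _ _) (Cfam_deriv K1)).
have H := @Cfam_mvt2 R V V m (C * d) wy 0 wy 0 wy _ (D2 f) _ a b
  (Cfam_nobound _ _ (Cfam_deriv K0)) F1fl D1D2f.
apply: (cball_eq _ _ (H _)) => [|//|t t01]; first by rewrite -/d; ring.
have Cz : 0 <= C * `|a + t *: (b - a) - a| by rewrite mulr_ge0.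
have h := cball_op (norm_flipL V V V) (wb_wy (dD2F1_bound (segment_in_sub ab t01)) Cz).
apply: (@cball_le _ _ _ _ (C * `|a + t *: (b - a) - a|)).
- by move=> k u; exact: weight_ge0.
- by rewrite ler_wpM2l// dist_le.
by apply: cball_eq h => // u; rewrite bopB.
Qed.

(** The first order term of the increment of D2 f(z, y) f(a, x) in z is
    H(a)(x, y) (b - a). *)
Lemma RG_bound : cball m w (2 ^+ m * C ^+ 2 * d ^+ 2)
  (fun p => rough_coef a p (b - a) - (D2 f b p.2 - D2 f a p.2) (f a p.1)).
Proof.
have C20 : 0 <= C * d ^+ 2 by rewrite mulr_ge0// sqr_ge0.
apply: cball_eq (cball_opp (cball_ev C20 C0 RD2f_bound (wb_wx (Cfam_cball (segment_in_l ab) K0) C0))); first by ring.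
by move=> p; exact: flip_remainder.
Qed.

End remainders.

End Regularity.

(** * Compactness of the chords of the path *)

Section Powers.
Context {R : realType}.

Lemma powR_nat_mul (x a : R) n : 0 <= x -> x `^ (n%:R * a) = (x `^ a) ^+ n.
Proof. by move=> x0; rewrite mulrC powRrM powR_mulrn// powR_ge0. Qed.

Lemma holder_continuous (V : normedModType R) (Y : R -> V) (c a : R) :
  0 < a -> (forall r s, `|Y r - Y s| <= c * `|r - s| `^ a) -> continuous Y.
Proof.
move=> a0 Yh s; apply/cvgrPdist_le => e e0.
have p : 0 < `|c| + 1 by rewrite ltr_wpDl.
pose d := (e / (`|c| + 1)) `^ a^-1.
have d0 : 0 < d by rewrite powR_gt0// divr_gt0.
have da : d `^ a = e / (`|c| + 1).
  by rewrite /d -powRrM mulVf ?gt_eqF// powRr1// divr_ge0// ltW.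
apply/nbhs_normP; exists d => //= r /= rs.
apply: le_trans (Yh s r) _.
apply: le_trans (_ : _ <= (`|c| + 1) * d `^ a) _; last by rewrite da mulrC divfK ?gt_eqF.
apply: (@le_trans _ _ ((`|c| + 1) * `|s - r| `^ a)).
  by rewrite ler_wpM2r ?powR_ge0// (le_trans (ler_norm c))// lerDl.
rewrite ler_wpM2l ?(ltW p)//; apply: ge0_ler_powR; rewrite ?nnegrE//; exact: ltW.
Qed.

End Powers.

Section CompactSegments.
Context {R : realType} (V : normedModType R) (T alpha c : R) (X : R -> V).
Hypothesis T0 : 0 < T.
Hypothesis alpha0 : 0 < alpha.
Hypothesis hX : forall s t, s \in `[0, T] -> t \in `[0, T] ->
  `|X t - X s| <= c * `|t - s| `^ alpha.

(** The union of the chords of the path.  It contains the segments on which the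
    mean value theorem is used and, unlike the convex hull, it is compact as
    the continuous image of a product of three segments.  Clipping extends the
    path continuously to all times. *)
Definition chords : set V :=
  (fun q : R * R * R => X (clip 0 T q.1.1) + q.2 *: (X (clip 0 T q.1.2) - X (clip 0 T q.1.1)))
  @` (`[0, T] `*` `[0, T] `*` `[0, 1]).

Lemma clip_in r : clip 0 T r \in `[0, T].
Proof. by rewrite in_itv/= clip_ge clip_le// ltW. Qed.

Lemma clip_id r : r \in `[0, T] -> clip 0 T r = r.
Proof. by rewrite in_itv/= => /andP[r0 rT]; rewrite /clip (min_idPl rT) (max_idPr r0). Qed.

Lemma clipped_continuous : continuous (fun r => X (clip 0 T r)).
Proof.
apply: (@holder_continuous _ _ _ `|c| alpha alpha0) => r s.
apply: le_trans (hX (clip_in s) (clip_in r)) _.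
have h : `|clip 0 T r - clip 0 T s| `^ alpha <= `|r - s| `^ alpha.
  apply: ge0_ler_powR; rewrite ?nnegrE//; first exact: ltW.
  case: (leP s r) => [sr|/ltW rs].
    rewrite !ger0_norm ?subr_ge0 ?clip_homo//; exact: clip_lip.
  rewrite distrC [leRHS]distrC !ger0_norm ?subr_ge0 ?clip_homo//; exact: clip_lip.
apply: le_trans (ler_wpM2r (powR_ge0 _ _) (ler_norm c)) _.
by rewrite ler_wpM2l.
Qed.

Lemma chords_compact : compact chords.
Proof.
apply: continuous_compact; last first.
  by apply: compact_setX; [apply: compact_setX|]; exact: segment_compact.
apply: continuous_subspaceT => q.
have c1 : {for q, continuous (fun q : R * R * R => X (clip 0 T q.1.1))}.
  apply: (@continuous_comp _ _ _ (fun q : R * R * R => q.1.1) (fun r => X (clip 0 T r))).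
    by apply: (@continuous_comp _ _ _ fst fst); exact: cvg_fst.
  exact: clipped_continuous.
have c2 : {for q, continuous (fun q : R * R * R => X (clip 0 T q.1.2))}.
  apply: (@continuous_comp _ _ _ (fun q : R * R * R => q.1.2) (fun r => X (clip 0 T r))).
    by apply: (@continuous_comp _ _ _ fst snd); [exact: cvg_fst|exact: cvg_snd].
  exact: clipped_continuous.
by apply: cvgD => //; apply: cvgZ; [exact: cvg_snd|apply: cvgB].
Qed.

Lemma chords_seg s t : s \in `[0, T] -> t \in `[0, T] -> segment_in chords (X s) (X t).
Proof.
move=> sT tT r r01; exists ((s, t), r) => /=; last by rewrite !clip_id.
by split=> //=; rewrite in_itv.
Qed.

End CompactSegments.

Section ClocFam.
Context {R : realType} (V : normedModType R) (beta : nat -> R) (n : nat).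

(** Every supremum in the norm of f over K is nonnegative, hence at most the total;
    the total serves as one constant for all orders. *)
Lemma Cloc_fam (f : V -> V -> V) (K : set V) : Cloc 3 n beta f -> compact K -> K !=set0 ->
  exists2 C : R, 0 <= C &
    forall j, (j <= 3)%N -> Cfam n K C (weight beta) (D1n j f).
Proof.
move=> [[dD1 dD2 cD] bK] Kc [x0 Kx0].
pose S (j k : nat) := ereal_sup
  [set (`|D2n k (D1n j f) p.1 p.2| / (1 + `|p.2|) `^ beta k)%:E | p in K `*` [set: V]].
have S0 j k : (0 <= S j k)%E.
  apply: (@le_trans _ _ (`|D2n k (D1n j f) x0 0| / (1 + `|0 : V|) `^ beta k)%:E).
    by rewrite lee_fin divr_ge0// powR_ge0.
  by apply: ereal_sup_ubound; exists (x0, 0).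
have Nfin := bK K Kc.
have N0 : (0 <= Cloc_norm K 3 n beta f)%E.
  by apply: sume_ge0 => j _; apply: sume_ge0 => k _; exact: S0.
have Nreal : Cloc_norm K 3 n beta f = (fine (Cloc_norm K 3 n beta f))%:E.
  by rewrite fineK// ge0_fin_numE.
exists (fine (Cloc_norm K 3 n beta f)); first exact: fine_ge0.
move=> j j3; apply/CfamP; split.
- by move=> k kn; exact: cD.
- by move=> k kn z u; exact: dD2.
move=> k kn z u Kz.
rewrite -ler_pdivrMr; last by rewrite /weight powR_gt0// ltr_pwDl.
rewrite -lee_fin -Nreal.
apply: (@le_trans _ _ (S j k)); first by apply: ereal_sup_ubound; exists (z, u).
rewrite /Cloc_norm (bigD1 (Ordinal (j3 : (j < 4)%N)))//= (bigD1 (Ordinal (kn : (k < n.+1)%N)))//=.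
rewrite -addeA leeDl// adde_ge0//; first by apply: sume_ge0 => i _; exact: S0.
by apply: sume_ge0 => i _; apply: sume_ge0 => i' _; exact: S0.
Qed.

End ClocFam.

(** * The second order process *)

Section Germs.
Context {R : realType} {V E : completeNormedModType R} {ot : {bilinear V -> V -> E}}.
Hypothesis hpt : projective_tensor ot.

Local Notation lift := (tensor_lift ot).

(** The algebra of the two germs and of their sum, with the coefficients replaced
    by arbitrary operators. *)
Lemma rough_increment (Hs Hu : 'L(V; V)) (Ds Du : 'L(V; 'L(V; V))) x y z est esu eut :
  z = x + y -> est - esu - eut = ot x y ->
  (Hs z + lift Ds est) - (Hs x + lift Ds esu) - (Hu y + lift Du eut) =
  - (evL V y (Hu - Hs - Ds x) + liftL hpt V eut (Du - Ds)).
Proof.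
move=> -> e; have -> : est = ot x y + (esu + eut) by rewrite -e; abel.
rewrite evLE bopB !liftLE !bopD tensor_liftE// !(opD, opN); abel.
Qed.

(** The antisymmetric defect of [est] is killed by the symmetry of [As]. *)
Lemma young_increment (As Au : 'L(V; 'L(V; V))) x y est esu eut :
  (forall v w, As v w = As w v) -> est - esu - eut = ot y x - ot x y ->
  lift As est - lift As esu - lift Au eut = - liftL hpt V eut (Au - As).
Proof.
move=> sym e; have -> : est = (ot y x - ot x y) + (esu + eut) by rewrite -e; abel.
rewrite bopB !liftLE !bopD bopN !tensor_liftE// (sym y x); abel.
Qed.

Lemma compensator_increment (X : R -> V) (XX : R -> R -> E) s u t :
  XX s t - XX s u - XX u t = ot (X u - X s) (X t - X u) ->
  compensator ot X XX s t - compensator ot X XX s u - compensator ot X XX u t =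
  ot (X t - X u) (X u - X s) - ot (X u - X s) (X t - X u).
Proof.
move=> e; rewrite /compensator.
have -> : X t - X s = (X u - X s) + (X t - X u) by abel.
have -> : XX s t = ot (X u - X s) (X t - X u) + (XX s u + XX u t) by rewrite -e; abel.
move: (X u - X s) (X t - X u) => x y.
rewrite linearDl /= !linearDr /= !scalerDr !scaler_nat !mulr2n; abel.
Qed.

Lemma area_split (a1 a2 h l1 l2 g : V) :
  a1 - (h + l1) + 2^-1 *: (a2 - l2) + (l1 + 2^-1 *: l2) + (h - g) =
  a1 + (2^-1 : R) *: a2 - g.
Proof. by rewrite scalerBr; abel. Qed.

Lemma area_swap (a1 a2 u v : V) (Gs Gt : 'L(V; V)) :
  - (a1 + (2^-1 : R) *: a2 - (Gs - Gt) v) + (Gs - Gt) (u - v) =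
  - a1 + 2^-1 *: (- a2) - (Gt - Gs) u.
Proof. by rewrite scalerN bopB !(opD, opN); abel. Qed.

Lemma area_chen (j1 j2 a b : V) (Gs Gu Gt : 'L(V; V)) :
  j1 + j2 - (Gt - Gs) a - (j1 - (Gu - Gs) a) - (j2 - (Gt - Gu) b) =
  (Gt - Gu) (b - a).
Proof. by rewrite bopB !(opD, opN); abel. Qed.

End Germs.

Section Main.
Context {R : realType} {V E : completeNormedModType R} (ot : {bilinear V -> V -> E}).
Variables (T alpha : R) (m : nat) (beta : nat -> R) (f : V -> V -> V).
Variables (X : R -> V) (XX : R -> R -> E) (c C : R).
Hypothesis hpt : projective_tensor ot.
Hypothesis T0 : 0 < T.
Hypothesis alpha3 : 1 / 3 < alpha.
Hypothesis c0 : 0 <= c.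
Hypothesis hX : forall s t, s \in `[0, T] -> t \in `[0, T] ->
  `|X t - X s| <= c * `|t - s| `^ alpha.
Hypothesis hXX : forall s t, s \in `[0, T] -> t \in `[0, T] ->
  `|XX s t| <= c * (`|t - s| `^ alpha) ^+ 2.
Hypothesis chen : forall s u t, s \in `[0, T] -> u \in `[0, T] -> t \in `[0, T] ->
  XX s t - XX s u - XX u t = ot (X u - X s) (X t - X u).
Local Notation K := (chords T X).
Local Notation w := (@weight2 R V beta).
Hypothesis C0 : 0 <= C.
Hypothesis K0 : Cfam m.+1 K C (weight beta) f.
Hypothesis K1 : Cfam m.+1 K C (weight beta) (D1 f).
Hypothesis K2 : Cfam m.+1 K C (weight beta) (D1 (D1 f)).
Hypothesis K3 : Cfam m.+1 K C (weight beta) (D1 (D1 (D1 f))).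
Hypothesis df : forall z y, differentiable (f^~ y) z.
Hypothesis dF1 : forall z y, differentiable ((D1 f)^~ y) z.
Hypothesis dF2 : forall z y, differentiable ((D1 (D1 f))^~ y) z.

Let alpha0 : 0 < alpha. Proof. by apply: lt_trans alpha3; rewrite divr_gt0. Qed.
Let rho (s t : R) : R := `|t - s| `^ alpha.
Let D : R := 4 * (2 ^+ m * C ^+ 2).
Let cQ : R := c ^+ 2 + 2 * c.

Let D0 : 0 <= D. Proof. by rewrite /D !mulr_ge0// sqr_ge0. Qed.
Let D1le : 2 ^+ m * C ^+ 2 <= D.
Proof. by have : 0 <= 2 ^+ m * C ^+ 2; [rewrite mulr_ge0// sqr_ge0|rewrite /D; lra]. Qed.
Let D2le : 2 * (2 ^+ m * C ^+ 2) <= D.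
Proof. by have : 0 <= 2 ^+ m * C ^+ 2; [rewrite mulr_ge0// sqr_ge0|rewrite /D; lra]. Qed.
Let rho0 s t : 0 <= rho s t. Proof. exact: powR_ge0. Qed.
Let cQ0 : 0 <= cQ. Proof. by rewrite addr_ge0 ?sqr_ge0// mulr_ge0. Qed.

Let Q := compensator ot X XX.
Let Xi1 (s t : R) (p : V * V) : V := rough_coef f (X s) p (X t - X s) + tensor_lift ot (rough_coef_deriv f (X s) p) (XX s t).
Let Xi2 (s t : R) (p : V * V) : V := tensor_lift ot (young_coef f (X s) p) (Q s t).

Let sg s t : s \in `[0, T] -> t \in `[0, T] -> segment_in K (X s) (X t).
Proof. exact: chords_seg. Qed.

Let Kin s : s \in `[0, T] -> K (X s).
Proof. by move=> sT; apply: segment_in_l (sg sT sT). Qed.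

Lemma hQ s t : s \in `[0, T] -> t \in `[0, T] -> `|Q s t| <= cQ * rho s t ^+ 2.
Proof.
move=> sT tT; rewrite /Q /compensator; apply: le_trans (ler_normB _ _) _.
rewrite /cQ mulrDl; apply: lerD.
  apply: le_trans (norm_ot hpt _ _) _; rewrite -expr2 -exprMn.
  by rewrite lerXn2r// ?nnegrE ?mulr_ge0// hX.
by rewrite normrZ ger0_norm// -mulrA ler_wpM2l// hXX.
Qed.

Lemma XX_diag t : t \in `[0, T] -> XX t t = 0.
Proof.
move=> tT; have := chen tT tT tT; rewrite !subrr linear0r sub0r => /eqP.
by rewrite oppr_eq0 => /eqP.
Qed.

Let itv s t u : 0 <= s -> s <= u -> u <= t -> t <= T -> u \in `[0, T].
Proof. by move=> s0 su ut tT; rewrite in_itv/= (le_trans s0 su) (le_trans ut tT). Qed.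

Let rho_le s u v t : s <= u -> u <= v -> v <= t -> rho u v <= rho s t.
Proof.
move=> su uv vt; apply: ge0_ler_powR; rewrite ?nnegrE//; first exact: ltW.
by rewrite !ger0_norm ?subr_ge0 ?(le_trans su (le_trans uv vt))// lerB.
Qed.

Let rho3 s t : s <= t -> (t - s) `^ (3 * alpha) = rho s t ^+ 3.
Proof. by move=> st; rewrite powR_nat_mul ?subr_ge0// /rho ger0_norm// subr_ge0. Qed.

Let w0 k p : 0 <= w k p. Proof. exact: weight2_ge0. Qed.

Lemma Xi1_delta s u t : 0 <= s -> s <= u -> u <= t -> t <= T ->
  cball m w (D * (c ^+ 3 + c ^+ 2) * (t - s) `^ (3 * alpha))
    (fun p => Xi1 s t p - Xi1 s u p - Xi1 u t p).
Proof.
move=> s0 su ut tT; have st := le_trans su ut.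
have sT := itv s0 (lexx s) st tT; have uT := itv s0 su ut tT.
have tT' := itv s0 st (lexx t) tT.
have r1 : rho s u <= rho s t by apply: rho_le.
have r2 : rho u t <= rho s t by apply: rho_le.
have x1 : `|X u - X s| <= c * rho s t by apply: le_trans (hX sT uT) _; rewrite ler_wpM2l.
have x2 : `|X t - X u| <= c * rho s t by apply: le_trans (hX uT tT') _; rewrite ler_wpM2l.
have x3 : `|XX u t| <= c * rho s t ^+ 2.
  by apply: le_trans (hXX uT tT') _; rewrite ler_wpM2l// lerXn2r// nnegrE.
rewrite rho3//; move: (rho s t) (rho0 s t) x1 x2 x3 => r r0 x1 x2 x3.
have h1 := cball_opa (norm_evL V (X t - X u)) (RH_bound C0 K0 K1 K2 K3 df dF1 dF2 (sg sT uT)).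
have h2 := cball_opa (norm_liftL hpt V (XX u t)) (drough_coef_deriv_bound C0 K0 K1 K2 K3 df dF1 dF2 (sg sT uT)).
have e1 : `|X t - X u| * (D * `|X u - X s| ^+ 2) <= c * r * (D * (c * r) ^+ 2).
  by rewrite ler_pM ?mulr_ge0// ?sqr_ge0// ler_wpM2l// lerXn2r// nnegrE// mulr_ge0.
have e2 : `|XX u t| * (D * `|X u - X s|) <= c * r ^+ 2 * (D * (c * r)).
  by rewrite ler_pM ?mulr_ge0// ler_wpM2l.
have e3 : c * r * (D * (c * r) ^+ 2) + c * r ^+ 2 * (D * (c * r)) =
  D * (c ^+ 3 + c ^+ 2) * r ^+ 3 by ring.
have e4 := lerD e1 e2; rewrite e3 in e4.
apply: (cball_eq (erefl _) _ (cball_le w0 e4 (cball_opp (cball_add h1 h2)))) => p.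
have xe : X t - X s = (X u - X s) + (X t - X u) by abel.
exact: esym (rough_increment hpt (rough_coef f (X s) p) (rough_coef f (X u) p) (rough_coef_deriv f (X s) p)
  (rough_coef_deriv f (X u) p) xe (chen sT uT tT')).
Qed.

Lemma Xi2_delta s u t : 0 <= s -> s <= u -> u <= t -> t <= T ->
  cball m w (D * (cQ * c) * (t - s) `^ (3 * alpha))
    (fun p => Xi2 s t p - Xi2 s u p - Xi2 u t p).
Proof.
move=> s0 su ut tT; have st := le_trans su ut.
have sT := itv s0 (lexx s) st tT; have uT := itv s0 su ut tT.
have tT' := itv s0 st (lexx t) tT.
have r1 : rho s u <= rho s t by apply: rho_le.
have r2 : rho u t <= rho s t by apply: rho_le.
have x1 : `|X u - X s| <= c * rho s t by apply: le_trans (hX sT uT) _; rewrite ler_wpM2l.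
have x3 : `|Q u t| <= cQ * rho s t ^+ 2.
  by apply: le_trans (hQ uT tT') _; rewrite ler_wpM2l// lerXn2r// nnegrE.
rewrite rho3//; move: (rho s t) (rho0 s t) x1 x3 => r r0 x1 x3.
have h := cball_opa (norm_liftL hpt V (Q u t)) (dyoung_coef_bound C0 K0 K1 K2 K3 df dF2 (sg sT uT)).
have e1 : `|Q u t| * (2 * (2 ^+ m * C ^+ 2) * `|X u - X s|) <= cQ * r ^+ 2 * (D * (c * r)).
  by rewrite ler_pM ?mulr_ge0// ?sqr_ge0// ler_pM ?mulr_ge0// ?sqr_ge0.
have e3 : cQ * r ^+ 2 * (D * (c * r)) = D * (cQ * c) * r ^+ 3 by ring.
rewrite e3 in e1.
apply: (cball_eq (erefl _) _ (cball_le w0 e1 (cball_opp h))) => p.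
have sym v v' : young_coef f (X s) p v v' = young_coef f (X s) p v' v by apply: (D2F2_sym K2 df dF1).
exact: esym (young_increment hpt (young_coef f (X u) p) sym
  (compensator_increment (chen sT uT tT'))).
Qed.

Let orient (I : R -> R -> V * V -> V) (s t : R) (p : V * V) : V :=
  if s <= t then I s t p else - I t s p.

Let orientE (I : R -> R -> V * V -> V) :
  (forall s u t, 0 <= s -> s <= u -> u <= t -> t <= T ->
     forall p, I s t p = I s u p + I u t p) ->
  forall s t p, s \in `[0, T] -> t \in `[0, T] -> orient I s t p = I 0 t p - I 0 s p.
Proof.
move=> Iadd s t p; rewrite !in_itv/= => /andP[s0 sT] /andP[t0 tT].
rewrite /orient; case: leP => [st|/ltW ts].
  by rewrite (Iadd 0 s t)//; abel.
by rewrite (Iadd 0 t s)//; abel.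
Qed.

(** The second component, in terms of the coefficients. *)
Definition area (s t : R) (p : V * V) : V :=
  rough_integral ot X XX (fun r => rough_coef f (X r) p) (fun r => fderive (rough_coef f ^~ p) (X r)) s t
  + 2^-1 *: young_integral ot (fun r => young_coef f (X r) p) (compensator ot X XX) s t
  - (D2 f (X t) p.2 - D2 f (X s) p.2) (f (X s) p.1).

(** J is the sum of the two oriented integrals.  For s <= t the bound is that of
    [area_split]: distances to the germs, second order terms of the germs and a
    Taylor remainder.  For t < s, exchanging s and t produces the additional
    product of two increments of order h in [area_swap]. *)
Theorem area_spec : exists J : R -> R -> V * V -> V, exists M : R,
  [/\ forall s u t p, s \in `[0, T] -> u \in `[0, T] -> t \in `[0, T] ->
        J s t p = J s u p + J u t p,
      forall s t p, s \in `[0, T] -> t \in `[0, T] ->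
        area s t p = J s t p - (D2 f (X t) p.2 - D2 f (X s) p.2) (f (X s) p.1) &
      forall s t, s \in `[0, T] -> t \in `[0, T] ->
        cball m w (M * rho s t ^+ 2) (area s t)].
Proof.
have g1 : 1 < 3 * alpha by move: alpha3; rewrite ltr_pdivrMr// mulrC.
have C10 : 0 <= D * (c ^+ 3 + c ^+ 2) by rewrite mulr_ge0// addr_ge0// exprn_ge0.
have C20 : 0 <= D * (cQ * c) by rewrite !mulr_ge0.
have Xi10 t : 0 <= t <= T -> Xi1 t t = (fun=> 0).
  move=> tT; apply/funext => p.
  by rewrite /Xi1 subrr bop0 XX_diag ?in_itv// bop0 addr0.
have Xi20 t : 0 <= t <= T -> Xi2 t t = (fun=> 0).
  move=> tT; apply/funext => p.
  by rewrite /Xi2 /Q /compensator subrr linear0r XX_diag ?in_itv// scaler0 subrr bop0.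
have [I1 [I1add I1Xi]] := sewing_cball w0 (@weight2_continuous _ _ beta) g1 C10 (ltW T0) Xi10 Xi1_delta.
have [I2 [I2add I2Xi]] := sewing_cball w0 (@weight2_continuous _ _ beta) g1 C20 (ltW T0) Xi20 Xi2_delta.
set k1 := sew_cst _ _ in I1Xi; set k2 := sew_cst _ _ in I2Xi.
have k10 : 0 <= k1 by apply: sew_cst_ge0.
have k20 : 0 <= k2 by apply: sew_cst_ge0.
have germE (I Xi : R -> R -> V * V -> V) k p s t :
    0 <= k -> (forall s u t, 0 <= s -> s <= u -> u <= t -> t <= T ->
       forall p, I s t p = I s u p + I u t p) ->
    (forall s t, 0 <= s -> s <= t -> t <= T ->
      cball m w (k * (t - s) `^ (3 * alpha)) (fun p => I s t p - Xi s t p)) ->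
    s \in `[0, T] -> t \in `[0, T] ->
    germ_integral (fun s t => Xi s t p) s t = orient I s t p.
  move=> k0 Iadd IXi sT tT.
  apply: (@germ_integralE R V _ (fun s t => I s t p) T (3 * alpha) (k * w 0%N p) g1) => //.
  - by rewrite mulr_ge0.
  - by move=> s' u t' s0 su ut tT'; apply: Iadd.
  - move=> s' t' s0 st tT'; rewrite mulrAC.
    exact: (Cfam_bound (IXi s' t' s0 st tT') (z := 0)).
pose J s t p := orient I1 s t p + 2^-1 *: orient I2 s t p.
have areaE s t p : s \in `[0, T] -> t \in `[0, T] ->
    area s t p = J s t p - (D2 f (X t) p.2 - D2 f (X s) p.2) (f (X s) p.1).
  move=> sT tT; rewrite /area; congr (_ + _ - _).
    rewrite -(germE I1 Xi1 k1)//; congr (germ_integral _ s t).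
    apply/funext => a; apply/funext => b; rewrite /Xi1.
    by rewrite (fderive_rough_coef K1 K2 df dF1).
  by congr (_ *: _); rewrite -(germE I2 Xi2 k2).
(* the five terms of [area_split]; the errors of order h ^ 3 lose a factor
   T `^ alpha *)
pose k := k1 * T `^ alpha + 2^-1 * (k2 * T `^ alpha) + c * D + 2^-1 * (cQ * D) + D * c ^+ 2.
have le_st s t : s <= t -> s \in `[0, T] -> t \in `[0, T] -> cball m w (k * rho s t ^+ 2)
    (fun p => I1 s t p + 2^-1 *: I2 s t p - (D2 f (X t) p.2 - D2 f (X s) p.2) (f (X s) p.1)).
  move=> st sT tT.
  have [s0 tT'] : 0 <= s /\ t <= T by move: sT tT; rewrite !in_itv => /andP[? _] /andP[].
  have rT : rho s t <= T `^ alpha.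
    apply: ge0_ler_powR; rewrite ?nnegrE// ?(ltW T0)//; first exact: ltW.
    by rewrite ger0_norm ?subr_ge0// lerBlDr (le_trans tT')// lerDl.
  have h1 := I1Xi s t s0 st tT'; have h2 := cball_scale 2^-1 (I2Xi s t s0 st tT').
  have h3 := cball_opa (norm_liftL hpt V (XX s t)) (rough_coef_deriv_bound C0 K0 K1 K2 (Kin sT)).
  have h4 := cball_scale 2^-1 (cball_opa (norm_liftL hpt V (Q s t)) (young_coef_bound C0 K0 K2 (Kin sT))).
  have h5 := RG_bound C0 K0 K1 K2 df dF1 (sg sT tT).
  have h := cball_add (cball_add (cball_add h1 h2) (cball_add h3 h4)) h5.
  apply: (cball_eq (erefl _) _ (cball_le w0 _ h)) => [p|].
    exact: area_split.
  have x1 := hX sT tT; have x2 := hXX sT tT; have x3 := hQ sT tT.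
  rewrite -/(rho s t) in x1 x2.
  rewrite rho3//; move: (rho s t) (rho0 s t) x1 x2 x3 rT => r r0 x1 x2 x3 rT.
  have r3 : r ^+ 3 <= T `^ alpha * r ^+ 2 by rewrite exprS ler_wpM2r// sqr_ge0.
  have e1 : k1 * r ^+ 3 <= k1 * T `^ alpha * r ^+ 2 by rewrite -mulrA ler_wpM2l.
  have e2 : `|2^-1 : R| * (k2 * r ^+ 3) <= 2^-1 * (k2 * T `^ alpha) * r ^+ 2.
    have e2' : k2 * r ^+ 3 <= k2 * T `^ alpha * r ^+ 2 by rewrite -mulrA ler_wpM2l.
    by rewrite ger0_norm ?invr_ge0//; lra.
  have e3 : `|XX s t| * (2 * (2 ^+ m * C ^+ 2)) <= c * D * r ^+ 2.
    by rewrite mulrAC ler_pM ?mulr_ge0// ?sqr_ge0.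
  have e4 : `|2^-1 : R| * (`|Q s t| * (2 ^+ m * C ^+ 2)) <= 2^-1 * (cQ * D) * r ^+ 2.
    have e4' : `|Q s t| * (2 ^+ m * C ^+ 2) <= cQ * D * r ^+ 2.
      by rewrite mulrAC ler_pM ?mulr_ge0// ?sqr_ge0.
    by rewrite ger0_norm ?invr_ge0//; lra.
  have e5 : 2 ^+ m * C ^+ 2 * `|X t - X s| ^+ 2 <= D * c ^+ 2 * r ^+ 2.
    rewrite -[leRHS]mulrA -exprMn ler_pM ?mulr_ge0// ?sqr_ge0//.
    by rewrite lerXn2r// nnegrE// mulr_ge0.
  have e6 := lerD (lerD (lerD e1 e2) (lerD e3 e4)) e5.
  have e7 : k1 * T `^ alpha * r ^+ 2 + 2^-1 * (k2 * T `^ alpha) * r ^+ 2 +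
    (c * D * r ^+ 2 + 2^-1 * (cQ * D) * r ^+ 2) + D * c ^+ 2 * r ^+ 2 = k * r ^+ 2.
    by rewrite /k; ring.
  by rewrite e7 in e6.
have Dc0 : 0 <= D * c ^+ 2 by rewrite mulr_ge0// sqr_ge0.
exists J, (k + D * c ^+ 2); split=> //.
  by move=> s u t p sT uT tT; rewrite /J !orientE// !scalerBr; abel.
move=> s t sT tT; have [st|ts] := leP s t.
  apply: (cball_eq (erefl _) _ (cball_le w0 _ (le_st s t st sT tT))) => [p|].
    by rewrite areaE// /J /orient st.
  by rewrite ler_wpM2r ?sqr_ge0// lerDl.
have h := cball_add (cball_opp (le_st t s (ltW ts) tT sT))
  (dfdf_bound C0 K0 K1 df (sg tT sT)).
apply: (cball_eq (erefl _) _ (cball_le w0 _ h)) => [p|].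
  by rewrite areaE// /J /orient leNgt ts /=; exact: area_swap.
have x1 := hX tT sT; rewrite -/(rho t s) in x1.
have -> : rho s t = rho t s by rewrite /rho distrC.
rewrite [leRHS]mulrDl lerD2l -[leRHS]mulrA -exprMn ler_pM ?mulr_ge0// ?sqr_ge0//.
by rewrite lerXn2r// nnegrE// mulr_ge0.
Qed.

End Main.

(** * The nonlinear rough path *)

Lemma sum_sup_fin {R : realType} (I : nat) (A : 'I_I -> set (\bar R)) (B : 'I_I -> R) :
  (forall k x, A k x -> (x <= (B k)%:E)%E) ->
  (\sum_(k < I) ereal_sup (A k) < +oo)%E.
Proof.
move=> AB; apply: lte_sum_pinfty => k _.
apply: (@le_lt_trans _ _ (B k)%:E); last exact: ltry.
by apply: ge_ereal_sup => x; exact: AB.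
Qed.

Unset Implicit Arguments.

Theorem proposition5p2 (R : realType) (T alpha : R)
    (V E : completeNormedModType R) (ot : {bilinear V -> V -> E})
    (n : nat) (beta : nat -> R) (f : V -> V -> V)
    (X : R -> V) (XX : R -> R -> E) :
  0 < T -> 1 / 3 < alpha <= 1 / 2 ->
  separable V -> projective_tensor ot ->
  (1 <= n)%N -> (forall k, (k <= n)%N -> 0 <= beta k) ->
  Cloc 3 n beta f ->
  rough_path T alpha ot X XX ->
  let W := fun (t : R) (x : V) => f (X t) x in
  let g := fun (t : R) (y : V) => D2 f (X t) y in
  let h := fun (x y z : V) => D2 (D1 f) z y (f z x) in
  let WW := fun (s t : R) (x y : V) =>
    rough_integral ot X XX
      (fun r => h x y (X r)) (fun r => fderive (h x y) (X r)) s t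
    + 2^-1 *: young_integral ot
      (fun r => D2 (D1 (D1 f)) (X r) y (f (X r) x)) (compensator ot X XX) s t
    - (g t y - g s y) (f (X s) x) in
  nonlinear_rough_path T alpha n beta W WW.
Proof.
move=> T0 /andP[alpha3 _] _ hpt n1 _ fC [[C1 hX1] [C2 hXX2] chen] W g h WW.
case: n n1 fC => // m _ fC.
have alpha0 : 0 < alpha by apply: lt_trans alpha3; rewrite divr_gt0.
have powE (s t : R) : `|t - s| `^ (2 * alpha) = (`|t - s| `^ alpha) ^+ 2.
  exact: powR_nat_mul.
pose c := `|C1| + `|C2|.
have c0 : 0 <= c by rewrite addr_ge0.
have hX s t : s \in `[0, T] -> t \in `[0, T] -> `|X t - X s| <= c * `|t - s| `^ alpha.
  move=> sT tT; apply: le_trans (hX1 s t sT tT) _; rewrite ler_wpM2r ?powR_ge0//.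
  by rewrite (le_trans (ler_norm _))// lerDl.
have hXX s t : s \in `[0, T] -> t \in `[0, T] -> `|XX s t| <= c * (`|t - s| `^ alpha) ^+ 2.
  move=> sT tT; have [st|st] := eqVneq s t.
    have -> : XX s t = 0.
      have := chen t t t tT tT tT; rewrite st !subrr linear0r sub0r => /eqP.
      by rewrite oppr_eq0 => /eqP.
    by rewrite normr0 mulr_ge0// sqr_ge0.
  have := hXX2 s t sT tT st; rewrite powE ler_pdivrMr; last first.
    by rewrite exprn_gt0// powR_gt0// normr_gt0 subr_eq0 eq_sym.
  move=> /le_trans; apply; rewrite ler_wpM2r ?sqr_ge0//.
  by rewrite (le_trans (ler_norm _))// lerDr.
have T0in : (0 : R) \in `[0, T] by rewrite in_itv/= lexx ltW.
have sg s t : s \in `[0, T] -> t \in `[0, T] -> segment_in (chords T X) (X s) (X t).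
  exact: chords_seg.
have [C C0 FC] := Cloc_fam fC (chords_compact T0 alpha0 hX)
  (ex_intro _ _ (segment_in_l (sg 0 0 T0in T0in))).
have K0 : Cfam m.+1 (chords T X) C (weight beta) f := FC 0%N isT.
have K1 : Cfam m.+1 (chords T X) C (weight beta) (D1 f) := FC 1%N isT.
have K2 : Cfam m.+1 (chords T X) C (weight beta) (D1 (D1 f)) := FC 2%N isT.
have K3 : Cfam m.+1 (chords T X) C (weight beta) (D1 (D1 (D1 f))) := FC 3%N isT.
have [[dD _ _] _] := fC.
have df z y : differentiable (f^~ y) z := dD 0%N isT z y.
have dF1 z y : differentiable ((D1 f)^~ y) z := dD 1%N isT z y.
have dF2 z y : differentiable ((D1 (D1 f))^~ y) z := dD 2%N isT z y.
have Kin s : s \in `[0, T] -> chords T X (X s) by move=> sT; exact: segment_in_l (sg s s sT sT).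
have df_fam s t : s \in `[0, T] -> t \in `[0, T] ->
    cball m.+1 (weight beta) (C * `|X t - X s|) (fun y => f (X t) y - f (X s) y).
  by move=> sT tT; exact: (df_bound K0 K1 df (sg s t sT tT)).
have [J [M [Jadd areaE areaB]]] :=
  area_spec hpt T0 alpha3 c0 hX hXX chen C0 K0 K1 K2 K3 df dF1 dF2.
have WWE s t x y : WW s t x y = area ot f X XX s t (x, y) by [].
split.
- split.
    by move=> t tT; have [] := cballP (Cfam_cball (Kin t tT) K0).
  apply: (sum_sup_fin (B := fun _ => C * c)) => k _ [[[s t] x] [[/= sT tT st] _] <-].
  rewrite lee_fin.
  have [_ /(_ k (leq_ord k) x) b] := cballP (df_fam s t sT tT).
  have r0 : 0 < `|t - s| `^ alpha by rewrite powR_gt0// normr_gt0 subr_eq0 eq_sym.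
  have w0 : 0 < (1 + `|x|) `^ beta k by rewrite powR_gt0// ltr_pwDl.
  rewrite !powRN ler_pdivrMr// ler_pdivrMr//.
  apply: le_trans b _; rewrite /weight.
  rewrite [leRHS](_ : _ = C * (c * `|t - s| `^ alpha) * (1 + `|x|) `^ beta k); last by ring.
  by rewrite ler_wpM2r ?(ltW w0)// ler_wpM2l// hX.
- have WWf s t : uncurry2 WW s t = area ot f X XX s t.
    by apply/funext => -[x y].
  split.
    by move=> s t sT tT; rewrite WWf; have [] := cballP (areaB s t sT tT).
  apply: (sum_sup_fin (B := fun _ => M)) => k _ [[[s t] [x y]] [[/= sT tT st] _] <-].
  rewrite lee_fin WWf.
  have [_ /(_ k (leq_ord k) (x, y)) b] := cballP (areaB s t sT tT).
  have r0 : 0 < (`|t - s| `^ alpha) ^+ 2.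
    by rewrite exprn_gt0// powR_gt0// normr_gt0 subr_eq0 eq_sym.
  have w1 : 0 < (1 + `|x|) `^ beta_star beta k by rewrite powR_gt0// ltr_pwDl.
  have w2 : 0 < (1 + `|y|) `^ beta_sstar beta k by rewrite powR_gt0// ltr_pwDl.
  rewrite !powRN powE ler_pdivrMr// ler_pdivrMr// ler_pdivrMr//.
  apply: le_trans b _; rewrite /weight2 /weight /= le_eqVlt; apply/orP; left; apply/eqP; ring.
move=> x y s u t sT uT tT.
rewrite !WWE !areaE// (Jadd s u t)//=.
have dfy z : is_fderive (f z) y (D2 f z y) by exact: (Cfam_is_fderive K0).
have /is_fderiveP[_ e] := is_fderive_sub (dfy (X t)) (dfy (X u)).
apply: etrans (area_chen _ _ _ _ _ _ _) _; apply/esym.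
exact: (congr1 (fun L : 'L(V; V) => L (f (X u) x - f (X s) x)) e).
Qed.
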